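(* Let $C:f=0$ be a reduced curve of degree $d$ in $\mathbb{P}^2$ over $\mathbb{C}$, and let $r=\mathrm{mdr}(f)$. If $r\ge d/2$, then the following hold for all integers $j$ with $2d-4-r\le j\le d-2+r$. (1) For $d=2d'+1$ odd, one has $T=3(d-2)=6d'-3$ and $$n(f)_j=3(d')^2-(j-3d'+2)(j-3d'+1)-\tau(C)=\nu(C)-(j-\lfloor T/2\rfloor)(j-\lceil T/2\rceil).$$ (2) For $d=2d'$ even, one has $T=3(d-2)=6d'-6$ and $$n(f)_j=3(d')^2-3d'+1-(j-3d'+3)^2-\tau(C)=\nu(C)-\left(j-\frac{T}{2}\right)^2.$$
   Context: $S=\mathbb{C}[x,y,z]$ with the usual grading; $f\in S_d$ is the reduced homogeneous equation of $C$; $f_x,f_y,f_z$ are its partial derivatives. $AR(f)_k=\{(a,b,c)\in S_k^3: af_x+bf_y+cf_z=0\}$ and $\mathrm{mdr}(f)=\min\{k: AR(f)_k\neq 0\}$. $J_f=(f_x,f_y,f_z)$ is the Jacobian ideal, $\widehat{J}_f$ its saturation with respect to $(x,y,z)$, $N(f)=\widehat{J}_f/J_f$ the graded Jacobian module, and $n(f)_j=\dim_{\mathbb{C}} N(f)_j$. With $T=3(d-2)$, one sets $\nu(C)=\dim N(f)_{\lfloor T/2\rfloor}$. $\tau(C)=\sum_{p\in C}\tau(C,p)$ is the global Tjurina number of $C$, the sum of the Tjurina numbers of the singularities of $C$. *)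

(* Defs.v *)
From HB Require Import structures.
From mathcomp Require Import all_boot all_order all_algebra fraction.
From mathcomp Require Import boolp classical_sets fsbigop reals.
From mathcomp Require Import complex mpoly.

Set Implicit Arguments.
Unset Strict Implicit.
Unset Printing Implicit Defensive.

Import Order.TTheory GRing.Theory Num.Theory.
Local Open Scope classical_set_scope.
Local Open Scope ring_scope.

Section QuotientDimension.
Variables (K : fieldType) (V : lmodType K).
Implicit Types A B : set V.

(* For subspaces B `<=` A: A / B has a basis with n elements, i.e. every v in A
   is congruent modulo B to a unique linear combination of e_0, ..., e_(n-1). *)
Definition has_quot_dim A B (n : nat) : Prop :=
  exists e : 'I_n -> V, (forall i, A (e i)) /\
    forall v, A v -> exists! c : 'rV[K]_n, B (v - \sum_i c 0 i *: e i).

(* dim (A / B); by convention 0 when A / B is infinite-dimensional. *)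
Definition quot_dim A B : nat := xget 0%N [set n | has_quot_dim A B n].

End QuotientDimension.

Section JacobianModule.
Variable K : fieldType.
Local Notation S := {mpoly K[3]}.
Implicit Types f g : S.

Definition reduced_poly f : Prop :=
  f != 0 /\ forall g h, f = g ^+ 2 * h -> g \is a GRing.unit.

Definition AR f (k : nat) : set {ffun 'I_3 -> S} :=
  [set t | (forall i, t i \is k.-homog) /\ \sum_(i < 3) t i * f^`M(i) = 0].

(* For homogeneous f the minimum exists (some Koszul syzygy is nonzero, unless
   all the partial derivatives vanish), so the default value 0 is not used. *)
Definition mdr f : nat :=
  xget 0%N [set r | (exists2 t, AR f r t & t != 0) /\
                    forall k t, AR f k t -> t != 0 -> (r <= k)%N].

Definition jacobian_ideal f : set S :=
  [set g | exists h : 'I_3 -> S, g = \sum_(i < 3) h i * f^`M(i)].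

(* I : m^oo with m = (x, y, z); m^k is generated by the monomials of degree k. *)
Definition saturation (I : set S) : set S :=
  [set g | exists k, forall m : 'X_{1..3}, mdeg m = k -> I ('X_[m] * g)].

Definition homog_part (I : set S) (j : nat) : set S :=
  [set g | I g /\ g \is j.-homog].

(* The graded piece N(f)_j is indexed by all integers; it is 0 for j < 0. *)
Definition n_ f (j : int) : nat :=
  match j with
  | Posz k => quot_dim (homog_part (saturation (jacobian_ideal f)) k)
                       (homog_part (jacobian_ideal f) k)
  | Negz _ => 0%N
  end.

Definition socle_degree (d : nat) : int := 3 * (d%:Z - 2).

Definition nu f (d : nat) : nat :=
  n_ f (Num.floor ((socle_degree d)%:~R / 2 : rat)).

End JacobianModule.

(* The function field K(u, v), as a K-vector space. *)
Definition ratfun (K : fieldType) : Type := {fraction {mpoly K[2]}}.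
HB.instance Definition _ (K : fieldType) := GRing.Field.on (ratfun K).

Section RatfunLmodule.
Variable K : fieldType.

Definition ratfun_scale (c : K) (z : ratfun K) : ratfun K :=
  FracField.tofrac (c%:MP : {mpoly K[2]}) * z.

Lemma ratfun_scaleA a b z :
  ratfun_scale a (ratfun_scale b z) = ratfun_scale (a * b) z.
Proof. by rewrite /ratfun_scale mulrA -tofracM -mpolyCM. Qed.

Lemma ratfun_scale1 : left_id 1 ratfun_scale.
Proof. by move=> z; rewrite /ratfun_scale mpolyC1 tofrac1 mul1r. Qed.

Lemma ratfun_scaleDr : right_distributive ratfun_scale +%R.
Proof. by move=> c y z; rewrite /ratfun_scale mulrDr. Qed.

Lemma ratfun_scaleDl z : {morph ratfun_scale^~ z : a b / a + b}.
Proof. by move=> a b; rewrite /ratfun_scale mpolyCD tofracD mulrDl. Qed.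

HB.instance Definition _ := GRing.Zmodule_isLmodule.Build K (ratfun K)
  ratfun_scaleA ratfun_scale1 ratfun_scaleDr ratfun_scaleDl.

End RatfunLmodule.

Section LocalTjurina.
Variable K : fieldType.
Local Notation P := {mpoly K[2]}.
Local Notation "p %:F" := (FracField.tofrac p : ratfun K).

(* The local ring of the affine plane at the origin, K[u, v]_(u, v). *)
Definition local_ring : set (ratfun K) :=
  [set z | exists a b : P, b.@[fun=> 0] != 0 /\ z = a%:F / b%:F].

(* The ideal (g, g_u, g_v) of this local ring. *)
Definition tjurina_ideal (g : P) : set (ratfun K) :=
  [set z | exists a : ratfun K, exists h : 'I_2 -> ratfun K,
     [/\ local_ring a, forall i, local_ring (h i)
       & z = a * g%:F + \sum_(i < 2) h i * (g^`M(i))%:F]].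

Definition tjurina_at_origin (g : P) : nat :=
  quot_dim local_ring (tjurina_ideal g).

End LocalTjurina.

Section GlobalTjurina.
Variable K : fieldType.

(* Points of the projective plane are the lines through 0 in K^3. *)
Definition proj_plane : Type := {U : {vspace 'rV[K]_3} | \dim U == 1%N}.
HB.instance Definition _ := Choice.on proj_plane.

(* Homogeneous coordinates of a point: some nonzero vector on the line. *)
Definition hcoord (p : proj_plane) : 'rV[K]_3 := vpick (val p).

(* A coordinate that does not vanish at p, selecting an affine chart. *)
Definition chart (p : proj_plane) : 'I_3 :=
  odflt ord0 [pick i | hcoord p 0 i != 0].

(* Affine equation of the curve near p, with p moved to the origin: the chart
   coordinate is frozen at its value p_i at p, and each other coordinate x_k
   becomes p_k plus one of the two local coordinates. *)
Definition local_equation (f : {mpoly K[3]}) (p : proj_plane) : {mpoly K[2]} :=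
  f \mPo [tuple (hcoord p 0 k)%:MP
                + (if unlift (chart p) k is Some l then 'X_l else 0) | k < 3].

Definition curve (f : {mpoly K[3]}) : set proj_plane :=
  [set p | f.@[hcoord p 0] = 0].

Definition tjurina (f : {mpoly K[3]}) (p : proj_plane) : nat :=
  tjurina_at_origin (local_equation f p).

(* Smooth points contribute 0, so that for a reduced curve over an
   algebraically closed field of characteristic 0 this is a finite sum. *)
Definition global_tjurina (f : {mpoly K[3]}) : nat :=
  \sum_(p \in curve f) tjurina f p.

End GlobalTjurina.

(* Main.v *)
(* Let e = d - 1. Since f is reduced, the discriminant of its restrictions to the
   lines of a pencil does not vanish identically, so some line ell = 0 avoids the
   singular points of C; hence two combinations a, b of the partial derivatives
   restrict to coprime binary forms on it, and a, b, ell is a regular sequence.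
   Let c be the remaining derivative, A = S/(a, b) dehomogenized by ell = 1, and
   F_k the image of S_k in A. The residue of binary forms of degree 2e - 2 makes
   A a Gorenstein algebra of which F_k and F_(2e-3-k) are orthogonal complements.
   Put k = 2e - 3 - j. If there are no syzygies of degree k < r, then
   multiplication by c is injective from F_k to A, so dually it maps A onto
   A / F_j, i.e. S_j maps onto A / cA.  The kernel of this map is the degree j
   part of the saturation of J_f, and A / cA is the product of the local Tjurina
   algebras, so that dim (S / sat J_f)_j = tau(C). If moreover j - e < r, the three
   derivatives have no syzygies of degree j - e and dim (J_f)_j = 3 dim S_(j-e).
   Hence n(f)_j = dim S_j - 3 dim S_(j-e) - tau(C). *)
Require Import Defs.
From HB Require Import structures.
From mathcomp Require Import all_boot all_order all_algebra fraction separable ring lra zify.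
From mathcomp Require Import boolp classical_sets fsbigop.
From mathcomp Require Import reals complex mpoly.
Set Implicit Arguments.
Unset Strict Implicit.
Unset Printing Implicit Defensive.
Import Order.TTheory GRing.Theory Num.Theory.
Local Open Scope ring_scope.
Local Notation o0 := (@Ordinal 3 0 isT).
Local Notation o1 := (@Ordinal 3 1 isT).
Local Notation o2 := (@Ordinal 3 2 isT).

(** * Quotient dimensions *)

Section QuotDimTheory.
Variables (K : fieldType) (V : lmodType K).
Implicit Types A B C : set V.
Local Open Scope classical_set_scope.

(** Neither the algebra [A] nor its quotients are built. A class of [A] is represented by forms of
    arbitrarily high degree, multiplication by [ell] being the identification between degrees; this
    is faithful because [ell] is regular modulo [(a, b)]. The dualities become statements about
    forms of one large degree [N], and linear algebra is needed only on the side of degree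
    [2e - 3 - j].

    The obstacle is to relate [A / cA] to the Tjurina algebras, which are defined by fractions at
    each point of the curve. Finite dimension of [A] yields, for each variable, a product of forms
    [X_k - z ell] that lies in the Jacobian ideal up to a power of [ell]. These products confine the
    singular points to a finite grid, make the local coordinates nilpotent, and allow an induction
    on the grid in place of the general Nullstellensatz.

    The condition [r >= d/2] makes [r] positive and places the degree [floor (T / 2)] in the range
    of validity, so that [nu] is a value of the same polynomial in [j]. *)

Definition subspace A : Prop :=
  A 0 /\ forall (a : K) u v, A u -> A v -> A (a *: u + v).

Lemma subspaceD A u v : subspace A -> A u -> A v -> A (u + v).
Proof. by case=> _ h hu hv; rewrite -[u]scale1r; apply: h. Qed.

Lemma subspaceZ A a u : subspace A -> A u -> A (a *: u).
Proof. by case=> h0 h hu; rewrite -[_ *: _]addr0; apply: h. Qed.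

Lemma subspaceN A u : subspace A -> A u -> A (- u).
Proof. by move=> hA hu; rewrite -scaleN1r; apply: subspaceZ. Qed.

Lemma subspaceB A u v : subspace A -> A u -> A v -> A (u - v).
Proof. by move=> hA hu hv; apply: subspaceD => //; apply: subspaceN. Qed.

Lemma subspace_sum A (I : Type) (r : seq I) (P : pred I) (F : I -> V) :
  subspace A -> (forall i, P i -> A (F i)) -> A (\sum_(i <- r | P i) F i).
Proof.
move=> hA hF; elim/big_rec: _ => [|i x Pi Ax]; first by case: hA.
by apply: subspaceD => //; apply: hF.
Qed.

Lemma subspaceC A u v : subspace A -> A (u - v) -> A v -> A u.
Proof. by move=> hA h1 h2; rewrite -[u](subrK v); apply: subspaceD. Qed.

(** By linearity, unique coordinates for every vector amount to existence for every vector and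
    uniqueness for 0. *)
Lemma has_quot_dimP A B n : subspace B -> B `<=` A ->
  has_quot_dim A B n <->
  exists e : 'I_n -> V,
    [/\ forall i, A (e i),
        forall v, A v -> exists c : 'I_n -> K, B (v - \sum_i c i *: e i)
      & forall c : 'I_n -> K, B (\sum_i c i *: e i) -> forall i, c i = 0].
Proof.
move=> sB BA; split=> -[e].
- case=> Ae h; exists e; split=> // [v /h[c [hc _]]|c hc].
    by exists (c 0).
  case: (h 0) => [|c0 [_ uniq]]; first by apply: BA; case: sB.
  move=> i; have h1: c0 = 0.
    apply: uniq; rewrite big1 ?subr0; first by case: sB.
    by move=> k _; rewrite mxE scale0r.
  have h2: c0 = - (\row_j c j).
    apply: uniq; rewrite sub0r -sumrN.
    by under eq_bigr do rewrite !mxE scaleNr opprK.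
  move: h2; rewrite h1 => /eqP; rewrite eq_sym oppr_eq0 => /eqP/rowP/(_ i).
  by rewrite !mxE.
- case=> Ae hspan hfree; exists e; split=> // v /hspan[c hc].
  exists (\row_j c j); split=> [|c' hc'].
    by under eq_bigr do rewrite mxE.
  apply/rowP => i; rewrite mxE; apply/eqP; rewrite -subr_eq0; apply/eqP.
  apply: (hfree (fun i => c i - c' 0 i)).
  have -> : \sum_i (c i - c' 0 i) *: e i =
     (v - \sum_i c' 0 i *: e i) - (v - \sum_i c i *: e i).
    under eq_bigr do rewrite scalerBl.
    by rewrite sumrB opprB [RHS]addrC addrA subrK.
  exact: subspaceB.
Qed.

Lemma sum_enum_val (T : finType) (F : T -> V) :
  \sum_(i < #|T|) F (enum_val i) = \sum_t F t.
Proof.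
by rewrite [RHS](reindex (@enum_val T T)) //; apply: onW_bij; apply: enum_val_bij.
Qed.

Lemma has_quot_dim_fin A B (T : finType) (e : T -> V) :
    subspace B -> B `<=` A -> (forall t, A (e t)) ->
    (forall v, A v -> exists c : T -> K, B (v - \sum_t c t *: e t)) ->
    (forall c : T -> K, B (\sum_t c t *: e t) -> forall t, c t = 0) ->
  has_quot_dim A B #|T|.
Proof.
move=> sB BA Ae hspan hfree; apply/has_quot_dimP => //.
exists (fun i => e (enum_val i)); split=> [i|v /hspan[c hc]|c hc i]; first exact: Ae.
- exists (c \o enum_val) => /=.
  by rewrite -sum_enum_val in hc.
- have := hfree (c \o enum_rank); rewrite /= -sum_enum_val.
  under eq_bigr do rewrite enum_valK.
  by move=> /(_ hc (enum_val i)); rewrite enum_valK.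
Qed.

(** A trivial left kernel means full row rank. The contrapositive later produces nontrivial
    relations by counting. *)
Lemma rank_leq_free m n (c : 'I_m -> 'I_n -> K) :
  (forall x : 'I_m -> K, (forall j, \sum_i x i * c i j = 0) -> forall i, x i = 0) ->
  (m <= n)%N.
Proof.
move=> h; pose M := \matrix_(i, j) c i j.
suff /eqP <- : row_free M by apply: rank_leq_col.
rewrite -kermx_eq0; apply/eqP/row_matrixP => k; rewrite row0.
have : row k (kermx M) *m M = 0.
  by apply: sub_kermxP; apply: row_sub.
move: (row k _) => w hw; apply/rowP=> i; rewrite mxE; apply: (h (w 0)) => j.
by move/rowP/(_ j): hw; rewrite !mxE; under eq_bigr do rewrite mxE.
Qed.

Lemma has_quot_dim_le A B n (T : finType) (e : T -> V) :
    subspace B -> B `<=` A -> has_quot_dim A B n ->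
    (forall v, A v -> exists c : T -> K, B (v - \sum_t c t *: e t)) ->
  (n <= #|T|)%N.
Proof.
move=> sB BA /(has_quot_dimP _ sB BA)[b [Ab _ hfree]] hspan.
have /choice[c hc] : forall i, exists c : T -> K, B (b i - \sum_t c t *: e t).
  by move=> i; apply: hspan.
apply: (@rank_leq_free n #|T| (fun i j => c i (enum_val j))) => x hx.
apply: hfree.
apply: (@subspaceC _ _ (\sum_i x i *: \sum_t c i t *: e t)) => //.
  rewrite -sumrB; apply: subspace_sum => // i _.
  by rewrite -scalerBr; apply: subspaceZ.
under eq_bigr do rewrite scaler_sumr.
rewrite exchange_big big1 /=; first by case: sB.
move=> t _; under eq_bigr do rewrite scalerA.
by rewrite -scaler_suml -(enum_rankK t) hx scale0r.
Qed.

Lemma has_quot_dim_uniq A B m n : subspace B -> B `<=` A ->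
  has_quot_dim A B m -> has_quot_dim A B n -> m = n.
Proof.
move=> sB BA hm hn; apply/eqP; rewrite eqn_leq.
have [em [_ sm _]] := (has_quot_dimP _ sB BA).1 hm.
have [en [_ sn _]] := (has_quot_dimP _ sB BA).1 hn.
by have := has_quot_dim_le sB BA hm sn; have := has_quot_dim_le sB BA hn sm;
  rewrite !card_ord => -> ->.
Qed.

Lemma quot_dimE A B n : subspace B -> B `<=` A ->
  has_quot_dim A B n -> quot_dim A B = n.
Proof.
move=> sB BA h; apply: (has_quot_dim_uniq sB BA _ h).
exact: (xgetPex 0%N (P := [set n | has_quot_dim A B n]) (ex_intro _ n h)).
Qed.

(* A spanning family of minimal length is free. *)
Lemma has_quot_dim_ex A B (T : finType) (e : T -> V) :
    subspace B -> B `<=` A -> (forall t, A (e t)) ->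
    (forall v, A v -> exists c : T -> K, B (v - \sum_t c t *: e t)) ->
  exists n, has_quot_dim A B n.
Proof.
move=> sB BA Ae hspan.
pose P n := `[< exists e : 'I_n -> V, (forall i, A (e i)) /\
  forall v, A v -> exists c : 'I_n -> K, B (v - \sum_i c i *: e i) >].
have exP : exists n, P n.
  exists #|T|; apply/asboolP; exists (fun i => e (enum_val i)).
  split=> // v /hspan[c hc]; exists (c \o enum_val).
  by rewrite -sum_enum_val in hc.
case: (ex_minnP exP) => n /asboolP[b [Ab hb]] nmin; exists n.
apply/has_quot_dimP => //; exists b; split=> // c hc i.
apply/eqP; apply: contraT => ci0; suff: (n < n)%N by rewrite ltnn.
case: n => [|n] in b Ab hb nmin c hc i ci0 *; first by case: i {ci0}.
apply: (nmin n); apply/asboolP; exists (fun k => b (lift i k)); split=> // v /hb[x hx].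
(* Since [c i] is nonzero, the relation expresses [b i] through the other vectors; substituting it
   leaves these coefficients. *)
exists (fun k => x (lift i k) - x i / c i * c (lift i k)).
apply: (@subspaceC _ _ (v - \sum_i x i *: b i)) => //.
have -> : v - \sum_(k < n) (x (lift i k) - x i / c i * c (lift i k)) *: b (lift i k)
    - (v - \sum_k x k *: b k) = (x i / c i) *: \sum_k c k *: b k.
  rewrite addrC opprB addrA subrK.
  rewrite (bigD1_ord i) //= (bigD1_ord i (F := fun k => c k *: b k)) //=.
  rewrite scalerDr scalerA divfK // -addrA; congr (_ + _).
  rewrite scaler_sumr -sumrB; apply: eq_bigr => k _.
  by rewrite scalerBl opprB addrC subrK scalerA.
exact: subspaceZ.
Qed.

(** Take a matrix of maximal rank with rows in [W]: a vector of [W] outside its row space could be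
    adjoined and would raise the rank. *)
Lemma subspace_mx n (W : 'rV[K]_n -> Prop) :
  W 0 -> (forall a u v, W u -> W v -> W (a *: u + v)) ->
  exists M : 'M[K]_n, forall v, W v <-> (v <= M)%MS.
Proof.
move=> W0 WD.
have Wsum m (M : 'M_(m, n)) v :
    (forall i, W (row i M)) -> (v <= M)%MS -> W v.
  move=> hM /submxP[D ->]; rewrite mulmx_sum_row.
  elim/big_rec: _ => [|i x _ Wx]; first exact: W0.
  exact: WD.
pose P r := `[< exists M : 'M[K]_n, \rank M = r /\ forall i, W (row i M) >].
have exP : exists r, P r.
  exists 0%N; apply/asboolP; exists 0; rewrite mxrank0; split=> // i.
  by rewrite row0.
have ub r : P r -> (r <= n)%N.
  by move=> /asboolP[M [<- _]]; apply: rank_leq_row.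
case: (ex_maxnP exP ub) => r /asboolP[M [rM hM]] rmax; exists M => v.
split=> [Wv|/Wsum]; last exact.
apply/negPn/negP => nv.
have sM : (M <= M + v)%MS by apply: addsmxSl.
have : (\rank (M + v)%MS <= r)%N.
  apply: rmax; apply/asboolP; exists (M + v)%MS; split=> // i.
  apply: (Wsum _ (col_mx M v)); last by rewrite -addsmxE row_sub.
  move=> k; rewrite -[k](splitK) /unsplit; case: (split k) => j.
    by rewrite rowKu.
  by rewrite rowKd row_id.
rewrite -rM => h; have := mxrank_leqif_sup sM.
case=> _; rewrite eqn_leq mxrankS // h /= => /esym hv.
by move/negP: nv; apply; apply: submx_trans hv; apply: addsmxSr.
Qed.

(** In coordinates with respect to a basis of [A / C], the subspace [B] is the row space of a matrix
    [M]; row bases of [M] and of its complement give bases of [B / C] and [A / B]. Finiteness of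
    both is thus part of the conclusion. *)
Lemma has_quot_dim_sub A B C m :
    subspace A -> subspace B -> subspace C -> C `<=` B -> B `<=` A ->
    has_quot_dim A C m ->
  exists2 n, (n <= m)%N & has_quot_dim B C n /\ has_quot_dim A B (m - n).
Proof.
move=> sA sB sC CB BA; have CA : C `<=` A by move=> x /CB/BA.
case/(has_quot_dimP _ sC CA) => e [Ae hspan hfree].
pose lc (v : 'rV[K]_m) := \sum_i v 0 i *: e i.
have lcD a u v : lc (a *: u + v) = a *: lc u + lc v.
  rewrite /lc scaler_sumr -big_split /=; apply: eq_bigr => i _.
  by rewrite !mxE scalerDl scalerA.
have lc0 : lc 0 = 0 by rewrite /lc big1 // => i _; rewrite mxE scale0r.
have lcM n (M : 'M_(n, m)) (c : 'I_n -> K) :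
    \sum_i c i *: lc (row i M) = lc ((\row_i c i) *m M).
  rewrite mulmx_sum_row.
  have lc_sum (s : seq 'I_n) (F : 'I_n -> 'rV_m) :
      lc (\sum_(i <- s) c i *: F i) = \sum_(i <- s) c i *: lc (F i).
    by elim: s => [|x s IH]; rewrite ?big_nil ?lc0 // !big_cons lcD IH.
  by rewrite -lc_sum; congr lc; apply: eq_bigr => i _; rewrite mxE.
have lcA v : A (lc v).
  by apply: subspace_sum => // i _; apply: subspaceZ.
have rowE n (x : 'rV[K]_n) : \row_i x 0 i = x.
  by apply/rowP => i; rewrite mxE.
have lcspan v : A v -> exists w, C (v - lc w).
  move=> /hspan[c hc]; exists (\row_i c i); rewrite /lc.
  by under eq_bigr do rewrite mxE.
have lcfree w : C (lc w) -> w = 0.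
  by move=> /(hfree (w 0)) h; apply/rowP => i; rewrite mxE.
have [|a u v hu hv|M hM] := @subspace_mx m (fun v => B (lc v)).
- by rewrite lc0; case: sB.
- by rewrite lcD; apply: subspaceD => //; apply: subspaceZ.
exists (\rank M); first exact: rank_leq_row.
split; [apply/has_quot_dimP => //|rewrite -mxrank_compl; apply/has_quot_dimP => //].
- exists (fun i => lc (row i (row_base M))); split=> [i|v Bv|c].
  + by apply/hM; apply: submx_trans (row_sub _ _) _; rewrite eq_row_base.
  + have [w hw] := lcspan v (BA _ Bv).
    have : (w <= row_base M)%MS.
      rewrite eq_row_base; apply/hM; rewrite -[lc w](subKr v).
      by apply: subspaceB => //; apply: CB.
    by case/submxP => x wE; exists (x 0); rewrite lcM rowE -wE.
  + rewrite lcM => /lcfree; rewrite -[RHS](mul0mx _ (row_base M)).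
    move=> /(row_free_inj (row_base_free M)) h i.
    by move/rowP: h => /(_ i); rewrite !mxE.
- exists (fun i => lc (row i (row_base M^C%MS))); split=> [i|v Av|c].
  + exact: lcA.
  + have [w hw] := lcspan v Av.
    have : (w <= M + M^C)%MS by apply: submx_full; apply: addsmx_compl_full.
    case/sub_addsmxP=> -[u1 u2] /= wE.
    have : (u2 *m M^C%MS <= row_base M^C%MS)%MS by rewrite eq_row_base submxMl.
    case/submxP => x xE; exists (x 0); rewrite lcM rowE -xE.
    have -> : v - lc (u2 *m M^C%MS) = (v - lc w) + lc (u1 *m M).
      by rewrite wE -[u1 *m M]scale1r lcD !scale1r opprD addrA [RHS]addrAC subrK.
    by apply: subspaceD => //; [apply: CB|apply/hM; apply: submxMl].
  + rewrite lcM => /hM h.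
    have : (\row_i c i *m row_base M^C%MS <= M :&: M^C)%MS.
      rewrite sub_capmx h /=; apply: submx_trans (submxMl _ _) _.
      by rewrite eq_row_base.
    rewrite capmx_compl submx0 => /eqP; rewrite -[RHS](mul0mx _ (row_base M^C%MS)).
    move=> /(row_free_inj (row_base_free _)) h0 i.
    by move/rowP: h0 => /(_ i); rewrite !mxE.
Qed.

Lemma has_quot_dim_trans A B C m n :
    subspace B -> subspace C -> C `<=` B -> B `<=` A ->
    has_quot_dim A B m -> has_quot_dim B C n ->
  has_quot_dim A C (m + n).
Proof.
move=> sB sC CB BA; have CA : C `<=` A by move=> x /CB/BA.
case/(has_quot_dimP _ sB BA) => e [Ae espan efree].
case/(has_quot_dimP _ sC CB) => e' [Be' e'span e'free].
rewrite -[m in (m + n)%N]card_ord -[n in (_ + n)%N]card_ord -card_sum.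
apply: (@has_quot_dim_fin A C _
  (fun t => match t with inl i => e i | inr i => e' i end)) => //.
- by case=> i; [exact: Ae|apply/BA/Be'].
- move=> v /espan[c /e'span[c' hc']].
  exists (fun t => match t with inl i => c i | inr i => c' i end).
  by rewrite big_sumType /= opprD addrA.
move=> c; rewrite big_sumType /= => hc.
have hB : B (\sum_i c (inr i) *: e' i).
  by apply: subspace_sum => // i _; apply: subspaceZ.
have c1 : forall i, c (inl i) = 0.
  apply: efree; rewrite -[\sum_i _](addrK (\sum_i c (inr i) *: e' i)).
  by apply: subspaceB => //; apply: CB.
have c2 : forall i, c (inr i) = 0.
  by apply: e'free; rewrite big1 ?add0r // in hc => i _; rewrite c1 scale0r.
by case.
Qed.

End QuotDimTheory.

(** The hypotheses say that [phi] induces an isomorphism from [A / B] onto [A' / B']; a basis of the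
    target is lifted. *)
Lemma has_quot_dim_map (K : fieldType) (V V' : lmodType K) (phi : V -> V')
    (A B : set V) (A' B' : set V') n :
    (forall a u v, phi (a *: u + v) = a *: phi u + phi v) ->
    subspace A -> subspace B -> subspace B' -> (B `<=` A)%classic -> (B' `<=` A')%classic ->
    (forall v, A v -> B v <-> B' (phi v)) -> (forall v, A v -> A' (phi v)) ->
    (forall w, A' w -> exists2 v, A v & B' (w - phi v)) ->
  has_quot_dim A' B' n -> has_quot_dim A B n.
Proof.
move=> phiP sA sB sB' BA BA' hB hA surj.
case/(has_quot_dimP _ sB' BA') => e' [Ae' e'span e'free].
have /choice[e he] : forall i, exists v, A v /\ B' (e' i - phi v).
  by move=> i; case: (surj _ (Ae' i)) => v; exists v.
have phi0 : phi 0 = 0.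
  by have := phiP (-1) 0 0; rewrite scaler0 addr0 scaleN1r addNr.
have phi_sum (c : 'I_n -> K) : phi (\sum_i c i *: e i) = \sum_i c i *: phi (e i).
  by elim/big_rec2: _ => [//|i x y _ <-]; rewrite phiP.
have hsum (c : 'I_n -> K) : B' (\sum_i c i *: e' i - phi (\sum_i c i *: e i)).
  rewrite phi_sum -sumrB; apply: subspace_sum => // i _.
  by rewrite -scalerBr; apply: subspaceZ => //; case: (he i).
have Asum (c : 'I_n -> K) : A (\sum_i c i *: e i).
  by apply: subspace_sum => // i _; apply: subspaceZ => //; case: (he i).
apply/has_quot_dimP => //; exists e; split=> [i|v Av|c hc].
- by case: (he i).
- have [c hc] := e'span _ (hA _ Av); exists c; apply/hB.
    exact: subspaceB.
  have -> : phi (v - \sum_i c i *: e i) = phi v - phi (\sum_i c i *: e i).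
    by rewrite addrC -scaleN1r phiP scaleN1r addrC.
  by have := subspaceD sB' hc (hsum c); rewrite addrA subrK.
apply: e'free; rewrite -[\sum_i _](subrK (phi (\sum_i c i *: e i))).
by apply: subspaceD => //; apply/hB.
Qed.

(** * Homogeneous polynomials *)

Section Homogeneous.
Variables (K : fieldType) (k : nat).
Local Notation S := {mpoly K[k]}.
Implicit Types (g h : S) (n m : nat).

Lemma mpoly_ind (P : S -> Prop) :
    (forall a g h, P g -> P h -> P (a *: g + h)) -> P 0 -> P 1 ->
    (forall i g, P g -> P ('X_i * g)) ->
  forall g, P g.
Proof.
move=> PD P0 P1 PX g; rewrite [g]mpolyE.
have PM (m : 'X_{1..k}) : P 'X_[m].
  elim: {m}(mdeg m) {-2}m (erefl (mdeg m)) => [m /eqP|n IH m hm].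
    by rewrite mdeg_eq0 => /eqP ->; rewrite mpolyX0.
  have [i mi] : exists i, (0 < m i)%N.
    apply/existsP; apply: contraT => /existsPn h.
    move: hm; rewrite mdegE big1 // => i _; apply/eqP; rewrite -leqn0 leqNgt.
    exact: h.
  have lem : (U_(i) <= m)%MM by rewrite lep1mP -lt0n.
  rewrite -(submK lem) addmC mpolyXD; apply/PX/IH.
  by apply/eqP; rewrite -(eqn_add2r 1) -{1}(mdeg1 i) -mdegD submK // hm addn1.
elim: (msupp g) => [|m s IH]; first by rewrite big_nil.
by rewrite big_cons; apply: PD.
Qed.

(** The degree is an argument of [P], so that properties involving the degree can be carried along;
    only multiplication by a variable changes it. *)
Lemma homog_ind (P : nat -> S -> Prop) :
    (forall n, P n 0) -> (forall n a g h, P n g -> P n h -> P n (a *: g + h)) ->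
    P 0%N 1 ->
    (forall n i g, g \is n.-homog -> P n g -> P n.+1 ('X_i * g)) ->
  forall n g, g \is n.-homog -> P n g.
Proof.
move=> P0 PD P1 PX n g /dhomogP hg; rewrite [g]mpolyE.
have PM (m : 'X_{1..k}) : P (mdeg m) 'X_[m].
  elim: {m}(mdeg m) {-2}m (erefl (mdeg m)) => [m|l IH m] hm.
    by move/eqP: (hm); rewrite mdeg_eq0 => /eqP ->; rewrite mdeg0 mpolyX0.
  have [i mi] : exists i, (0 < m i)%N.
    apply/existsP; apply: contraT => /existsPn h.
    move: hm; rewrite mdegE big1 // => i _; apply/eqP; rewrite -leqn0 leqNgt.
    exact: h.
  have lem : (U_(i) <= m)%MM by rewrite lep1mP -lt0n.
  have hn : mdeg (m - U_(i))%MM = l.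
    by apply/eqP; rewrite -(eqn_add2r 1) -{1}(mdeg1 i) -mdegD submK // hm addn1.
  rewrite hm -(submK lem) addmC mpolyXD; apply/PX; last by rewrite -hn; apply: IH.
  by rewrite dhomogX; apply/eqP.
rewrite big_seq; elim/big_rec: _ => [|m x hm Px]; first exact: P0.
by apply: PD => //; rewrite -(hg _ hm); apply: PM.
Qed.

(* [g] has degree [n - m], with no truncation: [g = 0] when [n < m]. *)
Definition homog_sub n m g : Prop :=
  g \is (n - m).-homog /\ ((n < m)%N -> g = 0).

Lemma homog_sub0 n m : homog_sub n m 0.
Proof. by split=> //; apply: rpred0. Qed.

Lemma homog_subP n m a g h :
  homog_sub n m g -> homog_sub n m h -> homog_sub n m (a *: g + h).
Proof.
move=> [g1 g2] [h1 h2]; split; first by rewrite rpredD // rpredZ.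
by move=> nm; rewrite g2 // h2 // scaler0 addr0.
Qed.

Lemma homog_subE n m g : (m <= n)%N -> homog_sub n m g <-> g \is (n - m).-homog.
Proof. by move=> h; split=> [[]//|hg]; split=> //; rewrite ltnNge h. Qed.

Lemma homog_sub_addn n m g : homog_sub (n + m) m g <-> g \is n.-homog.
Proof. by rewrite homog_subE ?leq_addl // addnK. Qed.

Lemma homog_subM n m l g h :
  homog_sub n m g -> h \is l.-homog -> homog_sub (n + l) m (h * g).
Proof.
move=> [g1 g2] hh; case: (ltnP n m) => nm.
  by rewrite g2 // mulr0; apply: homog_sub0.
apply/homog_subE; first exact: leq_trans nm (leq_addr _ _).
by rewrite addnC -addnBA //; apply: dhomogM.
Qed.

Lemma homog_subM1 n m g h :
  homog_sub n m g -> h \is 1.-homog -> homog_sub n.+1 m (h * g).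
Proof. by move=> hg hh; rewrite -addn1; apply: homog_subM. Qed.

Lemma homog_subS n g : g \is n.-homog -> homog_sub n.+1 1 g.
Proof. by move=> hg; apply/homog_subE; rewrite // subn1. Qed.

Lemma homog_sub_homog n m g h :
  homog_sub n m g -> h \is m.-homog -> h * g \is n.-homog.
Proof.
move=> [g1 g2] hh; case: (ltnP n m) => nm; first by rewrite g2 // mulr0 rpred0.
by rewrite -(subnKC nm); apply: dhomogM.
Qed.

Lemma pihomogM n m g h : h \is m.-homog ->
  pihomog mdeg n (h * g) =
    if (m <= n)%N then h * pihomog mdeg (n - m) g else 0.
Proof.
move=> hh.
have [N [q [hq ->]]] : exists N (q : nat -> S),
    (forall d, q d \is d.-homog) /\ g = \sum_(d < N) q d.
  exists (mmeasure mdeg g), (fun d => pihomog mdeg d g); split=> [d|].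
    exact: pihomogP.
  exact: pihomog_partitionE.
rewrite mulr_sumr !raddf_sum /=; case: ifP => mn.
  rewrite mulr_sumr; apply: eq_bigr => d _ /=.
  have [e|ne] := eqVneq (m + d)%N n.
    by rewrite -e addKn !pihomog_dE //; apply: dhomogM.
  rewrite (pihomog_ne0 ne) ?(pihomog_ne0 _ (hq d)) ?mulr0 //; last exact: dhomogM.
  by apply: contra ne => /eqP ->; rewrite subnKC.
apply: big1 => d _; apply: (pihomog_ne0 _ (dhomogM hh (hq d))).
by apply: contraFN mn => /eqP <-; rewrite leq_addr.
Qed.

(** Replace each coefficient [h i] by its component of degree [n - m], or by 0 when [n < m]. *)
Lemma homog_comb (I : finType) n m g (h a : I -> S) :
    g \is n.-homog -> (forall i, a i \is m.-homog) -> g = \sum_i h i * a i ->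
  exists c : I -> S, (forall i, homog_sub n m (c i)) /\ g = \sum_i c i * a i.
Proof.
move=> hg ha gE.
exists (fun i => if (m <= n)%N then pihomog mdeg (n - m) (h i) else 0); split.
  move=> i; case: ifP => mn; last exact: homog_sub0.
  by apply/homog_subE => //; apply: pihomogP.
rewrite -(pihomog_dE hg) {1}gE raddf_sum; apply: eq_bigr => i _ /=.
rewrite mulrC (pihomogM _ _ (ha i)); case: ifP => mn; first by rewrite mulrC.
by rewrite mul0r.
Qed.

Lemma mderivXU i j : 'X_j^`M(i) = (j == i)%:R :> S.
Proof.
rewrite mderivX mnm1E; case: eqP => [->|]; last by rewrite scale0r.
have -> : (U_(i) - U_(i))%MM = 0%MM :> 'X_{1..k} by apply/mnmP => l; rewrite mnmBE subnn mnm0E.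
by rewrite mpolyX0 scale1r.
Qed.

Lemma homog_deriv n i g : g \is n.-homog -> homog_sub n 1 g^`M(i).
Proof.
move=> hg; apply: (homog_ind (P := fun n g => homog_sub n 1 g^`M(i))) hg => {n g}.
- by move=> n; rewrite mderiv0; apply: homog_sub0.
- by move=> n a g h Pg Ph; rewrite mderivD mderivZ; apply: homog_subP.
- by rewrite -mpolyC1 mderivC; apply: homog_sub0.
move=> n j g hg Pg; rewrite mderivM mderivXU.
rewrite -[_%:R]mulr_natl mulr1 -scaler_nat -scalerAl mul1r.
apply: homog_subP; first by apply/homog_subE => //; rewrite subn1.
by rewrite -addn1; apply: homog_subM => //; rewrite dhomogX; apply/eqP/mdeg1.
Qed.

Lemma euler n g : g \is n.-homog -> \sum_i 'X_i * g^`M(i) = n%:R *: g.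
Proof.
move=> hg; apply: (homog_ind (P := fun n g => \sum_i 'X_i * g^`M(i) = n%:R *: g)) hg => {n g}.
- by move=> n; rewrite scaler0 big1 // => i _; rewrite mderiv0 mulr0.
- move=> n a g h Pg Ph; rewrite scalerDr scalerA mulrC -scalerA -Pg -Ph.
  rewrite scaler_sumr -big_split; apply: eq_bigr => i _ /=.
  by rewrite mderivD mderivZ mulrDr scalerAr.
- by rewrite scale0r big1 // => i _; rewrite -mpolyC1 mderivC mulr0.
move=> n j g hg Pg.
have -> : \sum_i 'X_i * ('X_j * g)^`M(i) = 'X_j * (n%:R *: g) + 'X_j * g.
  rewrite -Pg mulr_sumr.
  transitivity (\sum_i ('X_j * ('X_i * g^`M(i)) + 'X_i * ((j == i)%:R * g))).
    by apply: eq_bigr => i _; rewrite mderivM mderivXU mulrDr addrC [in LHS]mulrCA.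
  rewrite big_split /=; congr (_ + _).
  rewrite (bigD1 j) //= eqxx mul1r big1 ?addr0 // => i.
  by rewrite eq_sym => /negPf ->; rewrite mul0r mulr0.
by rewrite -scalerAr -[n.+1]addn1 natrD scalerDl scale1r.
Qed.

Lemma mmap_scale (A : comNzRingType) (f : {rmorphism K -> A}) (x : 'I_k -> A) c n g :
  g \is n.-homog -> mmap f (fun i => c * x i) g = c ^+ n * mmap f x g.
Proof.
move=> hg; apply: (homog_ind (P := fun n g =>
  mmap f (fun i => c * x i) g = c ^+ n * mmap f x g)) hg => {n g}.
- by move=> n; rewrite !mmap0 mulr0.
- move=> n a g h Pg Ph; rewrite !mmapD !mmapZ Pg Ph mulrDr; congr (_ + _).
  by rewrite mulrCA.
- by rewrite !rmorph1 mulr1.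
move=> n i g _ Pg; rewrite !rmorphM /= Pg !mmapX !mmap1U exprS.
by rewrite mulrACA.
Qed.

(** The index type also contains the monomials of degree below [n], which are sent to 0: the family
    spans the forms of degree [n] but is in general not free. Spanning and counting arguments only
    need the finite index type. *)
Definition homog_mon n (m : 'X_{1..k < n.+1}) : S :=
  if mdeg m == n then 'X_[m] else 0.

Lemma homog_mon_homog n (m : 'X_{1..k < n.+1}) : homog_mon m \is n.-homog.
Proof.
by rewrite /homog_mon; case: eqP => [h|_]; rewrite ?rpred0 // dhomogX; apply/eqP.
Qed.

Lemma homog_monE n g : g \is n.-homog -> 
  g = \sum_(m : 'X_{1..k < n.+1}) g@_m *: homog_mon m.
Proof.
move=> hg; rewrite {1}[g](@mpolywE _ _ n.+1); last first.
  have [->|g0] := eqVneq g 0; first by rewrite msize0.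
  by have := dhomog_uniq g0 hg (dhomog_msize hg); lia.
apply: eq_bigr => m _; rewrite /homog_mon; case: eqP => // /eqP hm.
by rewrite scaler0 (dhomog_nemf_coeff hg hm) scale0r.
Qed.

End Homogeneous.

(** * Coprime binary forms *)

Section BinaryForms.
Variables (K : fieldType) (e : nat) (a b v : {poly K}).
Hypotheses (sa : size a = e.+1) (sb : (size b <= e.+1)%N).
Hypothesis bv1 : a %| v * b - 1.
Implicit Types y h al be : {poly K}.

(* Binary forms of degree [n] are encoded by polynomials of size at most [n.+1]. *)
Definition binary_ideal n y : Prop := exists al be,
  [/\ (size al <= n.+1 - e)%N, (size be <= n.+1 - e)%N & y = al * a + be * b].

Let a0 : a != 0. Proof. by rewrite -size_poly_gt0 sa. Qed.

(** [v] inverts [b] modulo [a], so [a] divides [be] as soon as it divides [be * b]. As [a] has full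
    degree [e], it has no zero at infinity, and coprimality of the polynomials is coprimality of the
    binary forms. *)
Lemma binary_syzygy al be : al * a + be * b = 0 ->
  exists ga, al = ga * b /\ be = - (ga * a).
Proof.
move=> h; have : a %| be.
  have -> : be = v * (al * a + be * b) - (be * (v * b - 1) + v * al * a) by ring.
  by rewrite h mulr0 sub0r dvdpNr dvdp_add ?dvdp_mull.
case/dvdpP => ga beE; exists (- ga); split; last by rewrite mulNr opprK.
apply: (mulIf a0); apply/eqP; rewrite -subr_eq0 -h beE; apply/eqP; ring.
Qed.

Lemma pred_leq m n : (m <= n)%N -> (m.-1 <= n.-1)%N.
Proof. lia. Qed.

Lemma size_mul_leP al (n : nat) : (size (al * a)%R <= n + e)%N -> (size al <= n)%N.
Proof.
have [->|al0] := eqVneq al 0; first by rewrite size_poly0.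
by rewrite size_mul // sa addnS /= leq_add2r.
Qed.

Lemma size_shift_le (al al' : {poly K}) (n : nat) : 'X * al = al' -> (size al' <= n)%N -> (size al <= n.-1)%N.
Proof.
move=> <-; have [->|al0] := eqVneq al 0; first by rewrite size_poly0.
by rewrite mulrC size_mulX //; case: n.
Qed.

Lemma size_mulX_le h : (size ('X * h)%R <= (size h).+1)%N.
Proof. by have := size_polyMleq 'X h; rewrite size_polyX. Qed.

(** [binary_ideal m.+1 y] concerns the product of [y] with the second variable, so both variables
    send [y] into the ideal. Comparing the two expressions of ['X * y] gives a Koszul syzygy, which
    vanishes for reasons of degree; then [al' = 'X * al] and [be' = 'X * be], so [al] and [be] are
    one degree smaller than assumed. *)
Lemma binary_socle m y : (m.+2 < 2 * e)%N ->
  binary_ideal m.+1 y -> binary_ideal m.+1 ('X * y) -> binary_ideal m y.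
Proof.
move=> me [al [be [sal sbe yE]]] [al' [be' [sal' sbe' XyE]]].
have h : ('X * al - al') * a + ('X * be - be') * b = 0.
  apply: (@addrI _ ('X * y)); rewrite addr0 {1}XyE yE; ring.
have [ga [alE beE]] := binary_syzygy h.
have ga0 : ga = 0.
  apply/eqP/negPn/negP => ga0.
  have : (size ('X * be - be')%R <= e)%N.
    apply: (leq_trans (size_polyD _ _)); rewrite size_polyN geq_max.
    have hX := size_mulX_le be; apply/andP; split.
      apply: leq_trans hX _; apply: leq_ltn_trans sbe _; lia.
    apply: leq_trans sbe' _; lia.
  rewrite beE size_polyN size_mul // sa addnS /= -{2}[e]add0n leq_add2r leqn0.
  by rewrite size_poly_eq0 (negPf ga0).
rewrite ga0 !mul0r ?oppr0 in alE beE.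
move/eqP: alE beE; rewrite subr_eq0 => /eqP alE /eqP; rewrite subr_eq0 => /eqP beE.
exists al, be; split=> //.
  by have := size_shift_le alE sal'; lia.
by have := size_shift_le beE sbe'; lia.
Qed.

(** Descending induction on [m] from the socle degree [2 * e - 2]: the hypothesis for [m] implies
    the one for [m.+1], both for [y] and for ['X * y]. *)
Lemma binary_nondeg m y : (0 < e)%N -> (m <= 2 * e - 2)%N ->
    (forall h, (size h <= 2 * e - 1 - m)%N -> binary_ideal (2 * e - 2) (y * h)) ->
  binary_ideal m y.
Proof.
move=> e0; move: {2}(2 * e - 2 - m)%N (erefl (2 * e - 2 - m)%N) => k.
elim: k m y => [|k IH] m y hk hm hy.
  have -> : m = (2 * e - 2)%N by lia.
  rewrite -[y]mulr1; apply: hy; rewrite size_poly1; lia.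
apply: binary_socle; first lia.
  by apply: IH; [lia|lia|move=> h sh; apply: hy; lia].
apply: IH; [lia|lia|move=> h sh]; rewrite -mulrA mulrCA; apply: hy.
apply: leq_trans (size_mulX_le h) _; apply: leq_ltn_trans sh _; lia.
Qed.

(* The residue pairing: [b^-1 y mod a], which has size at most [e], has leading
   coefficient zero exactly when [y] lies in the ideal. *)
Definition binary_residue y : K := ((y * v) %% a)`_e.-1.

Lemma binary_residueD c y h :
  binary_residue (c *: y + h) = c * binary_residue y + binary_residue h.
Proof. by rewrite /binary_residue mulrDl modpD -scalerAl modpZl coefD coefZ. Qed.

Lemma binary_decomp y : exists2 al, y = al * a + ((y * v) %% a) * b &
  (size ((y * v) %% a)%R <= e)%N.
Proof.
have hs : (size ((y * v) %% a)%R <= e)%N.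
  by rewrite -ltnS -sa ltn_modp.
have : a %| y - ((y * v) %% a) * b.
  have -> : y - ((y * v) %% a) * b = ((y * v) %/ a * b) * a - y * (v * b - 1).
    rewrite -[X in _ - X]addr0 -(subrr ((y * v) %/ a * b * a)).
    have -> : ((y * v) %% a) * b = y * v * b - ((y * v) %/ a * a) * b.
      by rewrite -mulrBl {2}(divp_eq (y * v) a) addrAC subrr add0r.
    ring.
  by rewrite dvdp_sub ?dvdp_mull.
by case/dvdpP => al /eqP; rewrite subr_eq => /eqP h; exists al.
Qed.

(** The cofactor of [b] can be reduced modulo [a] to size at most [e], while degree [2 * e - 2]
    allows only size [e - 1]: the coefficient of index [e - 1] is the sole obstruction. In higher
    degrees there is none. *)
Lemma binary_residue0 y : (0 < e)%N -> (size y <= 2 * e - 1)%N ->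
  binary_residue y = 0 <-> binary_ideal (2 * e - 2) y.
Proof.
move=> e0 sy; split=> [h|[al [be [sal sbe ->]]]].
  have [al yE hs] := binary_decomp y; exists al, ((y * v) %% a).
  have hs1 : (size ((y * v) %% a)%R <= e.-1)%N.
    apply/leq_sizeP => j; rewrite leq_eqVlt => /orP[/eqP <- //|hj].
    by move/leq_sizeP: hs; apply; lia.
  split=> //; last by apply: leq_trans hs1 _; lia.
  apply: size_mul_leP; rewrite -[al * a](addrK ((y * v) %% a * b)) -yE.
  apply: leq_trans (size_polyD _ _) _; rewrite size_polyN geq_max.
  apply/andP; split; first by apply: leq_trans sy _; lia.
  apply: leq_trans (size_polyMleq _ _) _.
  apply: (@leq_trans (e.-1 + e.+1).-1); last lia.
  by apply: pred_leq; apply: leq_add.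
rewrite /binary_residue.
have -> : (al * a + be * b) * v = (al * v) * a + be * (v * b - 1) + be by ring.
rewrite -addrA modpD modp_mull add0r modpD.
have /modp_eq0 -> : a %| be * (v * b - 1) by rewrite dvdp_mull.
rewrite add0r modp_small ?sa; last by apply: leq_ltn_trans sbe _; lia.
by apply: nth_default; apply: leq_trans sbe _; lia.
Qed.

Lemma binary_ideal_top n y : (2 * e - 1 <= n)%N -> (0 < e)%N ->
  (size y <= n.+1)%N -> binary_ideal n y.
Proof.
move=> hn e0 sy; have [al yE hs] := binary_decomp y.
exists al, ((y * v) %% a); split=> //; last by apply: leq_trans hs _; lia.
apply: size_mul_leP; rewrite -[al * a](addrK ((y * v) %% a * b)) -yE.
apply: leq_trans (size_polyD _ _) _; rewrite size_polyN geq_max.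
apply/andP; split; first by apply: leq_trans sy _; lia.
apply: leq_trans (size_polyMleq _ _) _; apply: (@leq_trans (e + e.+1).-1); last lia.
by apply: pred_leq; apply: leq_add.
Qed.

End BinaryForms.

(** * Restriction to a line *)

Lemma sum_ord3 (V : nmodType) (F : 'I_3 -> V) : \sum_i F i = F o0 + F o1 + F o2.
Proof.
rewrite !big_ord_recl big_ord0 addr0 addrA.
by congr (F _ + F _ + F _); apply: val_inj.
Qed.

Lemma ord3P (P : 'I_3 -> Prop) : P o0 -> P o1 -> P o2 -> forall i, P i.
Proof.
move=> h0 h1 h2 [[|[|[|//]]] hi].
- by rewrite (_ : Ordinal hi = o0) //; apply: val_inj.
- by rewrite (_ : Ordinal hi = o1) //; apply: val_inj.
- by rewrite (_ : Ordinal hi = o2) //; apply: val_inj.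
Qed.

(** * Homogenization of univariate polynomials *)

Section Bihom.
Variables (K : fieldType) (k : nat).
Local Notation S := {mpoly K[k]}.
Implicit Types (u v : S) (w : {poly K}).

(** The homogenization of [w] in degree [n], evaluated at the pair [u], [v]. *)
Definition bihom n w u v : S := \sum_(i < n.+1) w`_i *: (u ^+ i * v ^+ (n - i)).

Lemma bihomD n a w1 w2 u v :
  bihom n (a *: w1 + w2) u v = a *: bihom n w1 u v + bihom n w2 u v.
Proof.
rewrite /bihom scaler_sumr -big_split; apply: eq_bigr => i _ /=.
by rewrite coefD coefZ scalerDl scalerA.
Qed.

Lemma bihom0 n u v : bihom n 0 u v = 0.
Proof. by rewrite /bihom big1 // => i _; rewrite coef0 scale0r. Qed.

Lemma bihom_mulX n w u v : bihom n.+1 ('X * w) u v = u * bihom n w u v.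
Proof.
rewrite /bihom big_ord_recl mulrC coefMX eqxx scale0r add0r mulr_sumr.
apply: eq_bigr => i _; rewrite coefMX /= /bump /= add1n subSS exprS.
by rewrite -scalerAr mulrA.
Qed.

Lemma bihomS n w u v : (size w <= n.+1)%N -> bihom n.+1 w u v = v * bihom n w u v.
Proof.
move=> sw; rewrite /bihom big_ord_recr /= (nth_default _ sw) scale0r addr0 mulr_sumr.
apply: eq_bigr => i _; rewrite subSn; last by rewrite -ltnS.
rewrite exprS -scalerAr.
by congr (_ *: _); ring.
Qed.

Lemma bihom_homog n w u v :
  u \is 1.-homog -> v \is 1.-homog -> bihom n w u v \is n.-homog.
Proof.
move=> hu hv; apply: rpred_sum => i _; apply: rpredZ.
by have := dhomogM (dhomogMn i hu) (dhomogMn (n - i) hv); rewrite !mul1n subnKC // -ltnS.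
Qed.

Lemma bihom1 u v : bihom 0 1 u v = 1.
Proof. by rewrite /bihom big_ord1 coef1 scale1r !expr0 mulr1. Qed.

End Bihom.

Section LineRestriction.
Variables (K : fieldType) (p1 p2 b0 : K).
Local Notation S := {mpoly K[3]}.
Implicit Types (g h x y : S) (w : {poly K}).

Definition line_point (i : 'I_3) : {poly K} :=
  match val i with 0%N => 'X | 1%N => p1 *: 'X + 1 | _ => p2 *: 'X + b0%:P end.

(* Restriction to the line through (1 : p1 : p2) and (0 : 1 : b0), with the
   parameter infinity corresponding to the first point. *)
Definition restr g : {poly K} := mmap (@polyC K) line_point g.

HB.instance Definition _ := GRing.RMorphism.copy restr
  (mmap (@polyC K) line_point).

(** The forms ['X_o0], [line_coord] and [line_form] are linear coordinates adapted to the line: they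
    restrict to ['X], 1 and 0. *)
Definition line_coord : S := 'X_o1 - p1 *: 'X_o0.
Definition line_form : S := 'X_o2 - b0 *: 'X_o1 + (b0 * p1 - p2) *: 'X_o0.

Lemma restrZ c g : restr (c *: g) = c *: restr g.
Proof. by rewrite /restr mmapZ mul_polyC. Qed.

Lemma restrX i : restr 'X_i = line_point i.
Proof. by rewrite /restr mmapX mmap1U. Qed.

Lemma homogX i : ('X_i : S) \is 1.-homog.
Proof. by rewrite dhomogX; apply/eqP/mdeg1. Qed.

Lemma line_coord_homog : line_coord \is 1.-homog.
Proof. by rewrite rpredB ?rpredZ ?homogX. Qed.

Lemma line_form_homog : line_form \is 1.-homog.
Proof. by rewrite rpredD ?rpredB ?rpredZ ?homogX. Qed.

Lemma line_form_neq0 : line_form != 0.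
Proof.
apply/eqP => /(congr1 (meval (fun i : 'I_3 => (i == o2)%:R))).
rewrite /line_form rmorphD rmorphB /= !mevalZ !mevalXU meval0 /= !mulr0 subr0 addr0.
by apply/eqP; rewrite oner_eq0.
Qed.

Lemma restr_coord : restr line_coord = 1.
Proof.
rewrite /line_coord rmorphB /= restrZ !restrX /line_point /=.
by rewrite addrAC subrr add0r.
Qed.

Lemma restr_form : restr line_form = 0.
Proof.
rewrite /line_form rmorphD rmorphB /= !restrZ !restrX /line_point /=.
rewrite -!mul_polyC polyCB polyCM; ring.
Qed.

(** In the adapted coordinates a form is a binary form in the first two plus a multiple of the
    third, so [line_form] generates the kernel of the restriction in each degree. *)
Lemma restr_decomp n g : g \is n.-homog -> (size (restr g) <= n.+1)%N /\
  exists g', homog_sub n 1 g' /\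
    g = bihom n (restr g) 'X_o0 line_coord + line_form * g'.
Proof.
move=> hg; apply: (homog_ind (P := fun n g => (size (restr g) <= n.+1)%N /\
  exists g', homog_sub n 1 g' /\
    g = bihom n (restr g) 'X_o0 line_coord + line_form * g')) hg => {n g}.
- move=> n; rewrite rmorph0 size_poly0; split=> //; exists 0.
  by rewrite bihom0 mulr0 addr0; split=> //; apply: homog_sub0.
- move=> n a g h [sg [g' [hg' gE]]] [sh [h' [hh' hE]]].
  rewrite rmorphD /= restrZ; split.
    by rewrite (leq_trans (size_polyD _ _)) // geq_max (leq_trans (size_scale_leq _ _)).
  exists (a *: g' + h'); split; first exact: homog_subP.
  by rewrite bihomD {1}gE {1}hE mulrDr scalerDr -scalerAr addrACA.
- rewrite rmorph1 size_poly1; split=> //; exists 0.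
  by rewrite bihom1 mulr0 addr0; split=> //; apply: homog_sub0.
move=> n i g hg [sg [g' [hg' gE]]].
have sX : (size ('X * restr g)%R <= n.+2)%N.
  by apply: leq_trans (size_mulX_le _) _.
have h0 : 'X_o0 * g = bihom n.+1 ('X * restr g) 'X_o0 line_coord
                       + line_form * ('X_o0 * g').
  by rewrite {1}gE bihom_mulX; ring.
have h1 : line_coord * g = bihom n.+1 (restr g) 'X_o0 line_coord
                       + line_form * (line_coord * g').
  by rewrite {1}gE bihomS //; ring.
have h0' := homog_subM1 hg' (homogX o0).
have h1' := homog_subM1 hg' line_coord_homog.
have sE a w1 w2 : (size w1 <= n.+2)%N -> (size w2 <= n.+2)%N ->
    (size (a *: w1 + w2)%R <= n.+2)%N.
  move=> s1 s2; apply: leq_trans (size_polyD _ _) _; rewrite geq_max s2 andbT.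
  exact: leq_trans (size_scale_leq _ _) s1.
have sg1 : (size (restr g) <= n.+2)%N by apply: leq_trans sg _.
have x1E : 'X_o1 = p1 *: 'X_o0 + line_coord by rewrite /line_coord addrC subrK.
have x2E : 'X_o2 = line_form + (p2 *: 'X_o0 + b0 *: line_coord).
  by rewrite /line_form /line_coord -!mul_mpolyC mpolyCB mpolyCM; ring.
elim/ord3P: i; rewrite rmorphM /= restrX /line_point /=.
- by split=> //; exists ('X_o0 * g').
- have -> : (p1 *: 'X + 1) * restr g = p1 *: ('X * restr g) + restr g.
    by rewrite mulrDl mul1r scalerAl.
  split; first exact: sE.
  exists (p1 *: ('X_o0 * g') + line_coord * g'); split; first exact: homog_subP.
  rewrite bihomD {1}x1E mulrDl -scalerAl h0 {1}h1 mulrDr scalerDr -scalerAr.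
  by rewrite addrACA.
have -> : (p2 *: 'X + b0%:P) * restr g = p2 *: ('X * restr g) + (b0 *: restr g + 0).
  by rewrite mulrDl mul_polyC scalerAl addr0.
split; first by apply: (sE) => //; apply: (sE) => //; rewrite size_poly0.
exists (p2 *: ('X_o0 * g') + (b0 *: (line_coord * g') + g)); split.
  by apply: homog_subP => //; apply: homog_subP => //; apply: homog_subS.
have -> : 'X_o2 * g = line_form * g + (p2 *: ('X_o0 * g) + b0 *: (line_coord * g)).
  by rewrite x2E mulrDl; congr (_ + _); rewrite mulrDl -!scalerAl.
rewrite !bihomD bihom0 addr0 {1}h0 {1}h1.
rewrite [line_form * (_ + _)]mulrDr [line_form * (_ + g)]mulrDr -!scalerAr !scalerDr.
have AC (c1 c2 c3 c4 c5 : S) : c1 + (c2 + c3 + (c4 + c5)) = c2 + c4 + (c3 + (c5 + c1)).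
  by ring.
exact: AC.
Qed.


End LineRestriction.

(** * Duality for a complete intersection *)

Section CompleteIntersection.
Variables (K : fieldType) (p1 p2 b0 : K).
Local Notation S := {mpoly K[3]}.
Local Notation restr := (restr p1 p2 b0).
Local Notation ell := (line_form p1 p2 b0).
Local Notation lc := (line_coord p1).
Implicit Types (g h x y : S) (w : {poly K}).

Variables (e : nat) (a b : S) (v : {poly K}).
Hypotheses (e_gt0 : (0 < e)%N) (ha : a \is e.-homog) (hb : b \is e.-homog).
Hypotheses (sa : size (restr a) = e.+1) (bv1 : restr a %| v * restr b - 1).

Definition pair_ideal x : Prop := exists al be, x = al * a + be * b.

Local Notation binary_ideal := (binary_ideal e (restr a) (restr b)).
Local Notation residue := (binary_residue e (restr a) v).

Let sb : (size (restr b) <= e.+1)%N.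
Proof. by case: (restr_decomp p1 p2 b0 hb). Qed.

Lemma homog_formX n : ell ^+ n \is n.-homog.
Proof. by have := dhomogMn n (line_form_homog p1 p2 b0); rewrite mul1n. Qed.

Lemma pair_ideal0 : pair_ideal 0.
Proof. by exists 0, 0; rewrite !mul0r addr0. Qed.

Lemma pair_idealM h x : pair_ideal x -> pair_ideal (h * x).
Proof. by case=> al [be ->]; exists (h * al), (h * be); rewrite mulrDr !mulrA. Qed.

Lemma pair_idealD x y : pair_ideal x -> pair_ideal y -> pair_ideal (x + y).
Proof.
move=> [al [be ->]] [al' [be' ->]]; exists (al + al'), (be + be').
by rewrite !mulrDl addrACA.
Qed.

Lemma pair_idealZ c x : pair_ideal x -> pair_ideal (c *: x).
Proof. by move=> /(pair_idealM c%:MP); rewrite mul_mpolyC. Qed.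

Lemma pair_idealN x : pair_ideal x -> pair_ideal (- x).
Proof. by move=> /(pair_idealZ (-1)); rewrite scaleN1r. Qed.

Lemma pair_idealB x y : pair_ideal x -> pair_ideal y -> pair_ideal (x - y).
Proof. by move=> hx /pair_idealN; apply: pair_idealD. Qed.

Lemma pair_ideal_trans y x z : pair_ideal (x - y) -> pair_ideal (y - z) ->
  pair_ideal (x - z).
Proof. by move=> h1 /(pair_idealD h1); rewrite addrA subrK. Qed.

Lemma pair_ideal_homog n x : x \is n.-homog -> pair_ideal x ->
  exists al be, [/\ homog_sub n e al, homog_sub n e be & x = al * a + be * b].
Proof.
move=> hx [al [be xE]].
have [||c [hc xE']] := @homog_comb _ _ 'I_2 n e x
    (fun i => if val i == 0%N then al else be) (fun i => if val i == 0%N then a else b) hx.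
- by move=> i; case: ifP.
- by rewrite xE !big_ord_recl big_ord0 addr0.
exists (c ord0), (c (lift ord0 ord0)); split=> //.
by rewrite xE' !big_ord_recl big_ord0 addr0.
Qed.

Lemma size_restr n m g : homog_sub n m g -> (size (restr g) <= n.+1 - m)%N.
Proof.
case=> hg g0; case: (ltnP n m) => nm; first by rewrite g0 // rmorph0 size_poly0.
by rewrite subSn //; case: (restr_decomp p1 p2 b0 hg).
Qed.

Lemma restr_pair_ideal n x : x \is n.-homog -> pair_ideal x -> binary_ideal n (restr x).
Proof.
move=> hx /(pair_ideal_homog hx)[al [be [hal hbe ->]]].
exists (restr al), (restr be); rewrite rmorphD !rmorphM; split=> //; exact: size_restr.
Qed.

Lemma restr_lift n w : (size w <= n.+1)%N ->
  restr (bihom n w 'X_o0 lc) = w.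
Proof.
move=> sw; rewrite /bihom rmorph_sum /=.
under eq_bigr do rewrite restrZ rmorphM !rmorphXn /= restrX restr_coord expr1n mulr1.
rewrite /line_point /=.
rewrite -poly_def; apply/polyP => i; rewrite coef_poly; case: ltnP => // hi.
by rewrite nth_default // (leq_trans sw).
Qed.

Lemma restr_lift_sub n m w : (size w <= n.+1 - m)%N ->
  exists2 x, homog_sub n m x & restr x = w.
Proof.
move=> sw; case: (ltnP n m) => nm.
  exists 0; first exact: homog_sub0.
  have -> : w = 0 by apply/eqP; rewrite -size_poly_leq0; apply: leq_trans sw _; lia.
  by rewrite rmorph0.
exists (bihom (n - m) w 'X_o0 lc); last by rewrite restr_lift // -subSn.
by apply/homog_subE => //; apply: bihom_homog; [exact: homogX|exact: line_coord_homog].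
Qed.

Lemma restr_eq0 n x : x \is n.-homog -> restr x = 0 ->
  exists2 x', homog_sub n 1 x' & x = ell * x'.
Proof.
move=> hx rx; have [_ [x' [hx' xE]]] := restr_decomp p1 p2 b0 hx.
by exists x' => //; rewrite {1}xE rx bihom0 add0r.
Qed.

(** Lift the two cofactors from the line to the plane; the error restricts to 0 and so is a multiple
    of [ell]. *)
Lemma binary_ideal_lift n x : x \is n.-homog -> binary_ideal n (restr x) ->
  exists2 x', homog_sub n 1 x' & pair_ideal (x - ell * x').
Proof.
move=> hx [al [be [sal sbe xE]]].
have [A hA AE] := restr_lift_sub sal; have [B hB BE] := restr_lift_sub sbe.
have [||x' hx' xE'] := @restr_eq0 n (x - A * a - B * b).
- rewrite !rpredB //.
    by rewrite mulrC; apply: (homog_sub_homog hA).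
  by rewrite mulrC; apply: (homog_sub_homog hB).
- by rewrite !rmorphB !rmorphM /= AE BE xE -addrA -opprD subrr.
exists x' => //; exists A, B; rewrite -xE'; ring.
Qed.

(** On the line the cofactors of [ell * x] form a syzygy, which is Koszul. Subtracting a lift of
    that Koszul syzygy leaves cofactors divisible by [ell], and [ell] cancels. *)
Lemma pair_ideal_regular n x : x \is n.-homog -> pair_ideal (ell * x) -> pair_ideal x.
Proof.
move=> hx hi; have hlx : ell * x \is n.+1.-homog.
  exact: homog_sub_homog (homog_subS hx) (line_form_homog p1 p2 b0).
have [al [be [hal hbe xE]]] := pair_ideal_homog hlx hi.
have : restr al * restr a + restr be * restr b = 0.
  by rewrite -!rmorphM -rmorphD -xE rmorphM /= restr_form mul0r.
case/(binary_syzygy sa bv1) => ga [alE beE].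
have sga : (size ga <= n.+1.+1 - (e + e))%N.
  have := size_restr hbe; rewrite beE size_polyN => h.
  rewrite subnDA; apply: (size_mul_leP sa).
  have [|h1] := leqP e (n.+2 - e); first by move=> /subnK ->.
  have [->|ga0] := eqVneq ga 0; first by rewrite mul0r size_poly0.
  have := leq_trans h (ltnW h1); rewrite size_mul ?sa // -?size_poly_gt0 ?sa //.
  rewrite addnS /= -{2}[e]add0n leq_add2r leqn0 size_poly_eq0 => /eqP ga0'.
  by rewrite ga0' eqxx in ga0.
have [G hG GE] := restr_lift_sub sga.
have hGb (q : S) : q \is e.-homog -> homog_sub n.+1 e (q * G).
  move=> hq; case: hG => hG G0; have [h|h] := ltnP n.+1 (e + e).
    by rewrite G0 // mulr0; apply: homog_sub0.
  apply/homog_subE; first exact: leq_trans (leq_addl _ _) h.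
  have -> : (n.+1 - e = e + (n.+1 - (e + e)))%N by lia.
  exact: dhomogM.
have [al' hal' alE'] : exists2 al', homog_sub (n.+1 - e) 1 al' & al - b * G = ell * al'.
  apply: restr_eq0; last by rewrite rmorphB rmorphM /= alE GE mulrC subrr.
  by rewrite rpredB //; [case: hal|case: (hGb _ hb)].
have [be' hbe' beE'] : exists2 be', homog_sub (n.+1 - e) 1 be' & be + a * G = ell * be'.
  apply: restr_eq0; last by rewrite rmorphD rmorphM /= beE GE mulrC addrC subrr.
  by rewrite rpredD //; [case: hbe|case: (hGb _ ha)].
exists al', be'; apply: (mulfI (line_form_neq0 p1 p2 b0)).
rewrite xE mulrDr !mulrA -alE' -beE' mulrBl mulrDl; ring.
Qed.

Lemma homog_formM n m x : x \is n.-homog -> ell ^+ m * x \is (n + m).-homog.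
Proof. by move=> hx; rewrite addnC; apply: dhomogM; first exact: homog_formX. Qed.

Lemma pair_ideal_regularX n m x : x \is n.-homog -> pair_ideal (ell ^+ m * x) ->
  pair_ideal x.
Proof.
move=> hx; elim: m => [|m IH]; first by rewrite expr0 mul1r.
by rewrite exprS -mulrA => /(pair_ideal_regular (homog_formM m hx)).
Qed.

Lemma pair_ideal_top n x : (2 * e - 1 <= n)%N -> x \is n.-homog ->
  exists2 x', homog_sub n 1 x' & pair_ideal (x - ell * x').
Proof.
move=> hn hx; apply: binary_ideal_lift => //; apply: (binary_ideal_top sa sb bv1) => //.
by case: (restr_decomp p1 p2 b0 hx).
Qed.

(** In terms of [A]: the images of the forms of any degree [n >= 2 * e - 2] fill the whole
    algebra. *)
Lemma pair_ideal_topX n m x : (2 * e - 2 <= n)%N -> x \is (n + m).-homog ->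
  exists2 x', x' \is n.-homog & pair_ideal (x - ell ^+ m * x').
Proof.
move=> hn; elim: m x => [|m IH] x hx.
  rewrite addn0 in hx; exists x => //; rewrite expr0 mul1r subrr; exact: pair_ideal0.
have [|x' hx' hI] := pair_ideal_top _ hx; first lia.
have {}hx' : x' \is (n + m).-homog by case: hx' => + _; rewrite addnS subn1.
have [y hy hJ] := IH _ hx'; exists y => //.
apply: (pair_ideal_trans hI); rewrite exprS -mulrA -mulrBr; exact: pair_idealM.
Qed.

Local Notation top := (2 * e - 2)%N.

(* [residue_form n] extends the residue of binary forms of degree [2e - 2] to
   degree [2e - 2 + n], where every form is [ell ^+ n * x'] modulo the ideal. *)
Definition residue_form n x : K := residue (restr
  (xget 0 [set x' | x' \is top.-homog /\ pair_ideal (x - ell ^+ n * x')])).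

Lemma residue_pair_ideal x : x \is top.-homog ->
  residue (restr x) = 0 <-> binary_ideal top (restr x).
Proof.
move=> hx; apply: (binary_residue0 sa sb bv1) => //.
case: (restr_decomp p1 p2 b0 hx) => + _; lia.
Qed.

Lemma residueB w1 w2 : residue (w1 - w2) = residue w1 - residue w2.
Proof. by rewrite addrC -scaleN1r binary_residueD mulN1r addrC. Qed.

(** Two choices of [x'] differ by a form whose product with [ell ^+ n] is in the ideal; regularity
    of [ell] puts the difference itself there, where the residue is 0. *)
Lemma residue_formE n x x' : x' \is top.-homog -> pair_ideal (x - ell ^+ n * x') ->
  residue_form n x = residue (restr x').
Proof.
move=> hx' hI; rewrite /residue_form; case: xgetP => [y _ [hy hJ]|/(_ x')]; last by case.
apply/eqP; rewrite -subr_eq0 -residueB -rmorphB; apply/eqP.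
have hyx : y - x' \is top.-homog by rewrite rpredB.
apply/residue_pair_ideal => //; apply: restr_pair_ideal => //.
apply: (pair_ideal_regularX hyx (m := n)).
have -> : ell ^+ n * (y - x') = (x - ell ^+ n * x') - (x - ell ^+ n * y) by ring.
exact: pair_idealB.
Qed.

Lemma residue_formP n x : x \is (top + n).-homog ->
  exists x', [/\ x' \is top.-homog, pair_ideal (x - ell ^+ n * x')
              & residue_form n x = residue (restr x')].
Proof.
move=> hx; have [x' hx' hI] := pair_ideal_topX (leqnn _) hx.
by exists x'; split=> //; apply: residue_formE.
Qed.

Lemma residue_formD n c x y : x \is (top + n).-homog -> y \is (top + n).-homog ->
  residue_form n (c *: x + y) = c * residue_form n x + residue_form n y.
Proof.
move=> /residue_formP[x' [hx' hI ->]] /residue_formP[y' [hy' hJ ->]].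
rewrite -binary_residueD -restrZ -rmorphD; apply: residue_formE.
  by rewrite rpredD ?rpredZ.
have -> : c *: x + y - ell ^+ n * (c *: x' + y') =
    c *: (x - ell ^+ n * x') + (y - ell ^+ n * y').
  by rewrite -!mul_mpolyC; ring.
by apply: pair_idealD => //; apply: pair_idealZ.
Qed.

Lemma residue_form_eq n x y : x \is (top + n).-homog -> pair_ideal (y - x) ->
  residue_form n y = residue_form n x.
Proof.
move=> /residue_formP[x' [hx' hI ->]] hyx; apply: residue_formE => //.
exact: pair_ideal_trans hyx hI.
Qed.

Lemma residue_form0 n x : pair_ideal x -> residue_form n x = 0.
Proof.
move=> hx; rewrite (@residue_formE n x 0) ?rpred0 ?mulr0 ?subr0 //.
by rewrite rmorph0 /binary_residue mul0r mod0p coef0.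
Qed.

Lemma residue_formM n x : x \is (top + n).-homog ->
  residue_form n.+1 (ell * x) = residue_form n x.
Proof.
move=> /residue_formP[x' [hx' hI ->]]; apply: residue_formE => //.
by rewrite exprS -mulrA -mulrBr; apply: pair_idealM.
Qed.

Lemma residue_formX n x : x \is top.-homog ->
  residue_form n (ell ^+ n * x) = residue (restr x).
Proof. by move=> hx; apply: (@residue_formE n _ x) => //; rewrite subrr; apply: pair_ideal0. Qed.

(** Test forms that are [ell ^+ l] times a form lifted from the line reduce the hypothesis to the
    residue pairing on the line. *)
Lemma residue_nondeg_step m n l x : (top <= n)%N -> (m + n = top + l)%N ->
    x \is m.-homog -> (forall h, h \is n.-homog -> residue_form l (x * h) = 0) ->
  exists2 x', homog_sub m 1 x' & pair_ideal (x - ell * x').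
Proof.
move=> hn hmn hx hr; have [hm|hm] := leqP (2 * e - 1) m; first exact: pair_ideal_top.
apply: binary_ideal_lift => //.
apply: (binary_nondeg sa sb bv1) => //; first lia.
move=> w sw; have hH : bihom (top - m) w 'X_o0 lc \is (top - m).-homog.
  by apply: bihom_homog; [exact: homogX|exact: line_coord_homog].
have hxH : x * bihom (top - m) w 'X_o0 lc \is top.-homog.
  by have := dhomogM hx hH; rewrite subnKC //; lia.
have sw' : (size w <= (top - m).+1)%N by apply: leq_trans sw _; lia.
have rE : restr (x * bihom (top - m) w 'X_o0 lc) = restr x * w.
  by rewrite rmorphM /= restr_lift.
rewrite -rE; apply/residue_pair_ideal => //.
rewrite -(residue_formX l hxH) mulrCA; apply: hr.
have -> : n = (top - m + l)%N by lia.
exact: homog_formM.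
Qed.

(** Induction on [m]: [x] is congruent to [ell * x'], and [x'] inherits the orthogonality because
    multiplication by [ell] preserves residues. *)
Lemma residue_nondeg m n l x : (top <= n)%N -> (m + n = top + l)%N ->
    x \is m.-homog -> (forall h, h \is n.-homog -> residue_form l (x * h) = 0) ->
  pair_ideal x.
Proof.
move=> hn; elim: m l x => [|m IH] l x hmn hx hr.
all: have [x' hx' hI] := residue_nondeg_step hn hmn hx hr.
  by move: hI; case: hx' => _ -> //; rewrite mulr0 subr0.
have {}hx' : x' \is m.-homog by case: hx' => + _; rewrite subn1.
suff /(pair_idealM ell) hJ : pair_ideal x'.
  by rewrite -(subrK (ell * x') x); apply: pair_idealD.
case: l hmn hr => [|l] hmn hr; first lia.
apply: (IH l) => // [|h hh]; first lia.
have hxh : x' * h \is (top + l).-homog.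
  by have := dhomogM hx' hh; rewrite (_ : m + n = top + l)%N //; lia.
rewrite -residue_formM // -(hr _ hh); apply/esym; apply: residue_form_eq.
  by rewrite addnS; apply: homog_sub_homog (line_form_homog _ _ _); apply: homog_subS.
by rewrite mulrA -mulrBl mulrC; apply: pair_idealM.
Qed.

Lemma residue_orthogonal j l h : (j.+1 <= top)%N -> h \is (j + l).-homog ->
    (forall l' g, l = l'.+1 -> g \is (top - j.+1).-homog -> residue_form l' (g * h) = 0) ->
  exists2 h', h' \is j.-homog & pair_ideal (h - ell ^+ l * h').
Proof.
move=> hj; elim: l h => [|l IH] h hh hr.
  rewrite addn0 in hh; exists h => //.
  by rewrite expr0 mul1r subrr; apply: pair_ideal0.
have [h' hh' hI] : exists2 h', homog_sub (j + l.+1) 1 h' & pair_ideal (h - ell * h').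
  have [hm|hm] := leqP (2 * e - 1) (j + l.+1); first exact: pair_ideal_top.
  apply: binary_ideal_lift => //; apply: (binary_nondeg sa sb bv1) => //; first lia.
  move=> w sw; have hH : bihom (top - (j + l.+1)) w 'X_o0 lc \is (top - (j + l.+1)).-homog.
    by apply: bihom_homog; [exact: homogX|exact: line_coord_homog].
  have hxH : h * bihom (top - (j + l.+1)) w 'X_o0 lc \is top.-homog.
    by have := dhomogM hh hH; rewrite subnKC //; lia.
  have sw' : (size w <= (top - (j + l.+1)).+1)%N by apply: leq_trans sw _; lia.
  have rE : restr (h * bihom (top - (j + l.+1)) w 'X_o0 lc) = restr h * w.
    by rewrite rmorphM /= restr_lift.
  rewrite -rE; apply/residue_pair_ideal => //.
  rewrite -(residue_formX l hxH) mulrCA mulrC; apply: hr => //.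
  have -> : (top - j.+1 = top - (j + l.+1) + l)%N by lia.
  exact: homog_formM.
have {}hh' : h' \is (j + l).-homog by case: hh' => + _; rewrite addnS subn1.
have [|h2 hh2 hJ] := IH _ hh'.
  move=> l' g lE hg; rewrite lE in hh' hr.
  have hgh : g * h' \is (top + l').-homog.
    by have := dhomogM hg hh'; rewrite (_ : top - j.+1 + (j + l'.+1) = top + l')%N //; lia.
  rewrite -residue_formM // -(hr _ _ erefl hg); apply/esym.
  apply: residue_form_eq.
    by rewrite addnS; apply: homog_sub_homog (line_form_homog _ _ _); apply: homog_subS.
  by rewrite mulrCA -mulrBr; apply: pair_idealM.
exists h2 => //; apply: (pair_ideal_trans hI); rewrite exprS -mulrA -mulrBr.
exact: pair_idealM.
Qed.

Variable c : S.
Hypothesis hc : c \is e.-homog.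

(** Nondegeneracy turns orthogonality of [g] to the multiples of [c] into membership of [g * c] in
    [(a, b)], that is, into a syzygy of degree [m]. *)
Lemma residue_annihilator m n l g : (top <= n)%N -> (m + e + n = top + l)%N ->
    g \is m.-homog ->
    (forall q, q \is n.-homog -> residue_form l (g * (c * q)) = 0) ->
  exists al be, [/\ al \is m.-homog, be \is m.-homog & al * a + be * b = g * c].
Proof.
move=> hn hmn hg hr; have hgc := dhomogM hg hc.
have hI : pair_ideal (g * c).
  by apply: (residue_nondeg hn hmn) => // q hq; rewrite -mulrA; apply: hr.
have [al [be [hal hbe gcE]]] := pair_ideal_homog hgc hI.
by exists al, be; split=> //; apply/(homog_sub_addn m e).
Qed.

(* Pairing with a basis of the forms of degree [k = 2e - 3 - j] is a linear map
   whose kernel comes from degree [j]; without syzygies in degree [k], no linear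
   form on its target vanishes on the multiples of [c]. *)
Lemma stable_of_no_syzygy j N h :
    ((j < top)%N -> forall al be ga : S, al \is (top - j.+1).-homog ->
       be \is (top - j.+1).-homog -> ga \is (top - j.+1).-homog ->
       al * a + be * b + ga * c = 0 -> ga = 0) ->
    (j <= N)%N -> (3 * e <= N)%N -> h \is N.-homog ->
  exists h' q, [/\ h' \is j.-homog, q \is (N - e).-homog
                 & pair_ideal (h - ell ^+ (N - j) * h' - c * q)].
Proof.
move=> nosyz hjN heN hh; have [hj|hj] := leqP top j.
  have [|h' hh' hI] := @pair_ideal_topX j (N - j) h hj; first by rewrite subnKC.
  by exists h', 0; split; rewrite ?rpred0 // mulr0 subr0.
move/(_ hj): nosyz; set k := (top - j.+1)%N => nosyz.
pose l := (k + N - top)%N; have klE : (k + N = top + l)%N by rewrite /l /k; lia.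
pose T := 'X_{1..3 < k.+1}; pose mon (t : 'I_#|{: T}|) := homog_mon K (enum_val t).
have hmon t : mon t \is k.-homog by apply: homog_mon_homog.
have hmq t q : q \is (N - e).-homog -> mon t * (c * q) \is (top + l).-homog.
  move=> hq; have := dhomogM (hmon t) (dhomogM hc hq).
  by rewrite (_ : k + (e + (N - e)) = top + l)%N // -klE; lia.
have hmh t : mon t * h \is (top + l).-homog by rewrite -klE; apply: dhomogM.
(* The image of the multiples of [c] under pairing with the monomials of degree [k]; the vector
   attached to [h] will be shown to lie in it. *)
pose W (w : 'rV[K]_#|{: T}|) := exists2 q, q \is (N - e).-homog &
  forall t, w 0 t = residue_form l (mon t * (c * q)).
have [||M hM] := @subspace_mx K _ W.
- exists 0; first exact: rpred0.
  by move=> t; rewrite mxE !mulr0 residue_form0 //; apply: pair_ideal0.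
- move=> x u w [q hq hu] [q' hq' hw]; exists (x *: q + q'); first by rewrite rpredD ?rpredZ.
  move=> t; rewrite !mxE hu hw -residue_formD ?hmq //.
  by congr residue_form; rewrite -!mul_mpolyC; ring.
pose w : 'rV[K]_#|{: T}| := \row_t residue_form l (mon t * h).
have res_sum (mu : 'I_#|{: T}| -> K) q : (forall t, mon t * q \is (top + l).-homog) ->
    residue_form l ((\sum_t mu t *: mon t) * q) = \sum_t mu t * residue_form l (mon t * q).
  move=> hq; suff: (\sum_t mu t *: mon t) * q \is (top + l).-homog /\
    residue_form l ((\sum_t mu t *: mon t) * q) = \sum_t mu t * residue_form l (mon t * q) by case.
  elim/big_rec2: _ => [|t x y _ [hx <-]].
    by rewrite mul0r rpred0 residue_form0 //; apply: pair_ideal0.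
  rewrite mulrDl -scalerAl residue_formD //; split=> //.
  by rewrite rpredD ?rpredZ.
have : W w.
  apply/hM; rewrite submxE; apply/eqP/rowP => i; rewrite !mxE.
  (* A column of the cokernel matrix is a linear form vanishing on [W]. Its entries are the
     coefficients of a form [g] of degree [k] orthogonal to every multiple of [c], which the absence
     of syzygies forces to be 0. *)
  pose mu t := cokermx M t i; pose g := \sum_t mu t *: mon t.
  have hg : g \is k.-homog by apply: rpred_sum => t _; apply: rpredZ.
  have -> : \sum_t w 0 t * cokermx M t i = residue_form l (g * h).
    by rewrite res_sum //; apply: eq_bigr => t _; rewrite mxE mulrC.
  have [|||al [be [hal hbe gcE]]] := @residue_annihilator k (N - e) l g _ _ hg.
  - lia.
  - by rewrite -klE; lia.
  - move=> q hq; rewrite res_sum => [|t]; last exact: hmq.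
    pose wq : 'rV[K]_#|{: T}| := \row_t residue_form l (mon t * (c * q)).
    have : (wq <= M)%MS by apply/hM; exists q => // t; rewrite mxE.
    rewrite submxE => /eqP/rowP/(_ i); rewrite !mxE; apply: etrans.
    by apply: eq_bigr => t _; rewrite mxE mulrC.
  have -> : g = 0.
    apply/eqP; rewrite -oppr_eq0; apply/eqP; apply: (nosyz al be) => //.
      by rewrite rpredN.
    by rewrite gcE mulNr subrr.
  by rewrite mul0r residue_form0 //; apply: pair_ideal0.
case=> q hq hw; have hcq : h - c * q \is N.-homog.
  by rewrite rpredB // -[N](@subnKC e) ?dhomogM //; lia.
(* The difference [h - c * q] is orthogonal to all forms of degree [k], hence comes from degree
   [j]. *)
have [||h' hh' hI] := @residue_orthogonal j (N - j) (h - c * q) hj.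
- by rewrite subnKC.
- move=> l' g lE hg; have {lE} -> : l' = l by rewrite /l /k; lia.
  have hpq t : mon t * (h - c * q) \is (top + l).-homog.
    by rewrite mulrBr rpredB // hmq.
  have gE : g = \sum_(t < #|{: T}|) g@_(enum_val t : T) *: mon t.
    by rewrite {1}(homog_monE hg) -(sum_enum_val (fun m : T => g@_m *: homog_mon K m)).
  rewrite gE res_sum // big1 // => t _.
  have -> : mon t * (h - c * q) = (-1) *: (mon t * (c * q)) + mon t * h.
    by rewrite scaleN1r; ring.
  rewrite residue_formD ?hmq // mulN1r -hw mxE addNr mulr0 //.
exists h', q; split=> //.
by rewrite addrAC.
Qed.

End CompleteIntersection.

(** * Points where a polynomial does not vanish *)

Section NonVanishing.
Variable K : closedFieldType.

Lemma horner_eq0 (p : {poly K}) : (forall x, p.[x] = 0) -> p = 0.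
Proof.
move=> hp; apply/eqP; apply: contraT => /closed_nonrootP[x].
by rewrite /root hp eqxx.
Qed.

Lemma meval_eq0 n (g : {mpoly K[n]}) : (forall v, g.@[v] = 0) -> g = 0.
Proof.
elim: n g => [|n IH] g hg.
  by have := hg (fun=> 0); rewrite [g]nvar0_mpolyC mevalC => ->; rewrite mpolyC0.
pose X (i : 'I_n.+1) : {poly {mpoly K[n]}} :=
  if unlift ord_max i is Some j then ('X_j)%:P else 'X.
pose U : {rmorphism {mpoly K[n.+1]} -> {poly {mpoly K[n]}}} :=
  mmap (@polyC _ \o @mpolyC n K) X.
have UX i h : U ('X_i * h) = X i * U h by rewrite rmorphM /= mmapX mmap1U.
have UD a g1 h : U (a *: g1 + h) = a%:MP *: U g1 + U h.
  by rewrite rmorphD /= mmapZ /= mul_polyC.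
move: U UX UD => U UX UD.
have mpD p q : mpwiden (p + q) = mpwiden p + mpwiden q :> {poly {mpoly K[n.+1]}}.
  exact: raddfD.
have mpM p q : mpwiden (p * q) = mpwiden p * mpwiden q :> {poly {mpoly K[n.+1]}}.
  exact: rmorphM.
have gE : g = (mpwiden (U g)).['X_ord_max].
  elim/mpoly_ind: g {hg} => [a g1 h hg1 hh| | |i g1 hg1].
  - rewrite UD mpD mpwidenZ hornerD hornerZ -hg1 -hh mwidenC.
    by rewrite mul_mpolyC.
  - by rewrite rmorph0 raddf0 horner0.
  - by rewrite !rmorph1 hornerC.
  rewrite UX mpM hornerM -hg1; congr (_ * _); rewrite /X.
  case: unliftP => [j ->|->]; last by rewrite mpwidenX hornerX.
  rewrite mpwidenC hornerC mwidenX mnmwiden1; congr 'X_[_].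
  by congr U_(_)%MM; apply: val_inj; rewrite /= /bump leqNgt ltn_ord.
have meD (v : 'I_n -> K) (p q : {poly {mpoly K[n]}}) : map_poly (meval v) (p + q) = map_poly (meval v) p + map_poly (meval v) q.
  exact: rmorphD.
have meM (v : 'I_n -> K) (p q : {poly {mpoly K[n]}}) : map_poly (meval v) (p * q) = map_poly (meval v) p * map_poly (meval v) q.
  exact: rmorphM.
have hor v x : (map_poly (meval v) (U g)).[x] = 0.
  rewrite -(hg (fun i => if unlift ord_max i is Some j then v j else x)).
  elim/mpoly_ind: g {hg gE} => [a g1 h hg1 hh| | |i g1 hg1].
  - by rewrite UD meD map_polyZ hornerD hornerZ hg1 hh /= mevalC mevalD mevalZ.
  - by rewrite !rmorph0 horner0.
  - by rewrite !rmorph1 hornerC.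
  rewrite UX meM mevalM hornerM hg1 mevalXU; congr (_ * _); rewrite /X.
  by case: unliftP => [j _|_]; rewrite ?map_polyC ?map_polyX ?hornerX //= hornerC mevalXU.
suff U0 : U g = 0 by rewrite gE U0 raddf0 horner0.
apply/polyP => i; rewrite coef0; apply: IH => v.
by rewrite -coef_map /= (horner_eq0 (hor v)) coef0.
Qed.

Lemma meval_neq0 n (g : {mpoly K[n]}) : g != 0 -> exists v, g.@[v] != 0.
Proof.
move=> g0; apply: contrapT => hv; move/eqP: g0; apply; apply: meval_eq0 => v.
by apply/eqP; apply: contraT => hgv; case: hv; exists v.
Qed.

Lemma mevalZ_homog k n (g : {mpoly K[k]}) c (v : 'I_k -> K) : g \is n.-homog ->
  g.@[fun i => c * v i] = c ^+ n * g.@[v].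
Proof. by move=> hg; rewrite /meval (mmap_scale _ _ _ hg). Qed.

(** By homogeneity, vanishing on the affine hyperplane [L = c] spreads to all points where [L] is
    nonzero; multiplication by [L] takes care of the others. *)
Lemma homog_eq0 k n (g L : {mpoly K[k]}) c : g \is n.-homog -> L \is 1.-homog ->
    L != 0 -> c != 0 -> (forall v, L.@[v] = c -> g.@[v] = 0) ->
  g = 0.
Proof.
move=> hg hL L0 c0 h; apply: (mulfI L0); rewrite mulr0; apply: meval_eq0 => v.
rewrite mevalM; apply/eqP; rewrite mulf_eq0; apply/orP.
have [|Lv] := eqVneq L.@[v] 0; [by left|right].
have := h (fun i => c / L.@[v] * v i); rewrite !(mevalZ_homog _ _ hL) expr1 divfK //.
move=> /(_ erefl) /eqP; rewrite (mevalZ_homog _ _ hg) mulf_eq0 => /orP[|//].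
by rewrite expf_eq0 mulf_eq0 invr_eq0 (negPf c0) (negPf Lv) andbF.
Qed.

End NonVanishing.

(** The kernel of [ev] is generated by [q], so [q] is prime and divides [g] or [h]. In the first
    case one of the two factors [q] of the square cancels and the other moves into [h']. *)
Lemma strip_prime (A A' : idomainType) (ev : {rmorphism A -> A'}) (q F g h : A) :
    q != 0 -> (forall x, ev x = 0 -> exists y, x = q * y) -> ev q = 0 ->
    q * F = g ^+ 2 * h ->
  exists g' h', F = g' ^+ 2 * h' /\ (g = g' \/ g = q * g').
Proof.
move=> q0 evK evq0 E.
have : ev g ^+ 2 * ev h = 0 by rewrite -rmorphXn -rmorphM -E rmorphM /= evq0 mul0r.
move/eqP; rewrite mulf_eq0 expf_eq0 /= => /orP[/eqP/evK[y gE]|/eqP/evK[y hE]].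
  exists y, (q * h); split; last by right.
  by apply: (mulfI q0); rewrite E gE; ring.
exists g, y; split; last by left.
by apply: (mulfI q0); rewrite E hE; ring.
Qed.

(** A substitute for Gauss's lemma: [c] splits into linear factors, each of them prime in the
    bivariate ring as generator of the kernel of an evaluation, and these are removed one at a
    time. *)
Lemma poly_strip_const (K : closedFieldType) (c : {poly K}) (F g h : {poly {poly K}}) :
    c != 0 -> c *: F = g ^+ 2 * h ->
  exists g' h', F = g' ^+ 2 * h' /\ size g' = size g.
Proof.
elim: {c}(size c) {-2}c (leqnn (size c)) g h => [|n IH] c.
  by rewrite size_poly_leq0 => ->.
move=> sc g h c0 E; have [sc1|sc1] := leqP (size c) 1.
  have [a a0 cE] : exists2 a, a != 0 & c = a%:P.
    exists (c`_0); last exact: size1_polyC.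
    by apply: contra c0 => /eqP a0; rewrite (size1_polyC sc1) a0.
  exists g, (a^-1%:P *: h); split=> //.
  rewrite -scalerAr -E cE scalerA -polyCM mulVf // scale1r //.
have [b rb] : exists b, root c b by apply/closed_rootP; rewrite gtn_eqF.
have [c' cE] := factor_theorem _ _ rb.
have q0 : ('X - b%:P)%:P != 0 :> {poly {poly K}} by rewrite polyC_eq0 polyXsubC_eq0.
have c'0 : c' != 0 by apply: contraNneq c0 => c'0; rewrite cE c'0 mul0r.
have [||| g' [h' [E' gE]]] := @strip_prime _ _ (map_poly (horner_eval b))
   ('X - b%:P)%:P (c' *: F) g h q0.
- move=> x hx; exists (\poly_(i < size x) (x`_i %/ ('X - b%:P))).
  apply/polyP => i; rewrite coefCM coef_poly; case: ltnP => hi; last first.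
    by rewrite mulr0 nth_default.
  rewrite mulrC divpK // dvdp_XsubCl /root -/(horner_eval b x`_i).
  by rewrite -coef_map hx coef0.
- by rewrite /= map_polyC /= /horner_eval hornerXsubC subrr.
- by rewrite -E cE mul_polyC scalerA mulrC.
have [|g2 [h2 [FE sg]]] := IH c' _ g' h' c'0 E'.
  rewrite -ltnS; apply: leq_trans sc; rewrite cE size_mul ?polyXsubC_eq0 //.
  by rewrite size_XsubC addn2.
exists g2, h2; split=> //; rewrite sg.
by case: gE => -> //; rewrite mul_polyC size_scale // polyXsubC_eq0.
Qed.

(** * A line avoiding the singular points *)

Section GoodLine.
Variable K : numClosedFieldType.
Local Notation S := {mpoly K[3]}.
Implicit Types (f g h : S).

Lemma restr_mulX p1 p2 b i g :
  restr p1 p2 b ('X_i * g) = line_point p1 p2 b i * restr p1 p2 b g.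
Proof. by rewrite rmorphM /= restrX. Qed.

Lemma restr_deriv p1 p2 b g : (restr p1 p2 b g)^`() =
  restr p1 p2 b g^`M(o0) + p1 *: restr p1 p2 b g^`M(o1) + p2 *: restr p1 p2 b g^`M(o2).
Proof.
elim/mpoly_ind: g => [a g h Pg Ph| | |i g Pg].
- rewrite rmorphD /= restrZ derivD derivZ Pg Ph !mderivD !mderivZ !rmorphD /= !restrZ.
  by rewrite !scalerDr !scalerA ![_ * a]mulrC; ring.
- by rewrite !mderiv0 !rmorph0 deriv0 !scaler0 !addr0.
- by rewrite -mpolyC1 !mderivC mpolyC1 !rmorph0 rmorph1 -polyC1 derivC !scaler0 !addr0.
rewrite !mderivM !mderivXU !rmorphD /= restr_mulX derivM Pg !restr_mulX !rmorphM /=.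
rewrite !rmorph_nat; elim/ord3P: i; rewrite /line_point /= ?mul0r ?mul1r ?add0r.
- by rewrite derivX mul1r -!mul_polyC; ring.
- by rewrite derivD derivZ derivX -polyC1 derivC -!mul_polyC; ring.
- by rewrite derivD derivZ derivX derivC -!mul_polyC; ring.
Qed.

(* The pencil of lines through (1 : p1 : p2), with parameter [t] on each line and
   coefficients in the parameter of the pencil. *)
Definition pencil_point p1 p2 (i : 'I_3) : {poly {poly K}} :=
  match val i with
  | 0%N => 'X | 1%N => p1%:P *: 'X + 1 | _ => p2%:P *: 'X + 'X%:P
  end.

Definition pencil p1 p2 g : {poly {poly K}} :=
  mmap (polyC \o polyC) (pencil_point p1 p2) g.

HB.instance Definition _ p1 p2 := GRing.RMorphism.copy (pencil p1 p2)
  (mmap (polyC \o polyC) (pencil_point p1 p2)).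

Lemma pencilX p1 p2 i : pencil p1 p2 'X_i = pencil_point p1 p2 i.
Proof. by rewrite /pencil mmapX mmap1U. Qed.

Lemma pencilZ p1 p2 a g : pencil p1 p2 (a *: g) = a%:P *: pencil p1 p2 g.
Proof. by rewrite /pencil mmapZ /= mul_polyC. Qed.

Lemma pencil_restr p1 p2 b g :
  map_poly (horner_eval b) (pencil p1 p2 g) = restr p1 p2 b g.
Proof.
elim/mpoly_ind: g => [a g h Pg Ph| | |i g Pg].
- by rewrite !rmorphD /= pencilZ restrZ map_polyZ /= Pg Ph /horner_eval hornerC.
- by rewrite !rmorph0.
- by rewrite !rmorph1.
rewrite !rmorphM /= Pg restrX pencilX; congr (_ * _).
elim/ord3P: i; rewrite /pencil_point /line_point /=.
- by rewrite map_polyX.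
- by rewrite rmorphD /= map_polyZ map_polyX rmorph1 /= /horner_eval hornerC.
- by rewrite rmorphD /= map_polyZ map_polyX map_polyC /= /horner_eval hornerC hornerX.
Qed.

Lemma restr_meval p1 p2 g (v : 'I_3 -> K) : v o1 - p1 * v o0 = 1 ->
  g.@[v] = (restr p1 p2 (v o2 - p2 * v o0) g).[v o0].
Proof.
move=> hv; elim/mpoly_ind: g => [a g h Pg Ph| | |i g Pg].
- by rewrite mevalD mevalZ rmorphD /= restrZ hornerD hornerZ -Pg -Ph.
- by rewrite meval0 rmorph0 horner0.
- by rewrite meval1 rmorph1 hornerC.
rewrite mevalM mevalXU restr_mulX hornerM -Pg; congr (_ * _).
elim/ord3P: i; rewrite /line_point /= ?hornerD ?hornerZ ?hornerX ?hornerC //.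
  by rewrite -hv addrC subrK.
by rewrite addrC subrK.
Qed.

Lemma line_coord_neq0 p1 : line_coord p1 != 0 :> S.
Proof.
apply/eqP => /(congr1 (meval (fun i : 'I_3 => (i == o1)%:R))).
rewrite /line_coord rmorphB /= !mevalZ !mevalXU meval0 /= !mulr0 subr0.
by apply/eqP; rewrite oner_eq0.
Qed.

Lemma pencil_eq0 p1 p2 n g : g \is n.-homog -> pencil p1 p2 g = 0 -> g = 0.
Proof.
move=> hg g0; apply: (@homog_eq0 _ _ n g (line_coord p1) 1 hg).
- exact: line_coord_homog.
- exact: line_coord_neq0.
- exact: oner_neq0.
move=> v; rewrite /line_coord rmorphB /= mevalZ !mevalXU => /(restr_meval p2) ->.
by rewrite -pencil_restr g0 rmorph0 horner0.
Qed.

Lemma pencil_coord p1 p2 : pencil p1 p2 (line_coord p1) = 1.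
Proof.
rewrite /line_coord rmorphB /= pencilZ !pencilX /pencil_point /=.
by rewrite addrAC subrr add0r.
Qed.

(** [pencil] is dehomogenization by [line_coord = 1]; the inner and outer variables are the images
    of ['X_o2 - p2 *: 'X_o0] and ['X_o0]. Powers of [line_coord] adjust the degree, so every large
    degree works. *)
Lemma pencil_surj p1 p2 (w : {poly {poly K}}) :
  exists n0, forall n, (n0 <= n)%N -> exists2 g, g \is n.-homog & pencil p1 p2 g = w.
Proof.
have hc := line_coord_homog p1 : line_coord p1 \is 1.-homog.
pose z : S := 'X_o2 - p2 *: 'X_o0.
have hz : z \is 1.-homog by rewrite rpredB ?rpredZ ?homogX.
have pz : pencil p1 p2 z = 'X%:P.
  rewrite /z rmorphB /= pencilZ !pencilX /pencil_point /=.
  by rewrite addrAC subrr add0r.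
have step (x : {poly {poly K}}) y : y \is 1.-homog -> pencil p1 p2 y = x -> forall w n0,
    (forall n, (n0 <= n)%N -> exists2 g, g \is n.-homog & pencil p1 p2 g = w) ->
    forall n, (n0.+1 <= n)%N -> exists2 g, g \is n.-homog & pencil p1 p2 g = w * x.
  move=> hy <- {}w n0 hw [//|n] hn; have [g hg <-] := hw n hn.
  exists (y * g); last by rewrite rmorphM mulrC.
  by apply: (homog_sub_homog (homog_subS hg) hy).
have one : forall n, (0 <= n)%N -> exists2 g, g \is n.-homog & pencil p1 p2 g = 1.
  move=> n _; exists (line_coord p1 ^+ n); last by rewrite rmorphXn /= pencil_coord expr1n.
  by have := dhomogMn n hc; rewrite mul1n.
have add (w1 w2 : {poly {poly K}}) n1 n2 :
    (forall n, (n1 <= n)%N -> exists2 g, g \is n.-homog & pencil p1 p2 g = w1) ->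
    (forall n, (n2 <= n)%N -> exists2 g, g \is n.-homog & pencil p1 p2 g = w2) ->
    forall n, (maxn n1 n2 <= n)%N -> exists2 g, g \is n.-homog & pencil p1 p2 g = w1 + w2.
  move=> h1 h2 n; rewrite geq_max => /andP[/h1[g1 hg1 <-] /h2[g2 hg2 <-]].
  by exists (g1 + g2); rewrite ?rmorphD ?rpredD.
elim/poly_ind: w => [|w c [n1 h1]].
  by exists 0%N => n _; exists 0; rewrite ?rpred0 ?rmorph0.
have [n2 h2] : exists n2, forall n, (n2 <= n)%N ->
    exists2 g, g \is n.-homog & pencil p1 p2 g = c%:P.
  elim/poly_ind: c => [|c a [n3 h3]].
    by exists 0%N => n _; exists 0; rewrite ?rpred0 ?rmorph0.
  have ha : forall n, (0 <= n)%N -> exists2 g, g \is n.-homog & pencil p1 p2 g = a%:P%:P.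
    move=> n /one[g hg gE]; exists (a *: g); first by rewrite rpredZ.
    by rewrite pencilZ gE -mul_polyC mulr1.
  eexists; rewrite polyCD polyCM; exact: add (step _ _ hz pz _ _ h3) ha.
eexists; apply: add h2; apply: (step 'X 'X_o0 (homogX _ o0)) h1.
by rewrite pencilX.
Qed.

Lemma strip_line_coord p1 p2 m f g h : line_coord p1 ^+ m * f = g ^+ 2 * h ->
  exists g' h', f = g' ^+ 2 * h' /\ pencil p1 p2 g' = pencil p1 p2 g.
Proof.
elim: m f g h => [|m IH] f g h; first by rewrite expr0 mul1r; exists g, h.
pose X (i : 'I_3) : S := if i == o1 then p1 *: 'X_o0 else 'X_i.
pose ev : {rmorphism S -> S} := mmap (@mpolyC 3 K) X.
have evX i x : ev ('X_i * x) = X i * ev x by rewrite rmorphM /= mmapX mmap1U.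
have evZ a x : ev (a *: x) = a *: ev x by rewrite /= mmapZ mul_mpolyC.
rewrite exprS -mulrA => E.
have [||g1 [h1 [E1 gE]]] := @strip_prime _ _ ev _ _ _ _ (line_coord_neq0 p1) _ _ E.
- move=> x; suff [q xE] : exists q, x = ev x + line_coord p1 * q.
    by move=> ev0; exists q; rewrite {1}xE ev0 add0r.
  elim/mpoly_ind: x => [a x y [q xE] [q' yE]| | |i x [q xE]].
  + exists (a *: q + q'); rewrite rmorphD evZ {1}xE {1}yE scalerDr mulrDr -scalerAr.
    by rewrite addrACA.
  + by exists 0; rewrite rmorph0 mulr0 addr0.
  + by exists 0; rewrite rmorph1 mulr0 addr0.
  have X1E : 'X_o1 = p1 *: 'X_o0 + line_coord p1 by rewrite addrC subrK.
  rewrite evX; elim/ord3P: i; rewrite /X /=.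
  + by exists ('X_o0 * q); rewrite {1}xE mulrDr mulrCA.
  + exists (ev x + 'X_o1 * q); rewrite {1}xE mulrDr {1}X1E mulrDl mulrDr -addrA.
    by congr (_ + (_ + _)); rewrite mulrCA.
  by exists ('X_o2 * q); rewrite {1}xE mulrDr mulrCA.
- rewrite /line_coord rmorphB evZ -['X_o1]mulr1 -['X_o0]mulr1 !evX rmorph1.
  by rewrite /X /= !mulr1 subrr.
have [g2 [h2 [fE pE]]] := IH _ _ _ E1; exists g2, h2; split=> //; rewrite pE.
by case: gE => -> //; rewrite rmorphM /= pencil_coord mul1r.
Qed.

(** A square factor of the dehomogenized polynomial lifts to one of [line_coord p1 ^+ m * f].
    Removing the power of [line_coord] does not change its image, and reducedness makes it a
    unit. *)
Lemma reduced_pencil p1 p2 n f (c : {poly K}) (g h : {poly {poly K}}) :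
    f \is n.-homog -> reduced_poly f -> c != 0 ->
    c *: pencil p1 p2 f = g ^+ 2 * h ->
  (size g <= 1)%N.
Proof.
move=> hf [_ red] c0 /(poly_strip_const c0)[g1 [h1 [FE <-]]].
have [n1 sg] := pencil_surj p1 p2 g1; have [n2 sh] := pencil_surj p1 p2 h1.
(* The extra [n] makes the degree of [G ^+ 2 * H] at least that of [f]; the excess is [m]. *)
have [G hG GE] := sg (n1 + n)%N (leq_addr _ _).
have [H hH HE] := sh n2 (leqnn _).
pose m := (n1 + n + n1 + n2)%N.
have E : line_coord p1 ^+ m * f = G ^+ 2 * H.
  apply/eqP; rewrite -subr_eq0; apply/eqP; apply: (@pencil_eq0 p1 p2 (m + n)).
    rewrite rpredB //.
      have := dhomogM (dhomogMn m (line_coord_homog p1)) hf.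
      by rewrite mul1n.
    have := dhomogM (dhomogMn 2 hG) hH.
    by rewrite (_ : (n1 + n) * 2 + n2 = m + n)%N // /m; lia.
  rewrite rmorphB !rmorphM !rmorphXn /= pencil_coord expr1n mul1r GE HE FE.
  by rewrite subrr.
have [G' [H' [fE pE]]] := @strip_line_coord p1 p2 m f G H E.
have : pencil p1 p2 G' \is a GRing.unit by apply: rmorph_unit; apply: red fE.
rewrite pE GE.
by rewrite poly_unitE => /andP[/eqP -> _].
Qed.

(** Divisibility over the domain [{poly K}] holds up to nonzero scalars, hence [c], [c1], [c2]. The
    nonvanishing of derivatives comes from characteristic 0. *)
Lemma separable_pencil p1 p2 n f : f \is n.-homog -> reduced_poly f ->
  separable_poly (pencil p1 p2 f).
Proof.
move=> hf red; apply/separable_polyP; split=> [u v uv|u uf su].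
  rewrite /coprimep; apply: contraT => hs.
  have [[c q] /= c0 cE] := Pdiv.Idomain.dvdpP _ _ uv.
  have [[c1 q1] /= c10 c1E] := Pdiv.Idomain.dvdpP _ _ (dvdp_gcdl u v).
  have [[c2 q2] /= c20 c2E] := Pdiv.Idomain.dvdpP _ _ (dvdp_gcdr u v).
  have g0 : gcdp u v != 0.
    apply/eqP => /eqP; rewrite gcdp_eq0 => /andP[/eqP u0 _].
    move/eqP: cE; rewrite u0 mul0r mulr0 scale_poly_eq0 (negPf c0) /=.
    by move=> /eqP/(pencil_eq0 hf) f0; case: red => /eqP.
  have : (size (gcdp u v) <= 1)%N.
    apply: (@reduced_pencil p1 p2 n f (c1 * c2 * c) (gcdp u v) (q * q1 * q2)) => //.
      by rewrite !mulf_neq0.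
    rewrite -scalerA cE.
    have -> : (c1 * c2) *: (q * (u * v)) = q * ((c1 *: u) * (c2 *: v)).
      by rewrite -!mul_polyC polyCM; ring.
    rewrite c1E c2E; ring.
  by move: hs g0; rewrite -size_poly_gt0; case: (size _) => [|[|]].
have [k sk] : exists k, size u = k.+2 by case: (size u) su => [|[|k]] // _; exists k.
apply/eqP => /polyP/(_ k); rewrite coef_deriv coef0 -scaler_nat => /eqP.
rewrite scaler_eq0 pnatr_eq0 /=.
have := lead_coef_eq0 u; rewrite /lead_coef sk /= => ->.
by rewrite -size_poly_eq0 sk.
Qed.

(** The coefficient of index [n] is the value at the parameter infinity, the point
    [(1 : p1 : p2)]. *)
Lemma restr_coef p1 p2 b n g : g \is n.-homog ->
  (restr p1 p2 b g)`_n = g.@[fun i => (line_point p1 p2 b i)`_1].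
Proof.
move=> hg; apply: (homog_ind (P := fun n g =>
  (restr p1 p2 b g)`_n = g.@[fun i => (line_point p1 p2 b i)`_1])) hg => {n g}.
- by move=> n; rewrite rmorph0 coef0 meval0.
- by move=> n a g h Pg Ph; rewrite rmorphD /= restrZ coefD coefZ mevalD mevalZ Pg Ph.
- by rewrite rmorph1 meval1 coef1.
move=> n i g hg Pg; rewrite restr_mulX mevalM mevalXU -Pg.
have [sg _] := restr_decomp p1 p2 b hg.
elim/ord3P: i; rewrite /line_point /=.
- by rewrite mulrC coefMX coefX mul1r.
- rewrite mulrDl mul1r coefD -scalerAl coefZ ['X * _]mulrC coefMX /= (nth_default _ sg).
  by rewrite addr0 coefD coefZ coefX coef1 mulr1 addr0 mulrC.
rewrite mulrDl mul_polyC coefD coefZ -scalerAl coefZ ['X * _]mulrC coefMX /= (nth_default _ sg).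
by rewrite mulr0 addr0 coefD coefZ coefX coefC mulr1 addr0 mulrC.
Qed.

Lemma good_line n f : f \is n.-homog -> (0 < n)%N -> reduced_poly f -> f^`M(o0) != 0 ->
  exists p1 p2 b, size (restr p1 p2 b f^`M(o0)) = n /\
    forall x, exists i, (restr p1 p2 b f^`M(i)).[x] != 0.
Proof.
move=> hf n0 red f0.
have [v] : exists v, ('X_o0 * f^`M(o0)).@[v] != 0.
  by apply: meval_neq0; rewrite mulf_neq0 // -msize_poly_eq0 msizeX mdeg1.
rewrite mevalM mevalXU mulf_eq0 negb_or => /andP[v0 fv].
(* The centre of the pencil is a point where the first partial derivative does not vanish, so this
   derivative keeps its full degree on every line of the pencil. *)
pose p1 := v o1 / v o0; pose p2 := v o2 / v o0.
have := separable_pencil p1 p2 hf red; rewrite separable_poly.unlock.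
case/Pdiv.Idomain.Bezout_coprimepP => -[u1 u2] /=.
rewrite -size_poly_eq1 => /eqP su.
set w := _ + _ in su.
have wE : w = (w`_0)%:P by apply: size1_polyC; rewrite su.
have w0 : w`_0 != 0 by rewrite -polyC_eq0 -wE -size_poly_eq0 su.
(* The Bezout combination [w] is nonzero and constant in the line parameter; it plays the role of
   the discriminant, and any nonroot [b] gives a good line. *)
have [b wb] := closed_nonrootP w`_0 w0.
have hfi i : f^`M(i) \is n.-1.-homog.
  by case: (homog_deriv i hf) => + _; rewrite subn1.
exists p1, p2, b; split.
  have [+ _] := restr_decomp p1 p2 b (hfi o0); rewrite prednK // => sf.
  apply/eqP; rewrite eqn_leq sf /=; move: fv; apply: contraR; rewrite -ltnNge => sf1.
  have := mevalZ_homog (v o0) (fun i => (line_point p1 p2 b i)`_1) (hfi o0).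
  rewrite -(restr_coef p1 p2 b (hfi o0)) nth_default ?mulr0; last by rewrite -ltnS prednK.
  move=> <-; apply/eqP/meval_eq => /=; elim/ord3P; rewrite /line_point /=.
  - by rewrite coefX mulr1.
  - by rewrite coefD coefZ coefX coef1 mulr1 addr0 mulrC divfK.
  by rewrite coefD coefZ coefX coefC mulr1 addr0 mulrC divfK.
move=> x; apply: contrapT => hx.
have {}hx i : (restr p1 p2 b f^`M(i)).[x] = 0.
  by apply/eqP; apply: contraT => hi; case: hx; exists i.
(* Euler's relation and the chain rule make [x] a common zero of the restriction and its derivative,
   so that [b] would be a root of [w]. *)
have fx : (restr p1 p2 b f).[x] = 0.
  have /(congr1 (fun g => (restr p1 p2 b g).[x])) := euler hf.
  rewrite restrZ hornerZ rmorph_sum horner_sum big1 => [/esym/eqP|i _].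
    by rewrite mulf_eq0 pnatr_eq0 -leqn0 leqNgt n0 => /eqP.
  by rewrite rmorphM hornerM hx mulr0.
have f'x : (restr p1 p2 b f)^`().[x] = 0.
  by rewrite restr_deriv !hornerD !hornerZ !hx !mulr0 !addr0.
move/negP: wb; apply; rewrite /root.
have : (map_poly (horner_eval b) w).[x] = (w`_0).[b].
  by rewrite {1}wE map_polyC hornerC.
rewrite /w rmorphD !rmorphM /= -deriv_map !pencil_restr hornerD !hornerM fx f'x.
by rewrite !mulr0 addr0 => <-.
Qed.

End GoodLine.

(** * The Jacobian ideal *)

Section JacobianIdeal.
Variable K : fieldType.
Local Notation S := {mpoly K[3]}.
Implicit Types (f g h x : S).

Lemma jacobian_ideal0 f : jacobian_ideal f 0.
Proof. by exists (fun=> 0); rewrite big1 // => i _; rewrite mul0r. Qed.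

Lemma jacobian_idealD f g h :
  jacobian_ideal f g -> jacobian_ideal f h -> jacobian_ideal f (g + h).
Proof.
move=> [u ->] [v ->]; exists (fun i => u i + v i); rewrite -big_split.
by apply: eq_bigr => i _; rewrite mulrDl.
Qed.

Lemma jacobian_idealM f x g : jacobian_ideal f g -> jacobian_ideal f (x * g).
Proof.
move=> [u ->]; exists (fun i => x * u i); rewrite mulr_sumr.
by apply: eq_bigr => i _; rewrite mulrA.
Qed.

Lemma jacobian_idealZ f c g : jacobian_ideal f g -> jacobian_ideal f (c *: g).
Proof. by rewrite -mul_mpolyC; apply: jacobian_idealM. Qed.

Lemma jacobian_ideal_deriv f i : jacobian_ideal f f^`M(i).
Proof.
exists (fun k => (k == i)%:R); rewrite (bigD1 i) //= eqxx mul1r big1 ?addr0 //.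
by move=> k /negPf ->; rewrite mul0r.
Qed.

Lemma jacobian_ideal_sum f (I : Type) (r : seq I) (P : pred I) (F : I -> S) :
  (forall i, P i -> jacobian_ideal f (F i)) -> jacobian_ideal f (\sum_(i <- r | P i) F i).
Proof.
move=> hF; elim/big_rec: _ => [|i x Pi]; first exact: jacobian_ideal0.
by apply: jacobian_idealD; apply: hF.
Qed.

End JacobianIdeal.

(** * From the regular sequence to the Jacobian ideal *)

Section JacobianStructure.
Variable K : numClosedFieldType.
Local Notation S := {mpoly K[3]}.

Lemma exists_notin (s : seq K) : exists x, x \notin s.
Proof.
have /closed_nonrootP[x] : \prod_(z <- s) ('X - z%:P) != 0.
  by rewrite monic_neq0 // monic_prod_XsubC.
by rewrite root_prod_XsubC; exists x.
Qed.

(** The excluded values of [s] are [- b(x) / c(x)] at the finitely many roots [x] of [a]; at a root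
    with [c(x) = 0] the value [b(x)] is nonzero and every [s] works. *)
Lemma coprime_pencil (a b c : {poly K}) : a != 0 ->
    (forall x, a.[x] != 0 \/ b.[x] != 0 \/ c.[x] != 0) ->
  exists s, coprimep a (b + s *: c).
Proof.
move=> a0 h; have [rs aE] := closed_field_poly_normal a.
have [s hs] := exists_notin [seq - b.[x] / c.[x] | x <- rs].
exists s; apply: Pdiv.ClosedField.root_coprimep => x rx; rewrite hornerD hornerZ.
apply: contra hs => /eqP hx.
have xrs : x \in rs.
  by move: rx; rewrite aE rootZ ?lead_coef_eq0 // root_prod_XsubC.
apply/mapP; exists x => //.
have c0 : c.[x] != 0.
  apply/eqP => c0; case: (h x) => [|[]]; rewrite ?c0 ?eqxx //.
    by rewrite (rootP rx) eqxx.
  by move: hx; rewrite c0 mulr0 addr0 => ->; rewrite eqxx.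
by apply: (mulIf c0); rewrite divfK //; apply/eqP; rewrite -addr_eq0 addrC hx.
Qed.

(** All that the sequel needs from duality, with the regular sequence hidden. Here [a] is the first
    partial derivative, [b] is the second plus [s] times the third, and [c] is the third. *)
Lemma jacobian_structure e (f : S) : f \is e.+1.-homog -> (0 < e)%N ->
    reduced_poly f -> f^`M(o0) != 0 ->
  exists2 ell : S, ell \is 1.-homog &
    (forall j N h, ((j < 2 * e - 2)%N -> forall t, AR f (2 * e - 2 - j.+1) t -> t = 0) ->
       (j <= N)%N -> (3 * e <= N)%N -> h \is N.-homog ->
       exists2 h', h' \is j.-homog & jacobian_ideal f (h - ell ^+ (N - j) * h')) /\
    (forall n m x, (2 * e - 2 <= n)%N -> x \is (n + m).-homog ->
       exists2 x', x' \is n.-homog & jacobian_ideal f (x - ell ^+ m * x')).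
Proof.
move=> hf e0 red f0; have hfi i : f^`M(i) \is e.-homog.
  by case: (homog_deriv i hf) => + _; rewrite subn1.
have [p1 [p2 [b0 [sz hx]]]] := good_line hf (ltn0Sn e) red f0.
set rs := restr p1 p2 b0 in sz hx.
have [||s cop] := @coprime_pencil (rs f^`M(o0)) (rs f^`M(o1)) (rs f^`M(o2)).
- by rewrite -size_poly_eq0 sz.
- move=> x; case: (hx x) => i; elim/ord3P: i => h; [by left|by right; left|by right; right].
have [[u v] /= uv] := Bezout_eq1_coprimepP _ _ cop.
pose b := f^`M(o1) + s *: f^`M(o2).
have rsb : rs b = rs f^`M(o1) + s *: rs f^`M(o2) by rewrite /rs /b rmorphD /= restrZ.
have hb : b \is e.-homog by rewrite rpredD ?rpredZ.
have bv1 : rs f^`M(o0) %| v * rs b - 1.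
  by rewrite rsb -uv opprD addrCA subrr addr0 dvdpNr dvdp_mull.
have IJ x : pair_ideal f^`M(o0) b x -> jacobian_ideal f x.
  move=> [al [be ->]]; apply: jacobian_idealD; apply: jacobian_idealM.
    exact: jacobian_ideal_deriv.
  apply: jacobian_idealD; first exact: jacobian_ideal_deriv.
  by apply: jacobian_idealZ; apply: jacobian_ideal_deriv.
exists (line_form p1 p2 b0); first exact: line_form_homog.
split=> [j N h nosyz hj hN hh|n m x hn hx'].
  have [|h' [q [hh' hq hI]]] := stable_of_no_syzygy e0 (hfi o0) hb sz bv1 (hfi o2) _ hj hN hh.
    move=> {}hj al be ga hal hbe hga E.
    (* The relation among [a], [b], [c] rewritten as a syzygy of the original partial
       derivatives. *)
    pose t := [ffun i : 'I_3 => if i == o0 then al else if i == o1 then be else s *: be + ga].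
    have : t = 0.
      apply: (nosyz hj); split=> [i|]; first by rewrite ffunE; do 2?case: ifP => // _; rewrite rpredD ?rpredZ.
      rewrite sum_ord3 !ffunE /= -E /b -!mul_mpolyC; ring.
    move=> t0; have := congr1 (fun u : {ffun 'I_3 -> S} => u o1) t0.
    have := congr1 (fun u : {ffun 'I_3 -> S} => u o2) t0.
    by rewrite /t !ffunE /= => + be0; rewrite be0 scaler0 add0r.
  exists h' => //; rewrite -[_ - _](subrK (f^`M(o2) * q)).
  apply: jacobian_idealD; first exact: IJ.
  by rewrite mulrC; apply: jacobian_idealM; apply: jacobian_ideal_deriv.
have [x' hx2 hI] := pair_ideal_topX e0 (hfi o0) hb sz bv1 hn hx'.
by exists x' => //; apply: IJ.
Qed.

End JacobianStructure.

(** * A Nullstellensatz on a grid *)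

Section Nullstellensatz.
Variable K : closedFieldType.
Local Notation S := {mpoly K[3]}.
Variable ell : S.
Hypothesis ell_homog : ell \is 1.-homog.
Implicit Types (g h x : S).

Lemma ell_homogX n : ell ^+ n \is n.-homog.
Proof. by have := dhomogMn n ell_homog; rewrite mul1n. Qed.

Lemma bihom_prod m (rs : seq K) (u v : S) :
  bihom (m + size rs) (\prod_(z <- rs) ('X - z%:P)) u v =
  v ^+ m * \prod_(z <- rs) (u - z *: v).
Proof.
elim: rs => [|z rs IH].
  rewrite !big_nil addn0 mulr1 /bihom big_ord_recl big1 => [|i _].
    by rewrite coef1 scale1r addr0 mul1r subn0.
  by rewrite coef1 scale0r.
set w := \prod_(_ <- _) _ in IH.
have sw : size w = (size rs).+1 by rewrite size_prod_XsubC.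
have -> : \prod_(z <- z :: rs) ('X - z%:P) = (- z) *: w + 'X * w.
  by rewrite big_cons mulrBl addrC scaleNr mul_polyC.
rewrite [size _]/= addnS bihomD bihom_mulX bihomS ?sw ?ltnS ?leq_addl // IH big_cons.
by rewrite -!mul_mpolyC mpolyCN; ring.
Qed.

(** Modulo the forms ['X_i - v i *: ell] each variable becomes a multiple of [ell], and [b] becomes
    [b(v)] times [ell ^+ n]. *)
Lemma homog_mod_point (v : 'I_3 -> K) n b : b \is n.-homog ->
  exists c : 'I_3 -> S, b = b.@[v] *: ell ^+ n + \sum_i ('X_i - v i *: ell) * c i.
Proof.
move=> hb; apply: (homog_ind (P := fun n b => exists c : 'I_3 -> S,
  b = b.@[v] *: ell ^+ n + \sum_i ('X_i - v i *: ell) * c i)) hb => {n b}.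
- move=> n; exists (fun=> 0); rewrite meval0 scale0r add0r big1 // => i _.
  by rewrite mulr0.
- move=> n a g h [cg gE] [ch hE]; exists (fun i => a *: cg i + ch i).
  rewrite mevalD mevalZ {1}gE {1}hE scalerDr scalerA scalerDl addrACA; congr (_ + _).
  rewrite scaler_sumr -big_split; apply: eq_bigr => i _ /=.
  by rewrite mulrDr -scalerAr.
- exists (fun=> 0); rewrite meval1 scale1r expr0 big1 ?addr0 // => i _.
  by rewrite mulr0.
move=> n k g _ [c gE].
exists (fun i => 'X_k * c i + (if i == k then g.@[v] *: ell ^+ n else 0)).
under eq_bigr do rewrite mulrDr.
rewrite big_split /= [X in _ + (_ + X)](bigD1 k) //= eqxx [X in _ + (_ + (_ + X))]big1; last first.
  by move=> i /negPf ->; rewrite mulr0.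
rewrite mevalM mevalXU {1}gE mulrDr mulr_sumr.
under [in RHS]eq_bigr do rewrite mulrCA.
rewrite -!mul_mpolyC mpolyCM exprS; ring.
Qed.

Variable I : S -> Prop.
Hypotheses (ID : forall x y, I x -> I y -> I (x + y)) (IM : forall x y, I y -> I (x * y)).

Lemma ideal_pow m n x : (m <= n)%N -> I (ell ^+ m * x) -> I (ell ^+ n * x).
Proof. by move=> /subnK <- h; rewrite exprD -mulrA; apply: IM. Qed.

(* Induction on the total length of the root lists. At a point [v] with
   [ell v <> 1], the linear forms [X_k - v_k ell] already generate [ell]. *)
Lemma grid_nullstellensatz (L : 'I_3 -> seq K) m h :
    (forall k, I (ell ^+ m * ((\prod_(z <- L k) ('X_k - z *: ell)) * h))) ->
    (forall v, (forall k, v k \in L k) -> ell.@[v] = 1 ->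
       exists n b, [/\ b \is n.-homog, b.@[v] != 0 & I b]) ->
  exists M, I (ell ^+ M * h).
Proof.
have [n] := ubnP (\sum_i size (L i))%N; elim: n L m h => // n IH L m h sL hL hv.
have [/existsP[k /eqP Lk]|/existsPn hne] := boolP [exists k, L k == [::]].
  by exists m; move: (hL k); rewrite Lk big_nil mul1r.
(* A corner of the grid. Removing [v k] from the list of index [k] gives membership after
   multiplication by ['X_k - v k *: ell]; doing so for each [k], a form of the ideal that is nonzero
   at the corner then removes these factors. *)
pose v k := head 0 (L k).
have LE k : L k = v k :: behead (L k).
  by move: (hne k); rewrite /v; case: (L k).
have /choice[M hM] : forall k, exists M, I (ell ^+ M * (('X_k - v k *: ell) * h)).
  move=> k; apply: (IH (fun i => if i == k then behead (L k) else L i) m).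
  - move: sL; rewrite ltnS; apply: leq_trans.
    rewrite (bigD1 k) //= eqxx [X in (_ < X)%N](bigD1 k) //=.
    have -> : size (L k) = (size (behead (L k))).+1 by rewrite {1}LE.
    rewrite addSn ltnS leq_add2l leq_eqVlt; apply/orP; left; apply/eqP.
    by apply: eq_bigr => i /negPf ->.
  - move=> i; case: eqP => [->|_].
      move: (hL k); rewrite {1}LE big_cons.
      by rewrite (mulrCA (\prod_(_ <- behead _) _)) (mulrA ('X_k - _)).
    move: (hL i) => /(IM ('X_k - v k *: ell)).
    by rewrite mulrCA (mulrCA ('X_k - _)).
  move=> u hu; apply: hv => i; have := hu i; case: eqP => // -> hb.
  by rewrite LE in_cons hb orbT.
pose N := (\sum_k M k)%N.
have hN k : I (ell ^+ N * (('X_k - v k *: ell) * h)).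
  by apply: ideal_pow (hM k); rewrite /N (bigD1 k) //= leq_addr.
have step (c : 'I_3 -> S) : I (ell ^+ N * ((\sum_i ('X_i - v i *: ell) * c i) * h)).
  rewrite mulr_suml mulr_sumr; elim/big_rec: _ => [|i x _ hx].
    by rewrite -(mul0r (ell ^+ N * (('X_o0 - v o0 *: ell) * h))); apply: IM.
  apply: ID => //; rewrite mulrAC mulrA [_ * c i]mulrC; exact: IM.
have fin d a (c : 'I_3 -> S) x : a != 0 -> I x ->
    x = ell ^+ N * ((a *: ell ^+ d + \sum_i ('X_i - v i *: ell) * c i) * h) ->
    exists M, I (ell ^+ M * h).
  move=> a0 Ix xE; exists (N + d)%N.
  have -> : ell ^+ (N + d) * h = (a^-1)%:MP * (x + (-1) *
      (ell ^+ N * ((\sum_i ('X_i - v i *: ell) * c i) * h))).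
    rewrite xE mulN1r -mulrBr -mulrBl addrK mul_mpolyC -scalerAl -scalerAr scalerA.
    by rewrite mulVf // scale1r exprD mulrA.
  by apply: IM; apply: ID => //; apply: IM.
have [hl|hl] := eqVneq ell.@[v] 1.
  have [|d [b [hb bv Ib]]] := hv v _ hl.
    by move=> k; rewrite LE in_cons eqxx.
  have [c bE] := homog_mod_point v hb.
  apply: (fin d b.@[v] c (ell ^+ N * (b * h))) => //; last by rewrite {1}bE.
  by apply: (IM); rewrite mulrC; apply: IM.
have [c lE] := homog_mod_point v ell_homog.
apply: (fin 1%N (ell.@[v] - 1) c 0) => //; first by rewrite subr_eq0.
  by rewrite -(mul0r (ell ^+ N * (('X_o0 - v o0 *: ell) * h))); apply: IM.
by rewrite scalerBl scale1r addrAC -lE expr1 subrr mul0r mulr0.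
Qed.

End Nullstellensatz.

(** * Products of linear forms in one variable and [ell] *)

Section RootProducts.
Variables (K : closedFieldType) (f ell : {mpoly K[3]}) (n0 : nat).
Local Notation S := {mpoly K[3]}.
Hypothesis ell_homog : ell \is 1.-homog.
Hypothesis top : forall n m (x : S), (n0 <= n)%N -> x \is (n + m).-homog ->
  exists2 x', x' \is n.-homog & jacobian_ideal f (x - ell ^+ m * x').

(** Modulo the ideal, the [N + 1] forms ['X_k ^+ i * ell ^+ (N - i)] are a fixed power of [ell]
    times forms of degree [n0], which span at most [#|T| <= N] dimensions. A linear relation gives a
    binary form in ['X_k] and [ell], and this splits into linear factors. *)
Lemma root_product k : exists m rs,
  jacobian_ideal f (ell ^+ m * \prod_(z <- rs) ('X_k - z *: ell)).
Proof.
pose T := 'X_{1..3 < n0.+1}; pose N := (n0 + #|{: T}|)%N.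
have hx (i : 'I_N.+1) : exists2 x', x' \is n0.-homog &
    jacobian_ideal f ('X_k ^+ i * ell ^+ (N - i) - ell ^+ #|{: T}| * x').
  apply: top => //; have := dhomogM (dhomogMn i (homogX K k)) (ell_homogX ell_homog (N - i)).
  by rewrite mul1n subnKC // -ltnS.
have /choice[y hy] : forall i : 'I_N.+1, exists x', x' \is n0.-homog /\
    jacobian_ideal f ('X_k ^+ i * ell ^+ (N - i) - ell ^+ #|{: T}| * x').
  by move=> i; case: (hx i) => x' h1 h2; exists x'.
have [w w0 hw] : exists2 w : 'I_N.+1 -> K, exists i, w i != 0 & \sum_i w i *: y i = 0.
  apply: contrapT => hno; suff : (N.+1 <= #|{: T}|)%N by rewrite /N; lia.
  apply: (@rank_leq_free K N.+1 #|{: T}| (fun i t => (y i)@_(enum_val t : T))) => w hw i.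
  apply: contrapT => wi; apply: hno; exists w; first by exists i; apply/eqP.
  under eq_bigr => j _ do rewrite (homog_monE (proj1 (hy j))) scaler_sumr.
  rewrite exchange_big big1 //= => t _.
  under eq_bigr do rewrite scalerA.
  by rewrite -scaler_suml -(enum_rankK t) hw scale0r.
pose W := \poly_(i < N.+1) w (inord i).
have WE (i : 'I_N.+1) : W`_i = w i by rewrite coef_poly ltn_ord inord_val.
have W0 : W != 0.
  case: w0 => i; apply: contraNneq => W0; by rewrite -WE W0 coef0.
have hW : jacobian_ideal f (bihom N W 'X_k ell).
  have -> : bihom N W 'X_k ell = \sum_(i < N.+1) w i *:
      ('X_k ^+ i * ell ^+ (N - i) - ell ^+ #|{: T}| * y i).
    under [in RHS]eq_bigr do rewrite scalerBr [_ *: (ell ^+ _ * y _)]scalerAr.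
    rewrite sumrB -mulr_sumr hw mulr0 subr0.
    by apply: eq_bigr => i _; rewrite WE.
  by apply: jacobian_ideal_sum => i _; apply: jacobian_idealZ; case: (hy i).
have [rs WrE] := closed_field_poly_normal W.
have srs : (size rs <= N)%N.
  have := size_poly N.+1 (fun i => w (inord i)); rewrite -/W WrE.
  by rewrite size_scale ?lead_coef_eq0 // size_prod_XsubC.
(* If [W] has degree below [N], the missing degree is a power of [ell]. *)
exists (N - size rs)%N, rs; rewrite -bihom_prod subnK //.
have -> : \prod_(z <- rs) ('X - z%:P) = (lead_coef W)^-1 *: W + 0.
  by rewrite addr0 {2}WrE scalerA mulVf ?lead_coef_eq0 // scale1r.
by rewrite bihomD bihom0 addr0; apply: jacobian_idealZ.
Qed.

End RootProducts.

(** * Ideals of the local ring *)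

Section LocalRing.
Variable K : fieldType.
Local Notation P := {mpoly K[2]}.
Local Notation F := (ratfun K).
Local Notation "p %:F" := (FracField.tofrac p : ratfun K).
Implicit Types (z y : F) (a b w : P).

Lemma tofracF_eq0 w : (w%:F == 0 :> F) = (w == 0).
Proof. exact: tofrac_eq0. Qed.

Lemma tofracFD a b : (a + b)%:F = a%:F + b%:F :> F.
Proof. exact: tofracD. Qed.

Lemma tofracFM a b : (a * b)%:F = a%:F * b%:F :> F.
Proof. exact: tofracM. Qed.

Lemma tofracFB a b : (a - b)%:F = a%:F - b%:F :> F.
Proof. exact: tofracB. Qed.

Lemma tofracF1 : (1 : P)%:F = 1 :> F.
Proof. exact: tofrac1. Qed.

Lemma tofracF0 : (0 : P)%:F = 0 :> F.
Proof. exact: tofrac0. Qed.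

Lemma tofracFX a n : (a ^+ n)%:F = a%:F ^+ n :> F.
Proof. exact: tofracXn. Qed.

Lemma tofracFZ c a : (c *: a)%:F = c *: (a%:F : F) :> F.
Proof. by rewrite -mul_mpolyC tofracFM. Qed.

Lemma tofracF_sum (I : Type) (r : seq I) (Q : pred I) (G : I -> P) :
  (\sum_(i <- r | Q i) G i)%:F = \sum_(i <- r | Q i) (G i)%:F :> F.
Proof. exact: (big_morph (fun p => p%:F : F) tofracFD tofracF0). Qed.

Lemma ratfun_scaleE c z : c *: z = (c%:MP : P)%:F * z.
Proof. by []. Qed.

Lemma ratfun_scaleAl c z y : c *: (z * y) = (c *: z) * y.
Proof. by rewrite !ratfun_scaleE mulrA. Qed.

Lemma denom_neq0 w : w.@[fun=> 0] != 0 -> w%:F != 0.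
Proof. by rewrite tofracF_eq0; apply: contraNneq => ->; rewrite meval0. Qed.

Lemma local_ring_poly w : local_ring (w%:F : F).
Proof. by exists w, 1; rewrite meval1 oner_eq0 tofracF1 divr1. Qed.

Lemma local_ringM z y : local_ring z -> local_ring y -> local_ring (z * y).
Proof.
move=> [a [b [b0 ->]]] [c [d [d0 ->]]]; exists (a * c), (b * d); split.
  by rewrite mevalM mulf_neq0.
by rewrite !tofracFM invfM mulrACA.
Qed.

Lemma local_ringD z y : local_ring z -> local_ring y -> local_ring (z + y).
Proof.
move=> [a [b [b0 ->]]] [c [d [d0 ->]]]; exists (a * d + c * b), (b * d); split.
  by rewrite mevalM mulf_neq0.
by rewrite tofracFD !tofracFM addf_div ?denom_neq0.
Qed.

Lemma local_ringV w : w.@[fun=> 0] != 0 -> local_ring (w%:F^-1 : F).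
Proof. by exists 1, w; rewrite tofracF1 div1r. Qed.

Lemma local_ring0 : local_ring (0 : F).
Proof. by rewrite -tofracF0; apply: local_ring_poly. Qed.

Lemma local_ring1 : local_ring (1 : F).
Proof. by rewrite -tofracF1; apply: local_ring_poly. Qed.

Lemma local_ringZ c z : local_ring z -> local_ring (c *: z).
Proof. by move=> hz; rewrite ratfun_scaleE; apply: local_ringM => //; apply: local_ring_poly. Qed.

Lemma local_ringX z n : local_ring z -> local_ring (z ^+ n).
Proof.
move=> hz; elim: n => [|n IH]; first by rewrite expr0; apply: local_ring1.
by rewrite exprS; apply: local_ringM.
Qed.

Lemma local_ring_subspace : subspace (@local_ring K).
Proof.
split=> [|c z y hz hy]; first exact: local_ring0.
by apply: local_ringD => //; apply: local_ringZ.
Qed.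

Definition local_ideal (T : set F) : Prop :=
  [/\ T 0, forall z y, T z -> T y -> T (z + y)
    & forall z y, local_ring z -> T y -> T (z * y)].

Section Ideal.
Variable T : set F.
Hypothesis T_ideal : local_ideal T.

Lemma local_idealD z y : T z -> T y -> T (z + y).
Proof. by case: T_ideal => _ + _; apply. Qed.

Lemma local_idealM z y : local_ring z -> T y -> T (z * y).
Proof. by case: T_ideal => _ _; apply. Qed.

Lemma local_idealMr z y : T y -> local_ring z -> T (y * z).
Proof. by move=> hy hz; rewrite mulrC; apply: local_idealM. Qed.

Lemma local_idealZ c z : T z -> T (c *: z).
Proof. by move=> hz; rewrite ratfun_scaleE; apply: local_idealM => //; apply: local_ring_poly. Qed.

Lemma local_ideal0 : T 0.
Proof. by case: T_ideal. Qed.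

Lemma local_ideal_subspace : subspace T.
Proof.
split=> [|c z y hz hy]; first exact: local_ideal0.
by apply: local_idealD => //; apply: local_idealZ.
Qed.

Lemma local_idealB z y : T z -> T y -> T (z - y).
Proof. exact: subspaceB local_ideal_subspace. Qed.

Lemma local_ideal_sum (I : Type) (r : seq I) (Q : pred I) (G : I -> F) :
  (forall i, Q i -> T (G i)) -> T (\sum_(i <- r | Q i) G i).
Proof. exact: subspace_sum local_ideal_subspace. Qed.

Lemma local_ideal_cancel w z : w.@[fun=> 0] != 0 -> T (w%:F * z) -> T z.
Proof.
move=> w0 /(local_idealM (local_ringV w0)).
by rewrite mulrA mulVf ?mul1r // denom_neq0.
Qed.

Definition nilpotent_mod z := local_ring z /\ exists n, T (z ^+ n).

Lemma local_idealX z m n : local_ring z -> T (z ^+ m) -> (m <= n)%N -> T (z ^+ n).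
Proof.
by move=> lz hz /subnK <-; rewrite exprD; apply: local_idealM => //; apply: local_ringX.
Qed.

Lemma nilpotent_modD z y : nilpotent_mod z -> nilpotent_mod y -> nilpotent_mod (z + y).
Proof.
move=> [lz [m hm]] [ly [n hn]]; split; first exact: local_ringD.
exists (m + n)%N; rewrite exprDn; apply: local_ideal_sum => i _.
rewrite -mulr_natl; apply: local_idealM.
  elim: ('C(_, _)) => [|k IH]; first exact: local_ring0.
  by rewrite mulrS; apply: local_ringD => //; apply: local_ring1.
have [hi|hi] := leqP i n.
  apply: local_idealMr; last exact: local_ringX.
  by apply: (local_idealX lz hm); rewrite -addnBA // leq_addr.
apply: local_idealM; first exact: local_ringX.
exact: (local_idealX ly hn (ltnW hi)).
Qed.

Lemma nilpotent_modM z y : local_ring z -> nilpotent_mod y -> nilpotent_mod (z * y).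
Proof.
move=> lz [ly [n hn]]; split; first exact: local_ringM.
by exists n; rewrite exprMn; apply: local_idealM => //; apply: local_ringX.
Qed.

(** A polynomial without constant term is a combination of the coordinates, and nilpotent elements
    are stable under combinations. *)
Lemma nilpotent_mod_origin : (forall l : 'I_2, nilpotent_mod ('X_l)%:F) ->
  forall w, w.@[fun=> 0] = 0 -> nilpotent_mod w%:F.
Proof.
move=> hX w w0; have [h wE] : exists h : 'I_2 -> P, w = (w.@[fun=> 0])%:MP + \sum_l 'X_l * h l.
  elim/mpoly_ind: w {w0} => [a g h [u gE] [v hE]| | |i g [u gE]].
  - exists (fun l => a *: u l + v l); rewrite mevalD mevalZ mpolyCD mpolyCM.
    rewrite {1}gE {1}hE scalerDr mul_mpolyC addrACA; congr (_ + _).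
    rewrite scaler_sumr -big_split; apply: eq_bigr => l _ /=.
    by rewrite mulrDr scalerAr.
  - by exists (fun=> 0); rewrite meval0 mpolyC0 big1 ?addr0 // => l _; rewrite mulr0.
  - by exists (fun=> 0); rewrite meval1 mpolyC1 big1 ?addr0 // => l _; rewrite mulr0.
  exists (fun l => if l == i then g else 0); rewrite mevalM mevalXU mul0r mpolyC0 add0r.
  by rewrite (bigD1 i) //= eqxx big1 ?addr0 // => l /negPf ->; rewrite mulr0.
rewrite wE w0 mpolyC0 add0r tofracF_sum.
elim/big_rec: _ => [|l z _ hz].
  by split; [exact: local_ring0|exists 1%N; rewrite expr1; apply: local_ideal0].
apply: nilpotent_modD => //; rewrite tofracFM mulrC; apply: nilpotent_modM => //.
exact: local_ring_poly.
Qed.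

(* Geometric series: a unit is a constant times [1 - n] with [n] nilpotent. *)
Lemma local_ring_mod_poly : (forall l : 'I_2, nilpotent_mod ('X_l)%:F) ->
  forall z, local_ring z -> exists w, T (z - w%:F).
Proof.
move=> hX z [a [b [b0 ->]]]; set be := b.@[_] in b0.
pose n := 1 - be^-1 *: b.
have [_ [m hm]] : nilpotent_mod n%:F.
  by apply: nilpotent_mod_origin; rewrite // mevalB meval1 mevalZ mulVf // subrr.
exists (be^-1 *: a * \sum_(i < m) n ^+ i); apply: (local_ideal_cancel b0).
have bE : b = be *: (1 - n) by rewrite /n subKr scalerA mulfV // scale1r.
have -> : b%:F * (a%:F / b%:F - (be^-1 *: a * \sum_(i < m) n ^+ i)%:F) = a%:F * n%:F ^+ m.
  rewrite mulrBr mulrC divfK ?denom_neq0 // -tofracFX -!tofracFM -tofracFB.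
  have -> : b * (be^-1 *: a * \sum_(i < m) n ^+ i) = a * (1 - n ^+ m).
    rewrite -[1 - n ^+ m]opprB subrX1 {1}bE -!scalerAl -!scalerAr scalerA mulfV // scale1r.
    ring.
  by rewrite -{1}[a]mulr1 -mulrBr subKr.
by apply: local_idealM => //; apply: local_ring_poly.
Qed.

End Ideal.
End LocalRing.

(** * The Tjurina ideal at a point *)

Section Chart.
Variables (K : numClosedFieldType) (p : proj_plane K).
Local Notation S := {mpoly K[3]}.
Local Notation P := {mpoly K[2]}.
Local Notation F := (ratfun K).
Local Notation "p %:F" := (FracField.tofrac p : ratfun K).
Local Notation q := (hcoord p 0).
Local Notation i0 := (chart p).
Implicit Types (f g : S) (w : P).

Lemma hcoord_neq0 : hcoord p != 0.
Proof.
rewrite /hcoord vpick0; apply/eqP => p0; have := valP p.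
by rewrite p0 dimv0.
Qed.

Lemma chart_neq0 : q i0 != 0.
Proof.
rewrite /chart; case: pickP => [//|h] /=; have := hcoord_neq0.
by case/eqP; apply/rowP => i; rewrite mxE; apply/eqP; have /negbFE := h i.
Qed.

Lemma local_equationD f g :
  local_equation (f + g) p = local_equation f p + local_equation g p.
Proof. exact: comp_mpolyD. Qed.

Lemma local_equationM f g :
  local_equation (f * g) p = local_equation f p * local_equation g p.
Proof. by rewrite /local_equation rmorphM. Qed.

Lemma local_equation0 : local_equation 0 p = 0.
Proof. exact: comp_mpoly0. Qed.

Lemma local_equation1 : local_equation 1 p = 1.
Proof. exact: comp_mpoly1. Qed.

Lemma local_equationB f g :
  local_equation (f - g) p = local_equation f p - local_equation g p.
Proof. exact: comp_mpolyB. Qed.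

Lemma local_equationZ a f : local_equation (a *: f) p = a *: local_equation f p.
Proof. exact: comp_mpolyZ. Qed.

Lemma local_equationXn f n : local_equation (f ^+ n) p = local_equation f p ^+ n.
Proof. exact: rmorphXn. Qed.

Lemma local_equation_sum (I : Type) (r : seq I) (Q : pred I) (G : I -> S) :
  local_equation (\sum_(i <- r | Q i) G i) p = \sum_(i <- r | Q i) local_equation (G i) p.
Proof.
exact: (big_morph (fun g => local_equation g p) local_equationD local_equation0).
Qed.

Lemma local_equationX k : local_equation 'X_k p =
  (q k)%:MP + (if unlift i0 k is Some l then 'X_l else 0).
Proof. by rewrite /local_equation /comp_mpoly mmapX mmap1U tnth_mktuple. Qed.

Lemma local_equationXc : local_equation 'X_i0 p = (q i0)%:MP.
Proof. by rewrite local_equationX unlift_none addr0. Qed.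

Lemma local_equationXl l : local_equation 'X_(lift i0 l) p = (q (lift i0 l))%:MP + 'X_l.
Proof. by rewrite local_equationX liftK. Qed.

Lemma local_equation_deriv g l :
  (local_equation g p)^`M(l) = local_equation g^`M(lift i0 l) p.
Proof.
elim/mpoly_ind: g => [a g h Pg Ph| | |i g Pg].
- by rewrite local_equationD local_equationZ !mderivD !mderivZ local_equationD local_equationZ Pg Ph.
- by rewrite mderiv0 local_equation0 mderiv0.
- by rewrite -mpolyC1 mderivC mpolyC1 local_equation1 local_equation0 -mpolyC1 mderivC.
rewrite local_equationM !mderivM Pg mderivXU.
rewrite local_equationD !local_equationM; congr (_ * _ + _).
rewrite local_equationX mderivD mderivC add0r; case: unliftP => [k ->|->].
  rewrite mderivXU (inj_eq (@lift_inj _ i0)).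
  by case: (k == l); rewrite ?local_equation1 ?local_equation0.
by rewrite mderiv0 (negPf (neq_lift _ _)) local_equation0.
Qed.

Lemma local_equation_origin g : (local_equation g p).@[fun=> 0] = g.@[q].
Proof.
elim/mpoly_ind: g => [a g h Pg Ph| | |i g Pg].
- by rewrite local_equationD local_equationZ !mevalD !mevalZ Pg Ph.
- by rewrite local_equation0 !meval0.
- by rewrite local_equation1 !meval1.
rewrite local_equationM !mevalM Pg mevalXU local_equationX mevalD mevalC.
by case: unliftP => [l _|_]; rewrite ?mevalXU ?meval0 addr0.
Qed.

Lemma local_equation_meval g (v : 'I_3 -> K) : v i0 = q i0 ->
  g.@[v] = (local_equation g p).@[fun l => v (lift i0 l) - q (lift i0 l)].
Proof.
move=> hv; elim/mpoly_ind: g => [a g h Pg Ph| | |i g Pg].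
- by rewrite local_equationD local_equationZ !mevalD !mevalZ Pg Ph.
- by rewrite local_equation0 !meval0.
- by rewrite local_equation1 !meval1.
rewrite local_equationM !mevalM -Pg mevalXU local_equationX mevalD mevalC.
congr (_ * _); case: unliftP => [l ->|->]; last by rewrite meval0 addr0.
by rewrite mevalXU addrC subrK.
Qed.

Lemma local_equation_eq0 n g : g \is n.-homog -> local_equation g p = 0 -> g = 0.
Proof.
move=> hg g0; apply: (homog_eq0 hg (homogX K i0) _ chart_neq0).
  by rewrite -msize_poly_eq0 msizeX mdeg1.
by move=> v; rewrite mevalXU => /(local_equation_meval g) ->; rewrite g0 meval0.
Qed.

Lemma local_equation_surj w : exists n0, forall n, (n0 <= n)%N ->
  exists2 g, g \is n.-homog & local_equation g p = w.
Proof.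
elim/mpoly_ind: w => [a w1 w2 [n1 h1] [n2 h2]| | |l w [n1 h1]].
- exists (maxn n1 n2) => n; rewrite geq_max => /andP[/h1[g1 hg1 <-] /h2[g2 hg2 <-]].
  by exists (a *: g1 + g2); rewrite ?local_equationD ?local_equationZ ?rpredD ?rpredZ.
- by exists 0%N => n _; exists 0; rewrite ?rpred0 ?local_equation0.
- exists 0%N => n _; exists ((q i0)^-1 ^+ n *: 'X_i0 ^+ n).
    by rewrite rpredZ //; have := dhomogMn n (homogX K i0); rewrite mul1n.
  have CX (c : K) : (c%:MP : P) ^+ n = (c ^+ n)%:MP by rewrite rmorphXn.
  rewrite local_equationZ local_equationXn local_equationXc CX -mul_mpolyC.
  by rewrite -mpolyCM -exprMn mulVf ?chart_neq0 // expr1n mpolyC1.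
exists n1.+1 => -[//|n] hn; have [g hg <-] := h1 n hn.
exists (('X_(lift i0 l) - (q (lift i0 l) / q i0) *: 'X_i0) * g).
  by apply: (homog_sub_homog (homog_subS hg)); rewrite rpredB ?rpredZ ?homogX.
rewrite local_equationM local_equationB local_equationZ local_equationXc local_equationXl.
by rewrite -mul_mpolyC -mpolyCM divfK ?chart_neq0 // addrAC subrr add0r.
Qed.

Section Tjurina.
Variables (d : nat) (f : S).
Hypotheses (d_gt0 : (0 < d)%N) (hf : f \is d.-homog).
Local Notation T := (tjurina_ideal (local_equation f p)).

Lemma tjurina_ideal_local : local_ideal T.
Proof.
split.
- exists 0, (fun=> 0); split=> [|_|]; rewrite ?mul0r ?add0r; try exact: local_ring0.
  by rewrite big1 // => l _; rewrite mul0r.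
- move=> z y [a [h [la lh ->]]] [b [k [lb lk ->]]].
  exists (a + b), (fun l => h l + k l); split; [exact: local_ringD| |].
    by move=> l; apply: local_ringD.
  rewrite mulrDl addrACA; congr (_ + _); rewrite -big_split.
  by apply: eq_bigr => l _; rewrite mulrDl.
move=> z y lz [a [h [la lh ->]]]; exists (z * a), (fun l => z * h l); split.
- exact: local_ringM.
- by move=> l; apply: local_ringM.
rewrite mulrDr mulrA mulr_sumr; congr (_ + _).
by apply: eq_bigr => l _; rewrite mulrA.
Qed.

Lemma tjurina_ideal_local_ring z : T z -> local_ring z.
Proof.
move=> [a [h [la lh ->]]]; apply: local_ringD.
  by apply: local_ringM => //; apply: local_ring_poly.
apply: subspace_sum => [|l _]; first exact: local_ring_subspace.
by apply: local_ringM => //; apply: local_ring_poly.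
Qed.

Let TI := tjurina_ideal_local.

(** Freezing the chart coordinate loses one partial derivative. Euler's relation recovers it from
    the local equation and the other two, the chart coordinate being a unit. *)
Lemma tjurina_ideal_partial k : T (local_equation f^`M(k) p)%:F.
Proof.
have Tf : T (local_equation f p)%:F.
  exists 1, (fun=> 0); split=> [|_|]; rewrite ?mul1r.
  - exact: local_ring1.
  - exact: local_ring0.
  by rewrite big1 ?addr0 // => l _; rewrite mul0r.
have Tl l : T (local_equation f^`M(lift i0 l) p)%:F.
  exists 0, (fun k => if k == l then 1 else 0); split=> [|j|].
  - exact: local_ring0.
  - by case: ifP => _; [exact: local_ring1|exact: local_ring0].
  rewrite mul0r add0r (bigD1 l) //= eqxx mul1r local_equation_deriv big1 ?addr0 //.
  by move=> j /negPf ->; rewrite mul0r.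
case: (unliftP i0 k) => [l -> //|->].
have E : local_equation 'X_i0 p * local_equation f^`M(i0) p =
    d%:R *: local_equation f p - \sum_(l < 2)
      local_equation 'X_(lift i0 l) p * local_equation f^`M(lift i0 l) p.
  have -> : d%:R *: local_equation f p =
      \sum_k local_equation 'X_k p * local_equation f^`M(k) p.
    rewrite -local_equationZ -(euler hf) local_equation_sum.
    by apply: eq_bigr => i _; rewrite local_equationM.
  by rewrite (bigD1_ord i0) //= addrK.
apply: (@local_ideal_cancel _ _ TI (local_equation 'X_i0 p)).
  by rewrite local_equationXc mevalC chart_neq0.
rewrite -tofracFM E tofracFB tofracFZ [(\sum_(_ < 2) _)%:F]tofracF_sum.
apply: (local_idealB TI); first exact: (local_idealZ TI).
apply: (local_ideal_sum TI) => // l _; rewrite tofracFM.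
by apply: (local_idealM TI) => //; apply: local_ring_poly.
Qed.

Lemma tjurina_ideal_jacobian g : jacobian_ideal f g -> T (local_equation g p)%:F.
Proof.
move=> [h ->]; rewrite local_equation_sum tofracF_sum; apply: (local_ideal_sum TI) => // i _.
rewrite local_equationM tofracFM; apply: (local_idealM TI) => //; first exact: local_ring_poly.
exact: tjurina_ideal_partial.
Qed.

(** Euler's relation divided by [d] eliminates the local equation, leaving the three partial
    derivatives as generators. *)
Lemma tjurina_idealP z : T z -> exists h : 'I_3 -> F,
  (forall k, local_ring (h k)) /\ z = \sum_k h k * (local_equation f^`M(k) p)%:F.
Proof.
move=> [a [h [la lh ->]]].
exists (fun k => a * (d%:R^-1 *: (local_equation 'X_k p)%:F) +
   (if unlift i0 k is Some l then h l else 0)); split=> [k|].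
  apply: local_ringD.
    by apply: local_ringM => //; apply: local_ringZ; apply: local_ring_poly.
  by case: unlift => [l|]; [exact: lh|exact: local_ring0].
under [RHS]eq_bigr do rewrite mulrDl.
rewrite big_split /=; congr (_ + _); last first.
  rewrite (bigD1_ord i0) //= unlift_none mul0r add0r; apply: eq_bigr => l _.
  by rewrite liftK local_equation_deriv.
have fE : f = d%:R^-1 *: \sum_i 'X_i * f^`M(i).
  by rewrite (euler hf) scalerA mulVf ?scale1r // pnatr_eq0 -lt0n.
rewrite {1}fE local_equationZ local_equation_sum tofracFZ tofracF_sum.
under [RHS]eq_bigr => k _ do rewrite -mulrA -ratfun_scaleAl -tofracFM -local_equationM.
by rewrite -mulr_sumr scaler_sumr.
Qed.

Lemma tjurina_ideal_poly w : T w%:F -> exists b : P, b.@[fun=> 0] != 0 /\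
  exists h : 'I_3 -> P, b * w = \sum_k h k * local_equation f^`M(k) p.
Proof.
move=> /tjurina_idealP[h [lh wE]].
have /choice[a /choice[b hab]] : forall k, exists a b : P,
    b.@[fun=> 0] != 0 /\ h k = a%:F / b%:F.
  by move=> k; have [a [b hab]] := lh k; exists a, b.
exists (\prod_k b k); split.
  rewrite (big_morph _ (mevalM _) (meval1 _)); apply/prodf_neq0 => k _.
  by case: (hab k).
exists (fun k => a k * \prod_(j | j != k) b j).
apply/eqP; rewrite -subr_eq0 -tofracF_eq0 tofracFB subr_eq0 tofracFM wE tofracF_sum.
rewrite mulr_sumr; apply/eqP/eq_bigr => k _.
have [bk ->] := hab k; rewrite (bigD1 k) //= !tofracFM.
rewrite mulrA; congr (_ * _); rewrite mulrC mulrA divfK ?denom_neq0 //.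
Qed.

(** Clear denominators, then homogenize in a degree large enough to lift all coefficients; the
    common denominator becomes [b]. *)
Lemma tjurina_ideal_conductor e n g : (forall k, f^`M(k) \is e.-homog) ->
    g \is n.-homog -> T (local_equation g p)%:F ->
  exists m b, [/\ b \is m.-homog, b.@[q] != 0 & jacobian_ideal f (b * g)].
Proof.
move=> hfi hg /tjurina_ideal_poly[b [b0 [h hE]]].
have [nb hb] := local_equation_surj b.
have /choice[nh hh] : forall k, exists n0, forall n, (n0 <= n)%N ->
  exists2 g, g \is n.-homog & local_equation g p = h k.
  by move=> k; apply: local_equation_surj.
pose N := (nb + e + \sum_k nh k)%N.
have [B hB BE] : exists2 B, B \is N.-homog & local_equation B p = b.
  by apply: hb; rewrite /N -addnA leq_addr.
have /choice[H hH] : forall k, exists H, H \is (N + n - e).-homog /\ local_equation H p = h k.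
  move=> k; have [|H h1 h2] := hh k (N + n - e)%N; last by exists H.
  have : (nh k <= \sum_k nh k)%N by rewrite (bigD1 k) //= leq_addr.
  rewrite /N; lia.
exists N, B; split=> //; first by rewrite -local_equation_origin BE.
exists H; apply/eqP; rewrite -subr_eq0; apply/eqP.
apply: (@local_equation_eq0 (N + n)).
  rewrite rpredB ?dhomogM // rpred_sum // => k _.
  have -> : (N + n = (N + n - e) + e)%N by rewrite /N; lia.
  by apply: dhomogM => //; case: (hH k).
rewrite local_equationB local_equationM BE hE local_equation_sum -sumrB big1 // => k _.
by rewrite local_equationM (proj2 (hH k)) subrr.
Qed.

Lemma tjurina_ideal_saturation g : saturation (jacobian_ideal f) g ->
  T (local_equation g p)%:F.
Proof.
move=> [k hk]; have := hk (U_(i0) *+ k)%MM; rewrite mdegMn mdeg1 mul1n => /(_ erefl).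
rewrite -mpolyXn => /tjurina_ideal_jacobian; rewrite local_equationM tofracFM.
apply: (local_ideal_cancel TI); rewrite local_equationXn local_equationXc.
by rewrite rmorphXn /= mevalC expf_neq0 // chart_neq0.
Qed.

Lemma tjurina_ideal_smooth k z : f^`M(k).@[q] != 0 -> local_ring z -> T z.
Proof.
move=> fk lz; apply: (@local_ideal_cancel _ _ TI (local_equation f^`M(k) p)).
  by rewrite local_equation_origin.
by rewrite mulrC; apply: (local_idealM TI) => //; apply: tjurina_ideal_partial.
Qed.

End Tjurina.
End Chart.

(** * Singular points and saturation *)

Section SingularPoints.
Variables (K : numClosedFieldType) (e n0 : nat) (f ell : {mpoly K[3]}).
Local Notation S := {mpoly K[3]}.
Local Notation P := {mpoly K[2]}.
Local Notation F := (ratfun K).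
Local Notation "p %:F" := (FracField.tofrac p : ratfun K).
Local Notation J := (jacobian_ideal f).
Hypotheses (hf : f \is e.+1.-homog) (ell_homog : ell \is 1.-homog).
Hypothesis top : forall n m (x : S), (n0 <= n)%N -> x \is (n + m).-homog ->
  exists2 x', x' \is n.-homog & J (x - ell ^+ m * x').
Implicit Types (p : proj_plane K) (g : S).

Local Notation T p := (tjurina_ideal (local_equation f p)).

Lemma partial_homog i : f^`M(i) \is e.-homog.
Proof. by case: (homog_deriv i hf) => + _; rewrite subn1. Qed.

Definition singular p : bool := [forall k, f^`M(k).@[hcoord p 0] == 0].

Lemma jacobian_ideal_singular p g : singular p -> J g -> g.@[hcoord p 0] = 0.
Proof.
move=> /forallP sp [h ->]; rewrite raddf_sum big1 //= => i _.
by rewrite mevalM (eqP (sp i)) mulr0.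
Qed.

(** High powers of the coordinates are multiples of [ell] modulo the ideal, so if [ell] vanished at
    [p], all coordinates of [p] would be 0. *)
Lemma singular_ell p : singular p -> ell.@[hcoord p 0] != 0.
Proof.
move=> sp; apply/eqP => l0; have := hcoord_neq0 p; case/eqP; apply/rowP => k.
rewrite mxE; apply/eqP.
have hX : ('X_k : S) ^+ (n0 + 1) \is (n0 + 1).-homog.
  by have := dhomogMn (n0 + 1) (homogX K k); rewrite mul1n.
have [x' _ /(jacobian_ideal_singular sp)] := top (leqnn _) hX.
rewrite mevalB mevalM expr1 l0 mul0r subr0 rmorphXn /= mevalXU => /eqP.
by rewrite expf_eq0 => /andP[].
Qed.

Lemma proj_plane_line p (v : 'rV[K]_3) : v \in val p -> v != 0 -> <[v]>%VS = val p.
Proof.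
move=> vp v0; apply/eqP; rewrite eqEdim dim_vline v0 (eqP (valP p)) andbT.
by rewrite -memvE.
Qed.

Lemma hcoord_mem p : hcoord p \in val p.
Proof. exact: memv_pick. Qed.

Variables (m : 'I_3 -> nat) (L : 'I_3 -> seq K).
Hypothesis root_products : forall k,
  J (ell ^+ (m k) * \prod_(z <- L k) ('X_k - z *: ell)).

Lemma singular_root p k : singular p -> hcoord p 0 k / ell.@[hcoord p 0] \in L k.
Proof.
move=> sp; have l0 := singular_ell sp.
have := jacobian_ideal_singular sp (root_products k).
rewrite mevalM rmorphXn /= => /eqP; rewrite mulf_eq0 expf_eq0 (negPf l0) andbF /=.
rewrite rmorph_prod /= prodf_seq_eq0 => /hasP[z zL /=].
rewrite mevalB mevalZ mevalXU subr_eq0 => /eqP ->.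
by rewrite mulfK.
Qed.

Definition grid_vector (t : K * K * K) : 'rV[K]_3 :=
  \row_k (if k == o0 then t.1.1 else if k == o1 then t.1.2 else t.2).

(** Normalized by [ell = 1], a singular point has its coordinates in the lists [L k], so a finite
    grid is searched; [insub] discards the zero vector. *)
Definition singular_points : seq (proj_plane K) :=
  [seq p <- undup (pmap insub [seq <[grid_vector t]>%VS
      | t <- [seq (xy, z) | xy <- [seq (x, y) | x <- L o0, y <- L o1], z <- L o2]])
   | singular p].

Lemma singular_pointsP p : p \in singular_points = singular p.
Proof.
rewrite mem_filter mem_undup; case sp: (singular p) => //=.
rewrite mem_pmap_sub; have l0 := singular_ell sp.
pose c k := hcoord p 0 k / ell.@[hcoord p 0].
apply/mapP; exists (c o0, c o1, c o2).
  by apply: allpairs_f; [apply: allpairs_f|]; apply: singular_root.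
have gE : grid_vector (c o0, c o1, c o2) = (ell.@[hcoord p 0])^-1 *: hcoord p.
  by apply/rowP; elim/ord3P; rewrite !mxE /= /c mulrC.
rewrite gE; apply/esym/proj_plane_line; first by rewrite memvZ // hcoord_mem.
by rewrite scaler_eq0 invr_eq0 (negPf l0) /= hcoord_neq0.
Qed.

Lemma uniq_singular_points : uniq singular_points.
Proof. by rewrite filter_uniq // undup_uniq. Qed.

(** The grid Nullstellensatz is applied to the conductor [I] of [g] and to the form 1. The local
    hypothesis provides an element of [I] that is nonzero at a given singular point; at other points
    a partial derivative does. *)
Lemma local_jacobian n g : g \is n.-homog ->
    (forall p, singular p -> T p (local_equation g p)%:F) ->
  exists M, J (ell ^+ M * g).
Proof.
move=> hg hT; pose I x := J (x * g).
have [||k|v vL lv1|M] := @grid_nullstellensatz K ell ell_homog I _ _ L (\sum_k m k)%N 1.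
- by move=> x y hx hy; rewrite /I mulrDl; apply: jacobian_idealD.
- by move=> x y hy; rewrite /I -mulrA; apply: jacobian_idealM.
- rewrite mulr1 /I mulrC; apply: jacobian_idealM; rewrite (bigD1 k) //= addnC exprD -mulrA.
  by apply: jacobian_idealM.
- pose w : 'rV[K]_3 := \row_k v k.
  have wv k : w 0 k = v k by rewrite mxE.
  have w0 : w != 0.
    apply/eqP => w0; have := mevalZ_homog 0 v ell_homog; rewrite expr1 mul0r.
    rewrite (_ : _.@[_] = 1) => [/eqP|]; first by rewrite oner_eq0.
    by rewrite -lv1; apply: meval_eq => k; rewrite -wv w0 mxE mulr0.
  have dw : \dim <[w]>%VS == 1%N by rewrite dim_vline w0.
  pose p : proj_plane K := Sub <[w]>%VS dw.
  have : hcoord p \in <[w]>%VS by have := hcoord_mem p.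
  case/vlineP => la hE.
  have ev k (b : S) : b \is k.-homog -> b.@[hcoord p 0] = la ^+ k * b.@[v].
    move=> hb; rewrite -(mevalZ_homog _ _ hb); apply: meval_eq => i.
    by rewrite hE mxE wv.
  have [sp|/forallPn[k fk]] := boolP (singular p).
    have [|k [b [hb b0 Jb]]] := tjurina_ideal_conductor _ hf partial_homog hg (hT p sp).
      by [].
    exists k, b; split=> //; move: b0; rewrite (ev _ _ hb) mulf_eq0 negb_or.
    by case/andP.
  exists e, f^`M(k); split; first exact: partial_homog.
    by move: fk; rewrite (ev _ _ (partial_homog k)) mulf_eq0 negb_or => /andP[].
  by rewrite /I mulrC; apply: jacobian_idealM; apply: jacobian_ideal_deriv.
by rewrite /I mulr1 => h; exists M.
Qed.

(** Every monomial of degree [n0 + M] is a multiple of [ell ^+ M] modulo the ideal. *)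
Lemma saturation_of_ell M g : J (ell ^+ M * g) -> saturation J g.
Proof.
move=> hJ; exists (n0 + M)%N => x hx.
have [|x' _ hx'] := @top n0 M 'X_[x] (leqnn _); first by rewrite dhomogX; apply/eqP.
have -> : 'X_[x] * g = g * ('X_[x] - ell ^+ M * x') + x' * (ell ^+ M * g) by ring.
by apply: jacobian_idealD; apply: jacobian_idealM.
Qed.

Lemma saturation_local n g : g \is n.-homog -> saturation J g <->
  forall p, singular p -> T p (local_equation g p)%:F.
Proof.
move=> hg; split=> [hs p _|/(local_jacobian hg)[M]]; last exact: saturation_of_ell.
exact: (tjurina_ideal_saturation p hf hs).
Qed.

End SingularPoints.

(** * The quotient by the saturation *)

Section QuotientBySaturation.
Variables (K : numClosedFieldType) (e n0 : nat) (f ell : {mpoly K[3]}).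
Local Notation S := {mpoly K[3]}.
Local Notation P := {mpoly K[2]}.
Local Notation F := (ratfun K).
Local Notation "p %:F" := (FracField.tofrac p : ratfun K).
Local Notation J := (jacobian_ideal f).
Hypotheses (hf : f \is e.+1.-homog) (ell_homog : ell \is 1.-homog).
Hypothesis top : forall n m (x : S), (n0 <= n)%N -> x \is (n + m).-homog ->
  exists2 x', x' \is n.-homog & J (x - ell ^+ m * x').
Variables (m : 'I_3 -> nat) (L : 'I_3 -> seq K).
Hypothesis root_products : forall k,
  J (ell ^+ (m k) * \prod_(z <- L k) ('X_k - z *: ell)).
Implicit Types (p : proj_plane K) (g : S).
Local Open Scope classical_set_scope.

Local Notation T p := (tjurina_ideal (local_equation f p)).
Local Notation sing := (singular f).

Let TI p : local_ideal (T p). Proof. exact: tjurina_ideal_local. Qed.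

(* Up to a constant this is [X_k - v_k ell], where [v] is the multiple of
   [hcoord p] with [ell v = 1]. *)
Definition vanishing_form p k : S := ell.@[hcoord p 0] *: 'X_k - hcoord p 0 k *: ell.

Lemma vanishing_form_homog p k : vanishing_form p k \is 1.-homog.
Proof. by rewrite rpredB ?rpredZ ?homogX. Qed.

(** In the root product, factors nonzero at [p] are units of the local ring, and the others are
    proportional to the vanishing form. *)
Lemma vanishing_form_nilpotent p k : sing p ->
  nilpotent_mod (T p) (local_equation (vanishing_form p k) p)%:F.
Proof.
move=> sp; split; first exact: local_ring_poly.
have l0 := singular_ell top sp.
have key (s : seq K) (z : F) : T p (z * (local_equation (\prod_(x <- s) ('X_k - x *: ell)) p)%:F) ->
    T p (z * (local_equation (vanishing_form p k) p)%:F ^+ size s).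
  elim: s z => [|x s IH] z; first by rewrite big_nil local_equation1 tofracF1 expr0.
  rewrite big_cons local_equationM tofracFM => hT.
  have [hx|hx] := eqVneq (hcoord p 0 k) (x * ell.@[hcoord p 0]).
    rewrite /= exprS mulrA; apply: IH.
    have -> : vanishing_form p k = ell.@[hcoord p 0] *: ('X_k - x *: ell).
      by rewrite /vanishing_form scalerBr scalerA mulrC hx.
    rewrite local_equationZ tofracFZ ratfun_scaleE -!mulrA mulrCA.
    by apply: (local_idealM (TI p)) => //; apply: local_ring_poly.
  rewrite /= exprSr mulrA; apply: (local_idealMr (TI p)); last exact: local_ring_poly.
  apply: IH; apply: (local_ideal_cancel (TI p) (w := local_equation ('X_k - x *: ell) p)).
    by rewrite local_equation_origin mevalB mevalZ mevalXU subr_eq0.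
  by rewrite mulrCA.
exists (size (L k)); rewrite -[_ ^+ _]mul1r.
apply: key; rewrite mul1r.
have := tjurina_ideal_jacobian p hf (root_products k).
rewrite local_equationM tofracFM; apply: (local_ideal_cancel (TI p)).
by rewrite local_equation_origin rmorphXn expf_neq0.
Qed.

Lemma local_coord_nilpotent p (l : 'I_2) : sing p -> nilpotent_mod (T p) ('X_l)%:F.
Proof.
move=> sp; have l0 := singular_ell top sp; have c0 := chart_neq0 p.
set i := chart p in c0; set k := lift i l.
(* The combination is chosen so that the contributions of [ell] cancel. *)
have -> : ('X_l : P) = (ell.@[hcoord p 0] * hcoord p 0 i)^-1%:MP *
    ((hcoord p 0 i)%:MP * local_equation (vanishing_form p k) p +
     (- hcoord p 0 k)%:MP * local_equation (vanishing_form p i) p).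
  rewrite /vanishing_form !local_equationB !local_equationZ local_equationXl local_equationXc.
  rewrite -!mul_mpolyC -/i -/k; set E := local_equation ell p.
  set lq := ell.@[_] in l0 *; set qi := hcoord p 0 i in c0 *; set qk := hcoord p 0 k.
  transitivity ((lq * qi)^-1%:MP * ((lq * qi)%:MP * ('X_l : P))).
    by rewrite mulrA -mpolyCM mulVf ?mpolyC1 ?mul1r // mulf_neq0.
  congr (_ * _); rewrite mpolyCM mpolyCN; ring.
rewrite tofracFM tofracFD !tofracFM.
apply: (nilpotent_modM (TI p)); first exact: local_ring_poly.
by apply: (nilpotent_modD (TI p)); apply: (nilpotent_modM (TI p));
  rewrite ?local_ring_poly //; [exact: local_ring_poly|exact: vanishing_form_nilpotent
                               |exact: local_ring_poly|exact: vanishing_form_nilpotent].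
Qed.

(* The bound [n1] must not depend on [z], which will be multiplied by a power of
   [ell] whose exponent depends on [n]. *)
Lemma local_ring_mod_form p : sing p -> exists n1, forall n, (n1 <= n)%N ->
  forall z, local_ring z ->
    exists2 g, g \is n.-homog & T p (z - (local_equation g p)%:F).
Proof.
move=> sp; have nil l := local_coord_nilpotent l sp.
have [M hM] : exists M, forall l : 'I_2, T p (('X_l)%:F ^+ M).
  have /choice[M hM] : forall l : 'I_2, exists M, T p (('X_l)%:F ^+ M).
    by move=> l; case: (nil l).
  exists (\sum_l M l)%N => l; apply: (local_idealX (TI p) _ (hM l)).
    exact: local_ring_poly.
  by rewrite (bigD1 l) //= leq_addr.
(* One of the two exponents is at least [M]. Only the finitely many monomials of degree below
   [2 * M] then need to be lifted. *)
have TX (x : 'X_{1..2}) : (2 * M <= mdeg x)%N -> T p ('X_[x])%:F.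
  move=> hx; have [l hl] : exists l, (M <= x l)%N.
    apply: contrapT => hno; have hlt l : (x l < M)%N.
      by rewrite ltnNge; apply/negP => h; apply: hno; exists l.
    move: hx; rewrite mdegE !big_ord_recl big_ord0 leqNgt => /negP; apply.
    by have := hlt ord0; have := hlt (lift ord0 ord0); lia.
  rewrite mpolyXE_id (bigD1 l) //= tofracFM tofracFX.
  apply: (local_idealMr (TI p)); last exact: local_ring_poly.
  by apply: (local_idealX (TI p) _ (hM l)); [exact: local_ring_poly|].
have /choice[nx hnx] : forall x : 'X_{1..2 < (2 * M)}, exists n1, forall n, (n1 <= n)%N ->
    exists2 g, g \is n.-homog & local_equation g p = 'X_[x].
  by move=> x; apply: local_equation_surj.
exists (\sum_x nx x)%N => n hn z hz.
have /choice[g hg] : forall x : 'X_{1..2}, exists g, g \is n.-homog /\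
    T p (('X_[x])%:F - (local_equation g p)%:F).
  move=> x; have [hx|hx] := leqP (2 * M) (mdeg x).
    exists 0; rewrite rpred0 local_equation0 tofracF0 subr0; split=> //; exact: TX.
  have [|g hg gE] := hnx (BMultinom hx) n.
    by apply: leq_trans hn; rewrite (bigD1 (BMultinom hx)) //= leq_addr.
  by exists g; rewrite gE subrr; split=> //; apply: (local_ideal0 (TI p)).
have [w hw] := local_ring_mod_poly (TI p) nil hz.
exists (\sum_(x <- msupp w) w@_x *: g x).
  by rewrite rpred_sum // => x _; rewrite rpredZ //; case: (hg x).
rewrite -[z](subrK w%:F) -addrA; apply: (local_idealD (TI p)) => //.
rewrite {1}[w]mpolyE local_equation_sum !tofracF_sum -sumrB.
apply: (local_ideal_sum (TI p)) => x _; rewrite local_equationZ !tofracFZ -scalerBr.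
by apply: (local_idealZ (TI p)); case: (hg x).
Qed.

(** A product of powers of vanishing forms of the other points. Some vanishing form of [q] is
    nonzero at [p], since otherwise the two coordinate vectors would be proportional. *)
Lemma separating_form p (s : seq (proj_plane K)) : sing p -> all sing s ->
  exists n E, [/\ E \is n.-homog, E.@[hcoord p 0] != 0 &
    forall p', p' \in s -> p' != p -> T p' (local_equation E p')%:F].
Proof.
move=> sp; elim: s => [|q s IH] /=.
  by exists 0%N, 1; split; rewrite ?dhomog1 // meval1 oner_neq0.
move=> /andP[sq /IH[n [E [hE E0 hT]]]].
have [qp|qp] := eqVneq q p.
  exists n, E; split=> // p'; rewrite in_cons => /orP[/eqP ->|/hT //].
  by rewrite qp eqxx.
have lq := singular_ell top sq; have lp := singular_ell top sp.
have [k hk] : exists k, (vanishing_form q k).@[hcoord p 0] != 0.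
  apply: contrapT => hno; move/eqP: qp; apply; apply/val_inj/esym.
  rewrite -(proj_plane_line (hcoord_mem p) (hcoord_neq0 p)).
  apply: proj_plane_line; last exact: hcoord_neq0.
  have -> : hcoord p = (ell.@[hcoord p 0] / ell.@[hcoord q 0]) *: hcoord q.
    apply/rowP => k; rewrite mxE; apply: (mulfI lq).
    rewrite mulrCA mulrA divfK //; apply/eqP; rewrite -subr_eq0.
    apply: contraT => h; case: hno; exists k.
    by rewrite /vanishing_form mevalB !mevalZ mevalXU [hcoord q 0 k * _]mulrC.
  by rewrite memvZ // hcoord_mem.
have [_ [M hM]] := vanishing_form_nilpotent k sq.
exists (M + n)%N, (vanishing_form q k ^+ M * E); split.
- apply: dhomogM => //; have := dhomogMn M (vanishing_form_homog q k).
  by rewrite mul1n.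
- by rewrite mevalM rmorphXn mulf_neq0 // expf_neq0.
move=> p'; rewrite in_cons => /orP[/eqP -> _|hp' hne]; rewrite local_equationM tofracFM.
  rewrite local_equationXn tofracFX; apply: (local_idealMr (TI q)) => //.
  exact: local_ring_poly.
by apply: (local_idealM (TI p')); [exact: local_ring_poly|apply: hT].
Qed.

(** A Chinese remainder theorem for the Tjurina algebras, solved by forms of any large degree. *)
Lemma local_rings_mod_form (s : seq (proj_plane K)) : uniq s -> all sing s ->
  exists n1, forall n, (n1 <= n)%N -> forall z : proj_plane K -> F,
    (forall p, p \in s -> local_ring (z p)) ->
    exists2 g, g \is n.-homog & forall p, p \in s -> T p (z p - (local_equation g p)%:F).
Proof.
move=> us ss.
(* Strengthened for the induction: [z] is prescribed on [t] and 0 on the rest of [s], so a new point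
   starts from the value 0. *)
suff h t : uniq t -> {subset t <= s} -> exists n1, forall n, (n1 <= n)%N ->
    forall z : proj_plane K -> F, (forall p, p \in s -> local_ring (z p)) ->
    exists2 g, g \is n.-homog &
      forall p, p \in s -> T p ((if p \in t then z p else 0) - (local_equation g p)%:F).
  have [|n1 h1] := h s us; first by [].
  exists n1 => n /h1 {}h1 z /h1[g hg hT].
  by exists g => // p ps; have := hT p ps; rewrite ps.
elim: t => [_ _|q t IH /= /andP[qt ut] ts].
  exists 0%N => n _ z _; exists 0; first exact: rpred0.
  by move=> p _; rewrite local_equation0 tofracF0 subr0; apply: (local_ideal0 (TI p)).
have [|n1 h1] := IH ut; first by move=> p pt; apply: ts; rewrite in_cons pt orbT.
have qs : q \in s by apply: ts; rewrite in_cons eqxx.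
have sq := allP ss q qs.
have [n2 [E [hE E0 hT]]] := separating_form sq ss.
have E0' : (local_equation E q).@[fun=> 0] != 0 by rewrite local_equation_origin.
have [n3 h3] := local_ring_mod_form sq.
exists (n1 + (n2 + n3))%N => n hn z lz.
have [hn1 hn3 hnE] : [/\ (n1 <= n)%N, (n3 <= n - n2)%N & (n = n2 + (n - n2))%N].
  by move: hn; clear; split; lia.
have [g hg gT] := h1 n hn1 z lz.
(* Dividing by [E], a unit at [q], makes [E * h] take the value [z q] there, while [E] lies in the
   Tjurina ideals of the other points. *)
have [|h hh hq] := h3 _ hn3 (z q * (local_equation E q)%:F^-1).
  by apply: local_ringM; [apply: lz|apply: local_ringV].
exists (g + E * h).
  by rewrite rpredD // hnE dhomogM.
move=> p ps; rewrite local_equationD local_equationM tofracFD tofracFM in_cons.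
have [->|pq] /= := eqVneq p q.
  have := gT q qs; rewrite (negPf qt) sub0r => gq.
  have -> : z q - ((local_equation g q)%:F + (local_equation E q)%:F * (local_equation h q)%:F) =
     - (local_equation g q)%:F + (local_equation E q)%:F *
       (z q * (local_equation E q)%:F^-1 - (local_equation h q)%:F).
    by rewrite mulrBr mulrCA mulfV ?mulr1 ?denom_neq0 // opprD [LHS]addrCA.
  apply: (local_idealD (TI q)) => //; apply: (local_idealM (TI q)) => //.
  exact: local_ring_poly.
rewrite opprD addrA; apply: (local_idealB (TI p)); first exact: gT.
by apply: (local_idealMr (TI p)); [apply: hT|exact: local_ring_poly].
Qed.

Lemma homog_subspace n : subspace [set g : S | g \is n.-homog].
Proof.
by split=> [|a u v hu hv]; rewrite /= ?rpred0 // rpredD ?rpredZ.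
Qed.

Lemma jacobian_ideal_subspace n : subspace (homog_part J n).
Proof.
split=> [|a u v [Ju hu] [Jv hv]]; split; rewrite ?rpred0 ?rpredD ?rpredZ //.
  exact: jacobian_ideal0.
by apply: jacobian_idealD => //; apply: jacobian_idealZ.
Qed.

Lemma saturation_subspace n : subspace (homog_part (saturation J) n).
Proof.
have sat := saturation_local hf ell_homog top root_products.
split=> [|a u v [Ju hu] [Jv hv]]; split; rewrite ?rpred0 ?rpredD ?rpredZ //.
  by exists 0%N => x _; rewrite mulr0; apply: jacobian_ideal0.
apply/(sat n); first by rewrite rpredD ?rpredZ.
move=> p sp; rewrite local_equationD local_equationZ tofracFD tofracFZ.
apply: (local_idealD (TI p)); first apply: (local_idealZ (TI p)).
  by move/(sat n _ hu): Ju; apply.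
by move/(sat n _ hv): Jv; apply.
Qed.

Lemma jacobian_sub_saturation g : J g -> saturation J g.
Proof. by move=> Jg; exists 0%N => x _; apply: jacobian_idealM. Qed.

Lemma tjurina_smooth p : ~~ sing p -> tjurina f p = 0%N.
Proof.
move=> /forallPn[k fk]; have hT z : local_ring z -> T p z.
  exact: (tjurina_ideal_smooth hf fk).
apply: quot_dimE; first exact: (local_ideal_subspace (TI p)).
  by move=> z; apply: tjurina_ideal_local_ring.
apply/has_quot_dimP; first exact: (local_ideal_subspace (TI p)).
  by move=> z; apply: tjurina_ideal_local_ring.
exists (fun=> 0); split=> [i|z hz|c _ []//]; first exact: local_ring0.
by exists (fun=> 0); rewrite big_ord0 subr0; apply: hT.
Qed.

Local Notation pts := (singular_points f L).

Lemma global_tjurinaE : global_tjurina f = (\sum_(p <- pts) tjurina f p)%N.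
Proof.
rewrite /global_tjurina -(fsbig_widen [set` pts] (curve f)).
- by rewrite -fsbig_seq // uniq_singular_points.
- move=> p /=; rewrite (singular_pointsP top root_products) => sp; rewrite /curve /=.
  have := congr1 (meval (hcoord p 0)) (euler hf).
  rewrite mevalZ (jacobian_ideal_singular sp); last by exists (fun i => 'X_i).
  by move/esym/eqP; rewrite mulf_eq0 pnatr_eq0 => /eqP.
move=> p [_] /=; rewrite (singular_pointsP top root_products) => /negP.
exact: tjurina_smooth.
Qed.

(** * Dimension of the quotient in a stable degree *)

Section StableDegree.
Variables (j N0 : nat).
Hypothesis stable : forall N h, (j <= N)%N -> (N0 <= N)%N -> h \is N.-homog ->
  exists2 h', h' \is j.-homog & J (h - ell ^+ (N - j) * h').

(** Solve for [ell ^+ (N - j) * z] in a large degree [N], descend to degree [j] by stability, and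
    cancel the power of [ell], a unit at singular points. *)
Lemma local_rings_stable (z : proj_plane K -> F) :
    (forall p, p \in pts -> local_ring (z p)) ->
  exists2 g, g \is j.-homog & forall p, p \in pts -> T p (z p - (local_equation g p)%:F).
Proof.
move=> lz; have [|n1 h1] := local_rings_mod_form (uniq_singular_points f L).
  by apply/allP => p; rewrite (singular_pointsP top root_products).
pose N := (n1 + j + N0)%N.
have [|p ps|G hG GT] := h1 N _ (fun p => (local_equation ell p)%:F ^+ (N - j) * z p).
- by rewrite /N -addnA leq_addr.
- by apply: local_ringM (lz p ps); apply: local_ringX; apply: local_ring_poly.
have [hjN hN0] : (j <= N)%N /\ (N0 <= N)%N by rewrite /N; clear; lia.
have [g hg Jg] := stable hjN hN0 hG.
exists g => // p ps; have sp : sing p by rewrite -(singular_pointsP top root_products).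
apply: (local_ideal_cancel (TI p) (w := local_equation (ell ^+ (N - j)) p)).
  by rewrite local_equation_origin rmorphXn expf_neq0 // (singular_ell top).
have := local_idealD (TI p) (GT p ps) (tjurina_ideal_jacobian p hf Jg).
rewrite local_equationB local_equationM tofracFB tofracFM addrA subrK.
by rewrite mulrBr local_equationXn tofracFX.
Qed.

(** [quot_dim] is 0 by convention on infinite-dimensional quotients, so finiteness has to be shown:
    forms of degree [j] span the Tjurina algebra. *)
Lemma tjurina_has_quot_dim p : sing p -> has_quot_dim (@local_ring K) (T p) (tjurina f p).
Proof.
move=> sp; have ps : p \in pts by rewrite (singular_pointsP top root_products).
have sT := local_ideal_subspace (TI p).
have TO z : T p z -> local_ring z by apply: tjurina_ideal_local_ring.
have [||n hn] := @has_quot_dim_ex _ _ (@local_ring K) (T p) _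
    (fun x : 'X_{1..3 < j.+1} => (local_equation (homog_mon K x) p)%:F) sT TO.
- by move=> x; apply: local_ring_poly.
- move=> z hz; have [|g hg gT] := @local_rings_stable (fun q => if q == p then z else 0).
    by move=> q _; case: eqP => _ //; apply: local_ring0.
  exists (fun x : 'X_{1..3 < j.+1} => g@_x); have := gT p ps; rewrite eqxx {1}(homog_monE hg).
  rewrite local_equation_sum tofracF_sum.
  by under eq_bigr do rewrite local_equationZ tofracFZ.
by rewrite /tjurina /tjurina_at_origin (quot_dimE sT TO hn).
Qed.

Lemma has_quot_dim_saturation :
  has_quot_dim [set g : S | g \is j.-homog] (homog_part (saturation J) j) (global_tjurina f).
Proof.
have spt p : p \in pts -> sing p by rewrite (singular_pointsP top root_products).
(* Imposing the conditions at the singular points one by one filters the forms of degree [j] down to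
   the saturation; each step has a local Tjurina algebra as quotient. *)
pose Z (s : seq (proj_plane K)) := [set g : S | g \is j.-homog /\
  forall p, p \in s -> T p (local_equation g p)%:F].
have sZ s : subspace (Z s).
  split=> [|a u v [hu Tu] [hv Tv]]; split; rewrite ?rpred0 ?rpredD ?rpredZ // => p ps.
    by rewrite local_equation0 tofracF0; apply: (local_ideal0 (TI p)).
  rewrite local_equationD local_equationZ tofracFD tofracFZ.
  by apply: (local_idealD (TI p)); [apply: (local_idealZ (TI p)); apply: Tu|apply: Tv].
have -> : homog_part (saturation J) j = Z pts.
  apply/seteqP; split=> g [h1 h2].
    split=> // p /spt sp.
    by move/(saturation_local hf ell_homog top root_products h2): h1; apply.
  split=> //; apply/(saturation_local hf ell_homog top root_products h1) => p sp.
  by apply: h2; rewrite (singular_pointsP top root_products).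
have -> : [set g : S | g \is j.-homog] = Z [::].
  by apply/seteqP; split=> g; [split|case].
rewrite global_tjurinaE.
have : {subset pts <= pts} by [].
elim: {1 2 4 5}pts (uniq_singular_points f L) => [_ _|p s IH /= /andP[ps us] sub].
  rewrite big_nil; apply/has_quot_dimP => //; exists (fun=> 0).
  split=> [i|v hv|c _ []//]; first by case: (sZ [::]).
  by exists (fun=> 0); rewrite big_ord0 subr0.
have sub' : {subset s <= pts} by move=> q qs; apply: sub; rewrite in_cons qs orbT.
have pp : p \in pts by apply: sub; rewrite in_cons eqxx.
have ZZ s1 : Z s1 `<=` Z [::] by move=> g [hg _].
have Zps : Z (p :: s) `<=` Z s.
  by move=> g [hg hT]; split=> // q qs; apply: hT; rewrite in_cons qs orbT.
rewrite big_cons addnC; apply: (has_quot_dim_trans (sZ s) (sZ _) Zps (ZZ s)).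
  exact: IH.
apply: (@has_quot_dim_map K _ _ (fun g => (local_equation g p)%:F : F) _ _
  (@local_ring K) (T p) _ _ (sZ s) (sZ _) (local_ideal_subspace (TI p)) Zps).
- by move=> a u v; rewrite local_equationD local_equationZ tofracFD tofracFZ.
- by move=> z; apply: tjurina_ideal_local_ring.
- move=> g [hg hT]; split=> [[_ h]|hp]; first exact: (h p (mem_head p s)).
  split; [exact: hg|move=> q; rewrite in_cons => /orP[/eqP ->|qs]]; first exact: hp.
  exact: hT.
- move=> g _; exact: local_ring_poly.
- move=> z hz; have [|g hg gT] := @local_rings_stable (fun q => if q == p then z else 0).
    by move=> q _; case: eqP => _ //; apply: local_ring0.
  exists g; last by have := gT p pp; rewrite eqxx.
  split=> // q qs; have := gT q (sub' _ qs); case: eqP => [qp|_].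
    by move: ps; rewrite -qp qs.
  by rewrite sub0r => /(subspaceN (local_ideal_subspace (TI q))); rewrite opprK.
by apply: tjurina_has_quot_dim; apply: spt.
Qed.

End StableDegree.

End QuotientBySaturation.

(** * Hilbert functions *)

Section HilbertFunction.
Variable K : fieldType.
Local Notation S := {mpoly K[3]}.
Local Open Scope classical_set_scope.
Implicit Types (g : S).

Definition degree_monomials n : seq 'X_{1..3} := 
  [seq s2m t | t : n.-tuple 'I_3 <- enum (basis 3 n)].

Definition shifted_monomials n m : seq 'X_{1..3} :=
  if (m <= n)%N then degree_monomials (n - m) else [::].

Lemma mem_shifted_monomials n m x :
  (x \in shifted_monomials n m) = (m <= n)%N && (mdeg x == n - m)%N.
Proof.
by rewrite /shifted_monomials; case: leqP => _ /=; rewrite ?in_nil // -basis_cover.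
Qed.

Lemma uniq_shifted_monomials n m : uniq (shifted_monomials n m).
Proof. by rewrite /shifted_monomials; case: ifP => // _; apply: uniq_basis. Qed.

Lemma size_shifted_monomials n m :
  size (shifted_monomials n m) = if (m <= n)%N then 'C(n - m + 2, 2) else 0%N.
Proof.
rewrite /shifted_monomials; case: ifP => // _; rewrite size_basis.
by rewrite -bin_sub ?leq_addr // addKn.
Qed.

Lemma sum_monomials_coef (s : seq 'X_{1..3}) (c : seq_sub s -> K) (x : seq_sub s) :
  (\sum_y c y *: 'X_[val y])@_(val x) = c x.
Proof.
rewrite raddf_sum /= (bigD1 x) //= mcoeffZ mcoeffX eqxx mulr1 big1 ?addr0 // => y yx.
by rewrite mcoeffZ mcoeffX (inj_eq val_inj) (negPf yx) mulr0.
Qed.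

Lemma homog_sub_monomials n m g : homog_sub n m g ->
  g = \sum_(y : seq_sub (shifted_monomials n m)) g@_(val y) *: 'X_[val y].
Proof.
case=> hg g0; apply/mpolyP => x.
have [xs|xs] := boolP (x \in shifted_monomials n m).
  by have := sum_monomials_coef (fun y => g@_(val y)) (SeqSub xs) => /= ->.
rewrite raddf_sum /= big1 => [|y _]; last first.
  rewrite mcoeffZ mcoeffX; case: eqP => [yx|]; last by rewrite mulr0.
  by rewrite -yx ssvalP in xs.
move: xs; rewrite mem_shifted_monomials negb_and; case: (leqP m n) => /= hmn.
  by move=> hx; apply: (dhomog_nemf_coeff hg).
by move=> _; rewrite g0 // mcoeff0.
Qed.

Lemma shifted_monomial_homog n m (y : seq_sub (shifted_monomials n m)) :
  homog_sub n m ('X_[val y] : S).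
Proof.
have := ssvalP y; rewrite mem_shifted_monomials => /andP[mn hy].
by apply/homog_subE => //; rewrite dhomogX.
Qed.

Lemma subspace_set0 (V : lmodType K) : subspace [set v : V | v = 0].
Proof. by split=> [|a u v -> ->] //=; rewrite scaler0 addr0. Qed.

Lemma has_quot_dim_homog n :
  has_quot_dim [set g : S | g \is n.-homog] [set g | g = 0] 'C(n + 2, 2).
Proof.
have hn g : g \is n.-homog -> homog_sub n 0 g by move=> hg; apply/homog_subE; rewrite ?subn0.
have -> : 'C(n + 2, 2) = #|{: seq_sub (shifted_monomials n 0)}|.
  by rewrite card_seq_sub ?uniq_shifted_monomials // size_shifted_monomials subn0.
apply: (@has_quot_dim_fin _ _ _ _ _ (fun y => 'X_[val y])).
- exact: subspace_set0.
- by move=> g /= ->; apply: rpred0.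
- by move=> y /=; case: (shifted_monomial_homog y) => + _; rewrite subn0.
- by move=> g /= /hn/homog_sub_monomials gE; exists (fun y => g@_(val y)); rewrite -gE subrr.
by move=> c /= c0 y; rewrite -(sum_monomials_coef c y) c0 mcoeff0.
Qed.

Lemma has_quot_dim_jacobian_ideal e n (f : S) : (forall i, f^`M(i) \is e.-homog) ->
    (forall t, (e <= n)%N -> AR f (n - e) t -> t = 0) ->
  has_quot_dim (homog_part (jacobian_ideal f) n) [set g | g = 0]
    (3 * (if (e <= n)%N then 'C(n - e + 2, 2) else 0)).
Proof.
move=> hfi hAR; set B := seq_sub (shifted_monomials n e).
have -> : (3 * (if (e <= n)%N then 'C(n - e + 2, 2) else 0))%N = #|{: 'I_3 * B}|.
  by rewrite card_prod card_ord card_seq_sub ?uniq_shifted_monomials // size_shifted_monomials.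
have sumE (c : 'I_3 * B -> K) : \sum_t c t *: ('X_[val t.2] * f^`M(t.1)) =
    \sum_i (\sum_y c (i, y) *: 'X_[val y]) * f^`M(i).
  transitivity (\sum_i \sum_(y : B) c (i, y) *: ('X_[val y] * f^`M(i))).
    by rewrite pair_bigA; apply: eq_bigr => -[].
  by apply: eq_bigr => i _; rewrite mulr_suml; apply: eq_bigr => y _; rewrite scalerAl.
apply: (@has_quot_dim_fin _ _ _ _ _ (fun t : 'I_3 * B => 'X_[val t.2] * f^`M(t.1))).
- exact: subspace_set0.
- by move=> g /= ->; split; [exact: jacobian_ideal0|exact: rpred0].
- move=> [i y]; split; first by apply: jacobian_idealM; apply: jacobian_ideal_deriv.
  by rewrite mulrC; apply: homog_sub_homog (hfi i); apply: shifted_monomial_homog.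
- move=> g [[h gE] hg]; have [c [hc gE']] := homog_comb hg hfi gE.
  exists (fun t => (c t.1)@_(val t.2)); apply/eqP; rewrite subr_eq0 sumE gE'; apply/eqP.
  by apply: eq_bigr => i _; rewrite {1}(homog_sub_monomials (hc i)).
move=> c /= c0 [i y]; have := ssvalP y; rewrite mem_shifted_monomials => /andP[en _].
pose t := [ffun k : 'I_3 => \sum_y c (k, y) *: ('X_[val y] : S)].
have : t = 0.
  apply: (hAR _ en); split=> [k|]; last first.
    by rewrite -[RHS]c0 sumE; apply: eq_bigr => k _; rewrite ffunE.
  rewrite ffunE; apply: rpred_sum => x _; apply: rpredZ.
  by case: (shifted_monomial_homog x).
move=> t0; have := congr1 (fun u : {ffun 'I_3 -> S} => u i) t0; rewrite /= !ffunE => ci0.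
by rewrite -(sum_monomials_coef (fun y => c (i, y)) y) ci0 mcoeff0.
Qed.

End HilbertFunction.

(** * Dimension count for the Jacobian module *)

Section JacobianModuleDimension.
Variable K : numClosedFieldType.
Local Notation S := {mpoly K[3]}.
Local Open Scope classical_set_scope.

Lemma jacobian_module_dim e r j (f : S) : f \is e.+1.-homog -> (0 < e)%N ->
    reduced_poly f -> f^`M(o0) != 0 -> (forall k t, (k < r)%N -> AR f k t -> t = 0) ->
    (2 * e - 2 <= j + r)%N -> (j < e + r)%N ->
  (quot_dim (homog_part (saturation (jacobian_ideal f)) j) (homog_part (jacobian_ideal f) j) +
   3 * (if (e <= j)%N then 'C(j - e + 2, 2) else 0) + global_tjurina f = 'C(j + 2, 2))%N.
Proof.
move=> hf e0 red f0 hAR hj1 hj2.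
have [ell hell [stable top]] := jacobian_structure hf e0 red f0.
have /choice[m /choice[L rp]] := root_product hell top.
have hfi := partial_homog hf.
have hJ0 : has_quot_dim (homog_part (jacobian_ideal f) j) [set g | g = 0]
    (3 * (if (e <= j)%N then 'C(j - e + 2, 2) else 0)).
  by apply: has_quot_dim_jacobian_ideal => // t ej; apply: hAR; lia.
have hS0 := has_quot_dim_homog K j.
have sS := homog_subspace K j; have sJ := jacobian_ideal_subspace f j.
have sJh := saturation_subspace hf hell top rp j; have s0 := @subspace_set0 K S.
have JS : homog_part (jacobian_ideal f) j `<=` [set g : S | g \is j.-homog] by move=> g [].
have JhS : homog_part (saturation (jacobian_ideal f)) j `<=` [set g : S | g \is j.-homog].
  by move=> g [].
have JJh : homog_part (jacobian_ideal f) j `<=` homog_part (saturation (jacobian_ideal f)) j.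
  by move=> g [Jg hg]; split=> //; apply: jacobian_sub_saturation.
have ZJ : [set g : S | g = 0] `<=` homog_part (jacobian_ideal f) j.
  by move=> g ->; case: sJ.
(* Dimensions add up along the chain formed by 0, the Jacobian ideal, its saturation and all forms
   in degree [j]. *)
have [n1 n1s [h1 h2]] := has_quot_dim_sub sS sJ s0 ZJ JS hS0.
rewrite (has_quot_dim_uniq s0 ZJ h1 hJ0) in n1s h2.
have [n2 n2s [h3 h4]] := has_quot_dim_sub sS sJh sJ JJh JhS h2.
rewrite (quot_dimE sJ JJh h3).
have hsat : has_quot_dim [set g : S | g \is j.-homog]
    (homog_part (saturation (jacobian_ideal f)) j) (global_tjurina f).
  apply: (has_quot_dim_saturation hf hell top rp (N0 := 3 * e)) => N h hjN hN hh.
  by apply: stable => // hj t; apply: hAR; lia.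
have := has_quot_dim_uniq sJh JhS h4 hsat; move: n1s n2s; clear.
by move: (3 * _)%N => u; move: 'C(j + 2, 2) => v; lia.
Qed.

End JacobianModuleDimension.

(** * The theorem *)

Section MinimalDegree.
Variable K : numClosedFieldType.
Local Notation S := {mpoly K[3]}.

(** A positive value is not the default of [xget], so it is a true minimum. *)
Lemma mdr_gt0 (f : S) k t : (0 < mdr f)%N -> (k < mdr f)%N -> AR f k t -> t = 0.
Proof.
rewrite /mdr; case: xgetP => [r -> [_ rmin]|_]; last by rewrite ltnn.
move=> _ kr hk; apply/eqP; apply: contraTT kr => t0.
by rewrite -leqNgt; apply: rmin hk t0.
Qed.

(** Otherwise [(1, 0, 0)] would be a syzygy of degree 0. *)
Lemma partial_neq0 (f : S) : (0 < mdr f)%N -> f^`M(o0) != 0.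
Proof.
move=> r0; apply/eqP => f0; pose t := [ffun i : 'I_3 => (i == o0)%:R : S].
have : t = 0.
  apply: (mdr_gt0 r0 r0); split=> [i|]; first by rewrite ffunE; case: eqP; rewrite ?dhomog1 ?rpred0.
  by rewrite sum_ord3 !ffunE /= f0 !mul0r mulr0 !addr0.
move=> /(congr1 (fun u : {ffun 'I_3 -> S} => u o0)); rewrite !ffunE /=.
by apply/eqP; rewrite oner_neq0.
Qed.

(* The Koszul syzygy [(f_1, - f_0, 0)] has degree [e]. *)
Lemma mdr_le e (f : S) : (0 < mdr f)%N -> f \is e.+1.-homog -> (mdr f <= e)%N.
Proof.
move=> r0 hf; rewrite leqNgt; apply/negP => er.
pose t := [ffun i : 'I_3 => if i == o0 then f^`M(o1) else if i == o1 then - f^`M(o0) else 0 : S].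
have : t = 0.
  apply: (mdr_gt0 r0 er); split=> [i|].
    by rewrite ffunE; do 2?case: eqP => _; rewrite ?rpredN ?rpred0 ?partial_homog.
  by rewrite sum_ord3 !ffunE /= mul0r addr0 mulNr mulrC subrr.
move=> /(congr1 (fun u : {ffun 'I_3 -> S} => u o1)); rewrite !ffunE /= => /eqP.
by rewrite oppr_eq0 (negPf (partial_neq0 r0)).
Qed.

Lemma bin2_double n : (2 * 'C(n + 2, 2) = (n + 2) * (n + 1))%N.
Proof.
by have := bin_ffact (n + 2) 2; rewrite !addn2 ffactnS ffactn1 addn1 /= mulnC.
Qed.

(** Doubled to clear the denominators of the binomials. With [s = j - e], the product
    [(s + 2) * (s + 1)] also gives the right value 0 for [s = -1] and [s = -2]; smaller [s] do not
    occur because [mdr f <= e]. *)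
Lemma jacobian_module_formula d (f : S) (j : int) : (0 < d)%N -> f \is d.-homog ->
    reduced_poly f -> (d <= 2 * mdr f)%N ->
    2 * d%:Z - 4 - (mdr f)%:Z <= j -> j <= d%:Z - 2 + (mdr f)%:Z ->
  2 * ((n_ f j)%:Z + (global_tjurina f)%:Z) =
    (j + 2) * (j + 1) - 3 * ((j - d%:Z + 3) * (j - d%:Z + 2)).
Proof.
case: d => // e _ hf red dr; have r0 : (0 < mdr f)%N by lia.
have re := mdr_le r0 hf; set r := mdr f in r0 dr re *.
have e0 : (0 < e)%N by lia.
have key (k : nat) : (2 * e - 2 <= k + r)%N -> (k < e + r)%N ->
    2 * ((n_ f k)%:Z + (global_tjurina f)%:Z) =
    (k%:Z + 2) * (k%:Z + 1) - 3 * ((k%:Z - e.+1%:Z + 3) * (k%:Z - e.+1%:Z + 2)).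
  move=> h1 h2; have := jacobian_module_dim hf e0 red (partial_neq0 r0)
    (fun k t => @mdr_gt0 f k t r0) h1 h2.
  rewrite /n_; set q := quot_dim _ _; have := bin2_double k.
  move: 'C(k + 2, 2) (global_tjurina f) => C tau hC.
  case: (leqP e k) => hk.
    move: (subnK hk) hC; move: (k - e)%N (bin2_double (k - e)) => s.
    move: 'C(s + 2, 2) => C' hC' <-; move: hC'; clear; lia.
  have : e = k.+1 \/ e = k.+2 by move: h1 re hk; clear; lia.
  by move: hC; clear => hC [->|->]; lia.
case: j => [k|k] h1 h2.
  by apply: key; move: h1 h2; clear; lia.
(* The only negative degree in the range is -1, for a conic with [r = 1]. The formula in degree 1
   then says that the Tjurina number is 0, which is the claim in degree -1. *)
have [k0 e1 r1] : [/\ k = 0%N, e = 1%N & r = 1%N].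
  by move: h1 re e0 r0; clear; rewrite NegzE; split; lia.
have := key 1%N; rewrite k0 e1 r1 /=; move: (n_ f 1%N) (global_tjurina f); clear.
move=> a b /(_ isT isT); lia.
Qed.

End MinimalDegree.

Theorem theorem3p1 (R : realType) (d : nat) (f : {mpoly R[i][3]})
    (d_gt0 : (0 < d)%N) (f_homog : f \is d.-homog) (f_red : reduced_poly f)
    (r_ge : d%:R / 2 <= (mdr f)%:R :> rat)
    (j : int)
    (j_ge : 2 * d%:Z - 4 - (mdr f)%:Z <= j)
    (j_le : j <= d%:Z - 2 + (mdr f)%:Z) :
  (forall d' : nat, d = (2 * d' + 1)%N ->
    [/\ socle_degree d = 6 * d'%:Z - 3,
        (n_ f j)%:Z = 3 * d'%:Z ^+ 2
                      - (j - 3 * d'%:Z + 2) * (j - 3 * d'%:Z + 1)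
                      - (global_tjurina f)%:Z
      & (n_ f j)%:Z = (nu f d)%:Z
                      - (j - Num.floor ((socle_degree d)%:~R / 2 : rat))
                        * (j - Num.ceil ((socle_degree d)%:~R / 2 : rat))]) /\
  (forall d' : nat, d = (2 * d')%N ->
    [/\ socle_degree d = 6 * d'%:Z - 6,
        (n_ f j)%:Z = 3 * d'%:Z ^+ 2 - 3 * d'%:Z + 1
                      - (j - 3 * d'%:Z + 3) ^+ 2
                      - (global_tjurina f)%:Z
      & (n_ f j)%:R = (nu f d)%:R
                      - (j%:~R - (socle_degree d)%:~R / 2) ^+ 2 :> rat]).
Proof.
have dr : (d <= 2 * mdr f)%N.
  by move: r_ge; rewrite ler_pdivrMr // -natrM ler_nat mulnC.
have formula (i : int) := jacobian_module_formula (j := i) d_gt0 f_homog f_red dr.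
have nj := formula j j_ge j_le.
split=> d' dE.
  have TE : socle_degree d = 6 * d'%:Z - 3 by rewrite /socle_degree dE; lia.
  have halfE : (socle_degree d)%:~R / 2 = 3 * d'%:R - 3 / 2 :> rat.
    by rewrite TE rmorphB rmorphM /=; field.
  have floorE : Num.floor ((socle_degree d)%:~R / 2 : rat) = 3 * d'%:Z - 2.
    by apply: floor_def; rewrite halfE; apply/andP; split; rewrite !(rmorphD, rmorphB, rmorphM) /=; lra.
  have ceilE : Num.ceil ((socle_degree d)%:~R / 2 : rat) = 3 * d'%:Z - 1.
    by apply: ceil_def; rewrite halfE; apply/andP; split; rewrite !(rmorphB, rmorphM) /=; lra.
  (* Here [r >= d / 2] allows [nu] to be evaluated by the same formula. *)
  have [h1 h2] : 2 * d%:Z - 4 - (mdr f)%:Z <= 3 * d'%:Z - 2 /\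
      3 * d'%:Z - 2 <= d%:Z - 2 + (mdr f)%:Z.
    by move: dE dr; clear; lia.
  have nf := formula _ h1 h2; rewrite /nu floorE ceilE.
  split; first exact: TE.
    move: nj; rewrite dE PoszD PoszM expr2; move: (n_ f j) (global_tjurina f); clear.
    by move=> a t; lia.
  move: nj nf; rewrite dE PoszD PoszM.
  by move: (n_ f j) (n_ f (3 * d'%:Z - 2)) (global_tjurina f); clear => a b t; lia.
have TE : socle_degree d = 6 * d'%:Z - 6 by rewrite /socle_degree dE; lia.
have halfE : (socle_degree d)%:~R / 2 = (3 * d'%:Z - 3)%:~R :> rat.
  by rewrite TE !rmorphB !rmorphM /=; field.
have floorE : Num.floor ((socle_degree d)%:~R / 2 : rat) = 3 * d'%:Z - 3.
  by rewrite halfE intrKfloor.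
have [h1 h2] : 2 * d%:Z - 4 - (mdr f)%:Z <= 3 * d'%:Z - 3 /\
    3 * d'%:Z - 3 <= d%:Z - 2 + (mdr f)%:Z.
  by move: dE dr; clear; lia.
have nf := formula _ h1 h2; rewrite /nu floorE halfE -rmorphB -rmorphXn.
have E : (n_ f j)%:Z = (n_ f (3 * d'%:Z - 3))%:Z - (j - (3 * d'%:Z - 3)) ^+ 2 /\
    (n_ f j)%:Z = 3 * d'%:Z ^+ 2 - 3 * d'%:Z + 1 - (j - 3 * d'%:Z + 3) ^+ 2
                      - (global_tjurina f)%:Z.
  move: nj nf; rewrite dE PoszM !expr2.
  by move: (n_ f j) (n_ f (3 * d'%:Z - 3)) (global_tjurina f); clear => a b t; split; lia.
case: E => E1 E2; split=> //.
by have /(congr1 (fun i : int => i%:~R : rat)) := E1; rewrite rmorphB.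
Qed.
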